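(* Let $l_1,l_2,l_3>0$. The oriented moduli space $M$ of $3$-arms in $\mathbb{R}^3$ with edge lengths $l_1,l_2,l_3$ is (homeomorphic to) a $3$-sphere, and the signed volume $V=[b_1,b_2,b_3]$ is an exact topological Morse function on $M$ with precisely two Morse critical points.
   Context: A $3$-arm is a sequence of points $(p_1,p_2,p_3,p_4)$ in $\mathbb{R}^3$ with $|p_{i+1}-p_i|=l_i$ for $i=1,2,3$; its arm vectors are $b_i=p_{i+1}-p_i$. The oriented moduli space $M$ is the set of all such sequences modulo the action of orientation preserving isometries of $\mathbb{R}^3$, with the quotient topology; equivalently $M=\{(b_1,b_2,b_3): |b_i|=l_i\}/SO(3)$. The signed volume is the triple product $V=[b_1,b_2,b_3]=\det(b_1,b_2,b_3)$, which descends to $M$. A continuous function $f$ on a topological $m$-manifold is topologically regular at a point if in some local topological chart around that point $f$ is (up to an additive constant) a coordinate function; a point is a (topological) Morse critical point of index $\lambda$ if in some local topological chart centred at it $f=f(0)-\sum_{i\le\lambda}x_i^2+\sum_{i>\lambda}x_i^2$. $f$ is a topological Morse function if each point is either topologically regular or a topological Morse critical point; it is exact (perfect) if the number of critical points of each index $\lambda$ equals the $\lambda$-th Betti number of the manifold. *)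

(* Defs.v *)
From HB Require Import structures.
From mathcomp Require Import all_boot all_order all_algebra.
From mathcomp Require Import all_classical all_reals all_analysis.
From mathcomp Require Import finmap.
(* The notations of monalg clash with those of mathcomp-analysis. *)
From mathcomp Require Import -(notations) monalg.

Set Implicit Arguments.
Unset Strict Implicit.
Unset Printing Implicit Defensive.

Import Order.TTheory GRing.Theory Num.Theory.
Import numFieldNormedType.Exports.

Local Open Scope classical_set_scope.
Local Open Scope quotient_scope.
Local Open Scope ring_scope.

(* The library norm on ['rV[R]_n] is the sup norm; it induces the same topology. *)
Definition euclidean_norm (R : realType) (n : nat) (x : 'rV[R]_n) : R :=
  Num.sqrt (\sum_(i < n) x 0 i ^+ 2).

Definition sphere (R : realType) (n : nat) : set 'rV[R]_n.+1 :=
  [set x | euclidean_norm x = 1].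
Arguments sphere : clear implicits.

Definition homeomorphic (X Y : topologicalType) : Prop :=
  exists (f : X -> Y) (g : Y -> X),
    [/\ continuous f, continuous g, cancel f g & cancel g f].

Section TopologicalMorse.
Variables (R : realType) (m : nat) (X : topologicalType).
Implicit Types (U : set X) (phi : X -> 'rV[R]_m) (f : X -> R) (p : X).

(* [phi] restricts to a homeomorphism from [U] onto an open subset of R^m; its
   values outside [U] are irrelevant. *)
Definition local_chart U phi : Prop :=
  exists psi : 'rV[R]_m -> X,
    [/\ open U /\ open (phi @` U), {in U, continuous phi},
        {in phi @` U, continuous psi} & {in U, cancel phi psi}].

Definition topological_manifold : Prop :=
  [/\ hausdorff_space X, @second_countable X &
      forall p, exists U phi, U p /\ local_chart U phi].

Definition topologically_regular f p : Prop :=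
  exists U phi, [/\ U p, local_chart U phi &
    exists (i : 'I_m) (c : R), {in U, forall x, f x = phi x 0 i + c}].

Definition morse_critical f (lambda : nat) p : Prop :=
  (lambda <= m)%N /\
  exists U phi, [/\ U p, local_chart U phi, phi p = 0 &
    {in U, forall x, f x = f p
      - \sum_(i < m | (i < lambda)%N) phi x 0 i ^+ 2
      + \sum_(i < m | (lambda <= i)%N) phi x 0 i ^+ 2}].

Definition topological_morse f : Prop :=
  [/\ topological_manifold, continuous f &
      forall p, topologically_regular f p \/
                exists lambda, morse_critical f lambda p].

End TopologicalMorse.

Definition std_simplex (R : realType) (n : nat) : set 'rV[R]_n.+1 :=
  [set x | (forall i, 0 <= x 0 i) /\ \sum_(i < n.+1) x 0 i = 1].
Arguments std_simplex : clear implicits.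

Section FaceMaps.
Variables (R : realType) (n : nat) (i : 'I_n.+2).

(* Inserts a zero coordinate at position [i]. *)
Definition face_row (x : 'rV[R]_n.+1) : 'rV[R]_n.+2 :=
  \row_j (if unlift i j is Some k then x 0 k else 0).

Lemma face_row_simplex (x : 'rV[R]_n.+1) :
  std_simplex R n x -> std_simplex R n.+1 (face_row x).
Proof.
move=> [x0 x1]; split=> [j|].
  by rewrite mxE; case: unliftP => [k _|_].
rewrite (bigD1_ord i) //= mxE unlift_none add0r -x1.
by apply: eq_bigr => k _; rewrite mxE liftK.
Qed.

Definition face_map (x : std_simplex R n) :
    std_simplex R n.+1 :=
  exist _ (face_row (set_val x)) (mem_set (face_row_simplex (set_valP x))).

End FaceMaps.

Section FaceContinuous.
Variables (R : realType) (n : nat) (i : 'I_n.+2).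

Lemma face_map_continuous : continuous (@face_map R n i).
Proof.
apply: continuous_comp_initial => x U [P Px PU].
have coord_i (j : 'I_n.+2) : \forall y \near x, P 0 j (face_row i (set_val y) 0 j).
  have Pj : nbhs (face_row i (set_val x) 0 j) (P 0 j) by exact: Px.
  have [k jE|jE] := unliftP i j.
    have face_k (y : std_simplex R n) :
        face_row i (set_val y) 0 j = set_val y 0 k by rewrite mxE jE liftK.
    rewrite face_k in Pj.
    have Pk : nbhs x ((fun y : std_simplex R n => set_val y 0 k) @^-1` P 0 j).
      exact: (@initial_continuous _ _ set_val x _ (@coord_continuous R _ _ 0 k _ _ Pj)).
    by apply: filterS Pk => y; rewrite face_k.
  have face_i (y : std_simplex R n) :
      face_row i (set_val y) 0 j = 0 by rewrite mxE jE unlift_none.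
  rewrite face_i in Pj.
  by near=> y; rewrite face_i; exact: nbhs_singleton Pj.
have FF : Filter (nbhs x) by exact: nbhs_filter.
have := filter_forall FF coord_i; apply: filterS => y Py; apply: PU => i0 j.
by rewrite (ord1 i0); exact: Py.
Unshelve. all: by end_near. Qed.

HB.instance Definition _ := @isContinuous.Build _ _ (@face_map R n i) face_map_continuous.

End FaceContinuous.

Section SingularHomology.
Variables (R : realType) (X : topologicalType).

Definition singular_simplex (n : nat) : choiceType :=
  continuousType (std_simplex R n) X.

Definition face (n : nat) (i : 'I_n.+2) (s : singular_simplex n.+1) :
    singular_simplex n :=
  [the continuousType _ _ of s \o face_map i].

(* The rational vector space with basis the singular [n]-simplices. *)
Definition singular_chain (n : nat) := malg (singular_simplex n) rat.

Definition boundary (n : nat) (c : singular_chain n.+1) : singular_chain n :=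
  \sum_(s <- msupp c) mcoeff s c *:
    \sum_(i < n.+2) (-1) ^+ i *: mkmalgU (face i s) 1.

Definition is_cycle (n : nat) : singular_chain n -> Prop :=
  match n with
  | 0 => fun=> True
  | n'.+1 => fun c => boundary c = 0
  end.

Definition is_boundary (n : nat) (c : singular_chain n) : Prop :=
  exists d : singular_chain n.+1, c = boundary d.

(* [b] is the dimension of H_n(X; Q): some [b] cycles represent a basis of it. *)
Definition is_betti_number (n b : nat) : Prop :=
  exists z : 'I_b -> singular_chain n,
    [/\ forall i, is_cycle (z i),
        forall a : 'I_b -> rat,
          is_boundary (\sum_(i < b) a i *: z i) -> forall i, a i = 0
      & forall c, is_cycle c ->
          exists a : 'I_b -> rat, is_boundary (c - \sum_(i < b) a i *: z i)].

End SingularHomology.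

Definition exact_morse (R : realType) (m : nat) (X : topologicalType)
    (f : X -> R) : Prop :=
  forall lambda, (lambda <= m)%N ->
    exists b, ([set p | morse_critical m f lambda p] #= `I_b)%card /\
              is_betti_number R X lambda b.

Section Arms.
Variables (R : realType) (l : 'I_3 -> R).

(* The rows of [p] are the four points of the arm. *)
Definition arm_vector (p : 'M[R]_(4, 3)) (i : 'I_3) : 'rV[R]_3 :=
  row (lift ord0 i) p - row (widen_ord (leqnSn 3) i) p.

Definition arms : set 'M[R]_(4, 3) :=
  [set p | forall i, euclidean_norm (arm_vector p i) = l i].

(* An orientation preserving isometry of R^3 acts on row vectors by an element
   of SO(3) on the right followed by a translation. *)
Definition orientation_preserving_isometry (g : 'rV[R]_3 -> 'rV[R]_3) : Prop :=
  exists (Q : 'M[R]_3) (v : 'rV[R]_3),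
    [/\ Q *m Q^T = 1%:M, \det Q = 1 & forall x, g x = x *m Q + v].

Definition congruent (p q : arms) : Prop :=
  exists2 g, orientation_preserving_isometry g &
    forall i, row i (set_val q) = g (row i (set_val p)).

Lemma congruent_refl p : congruent p p.
Proof.
exists id => //; exists 1%:M, 0; split; rewrite ?trmx1 ?mulmx1 ?det1 //.
by move=> x; rewrite mulmx1 addr0.
Qed.

Lemma congruent_sym p q : congruent p q -> congruent q p.
Proof.
move=> [g [Q [v [QQ dQ gE]]] pq].
have QtQ : Q^T *m Q = 1%:M by exact: mulmx1C.
exists (fun x => x *m Q^T - v *m Q^T).
  by exists Q^T, (- (v *m Q^T)); rewrite trmxK det_tr.
by move=> i; rewrite pq gE mulmxDl addrK -mulmxA QQ mulmx1.
Qed.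

Lemma congruent_trans p q r : congruent p q -> congruent q r -> congruent p r.
Proof.
move=> [g [Q [v [QQ dQ gE]]] pq] [h [S [w [SS dS hE]]] qr].
exists (h \o g) => [|i]; last by rewrite qr pq.
exists (Q *m S), (v *m S + w); split.
- by rewrite trmx_mul mulmxA -(mulmxA Q) SS mulmx1.
- by rewrite det_mulmx dQ dS mulr1.
- by move=> x; rewrite /= gE hE mulmxDl mulmxA addrA.
Qed.

Definition congruentb (p q : arms) : bool := `[< congruent p q >].

Lemma congruentb_refl : reflexive congruentb.
Proof. by move=> p; apply/asboolP/congruent_refl. Qed.

Lemma congruentb_sym : symmetric congruentb.
Proof. by move=> p q; apply/asboolP/asboolP; exact: congruent_sym. Qed.

Lemma congruentb_trans : transitive congruentb.
Proof.
move=> q p r /asboolP pq /asboolP qr.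
by apply/asboolP; exact: congruent_trans pq qr.
Qed.

Canonical congruentb_equiv :=
  EquivRel congruentb congruentb_refl congruentb_sym congruentb_trans.

Definition moduli_space : topologicalType :=
  quotient_topology {eq_quot congruentb}.

Definition arm_volume (p : 'M[R]_(4, 3)) : R :=
  \det (\matrix_(i < 3) arm_vector p i).

Definition signed_volume (x : moduli_space) : R := arm_volume (set_val (repr x)).

Lemma arm_volume_congruent (p q : arms) :
  congruent p q -> arm_volume (set_val p) = arm_volume (set_val q).
Proof.
move=> [g [Q [v [_ dQ gE]]] pq].
rewrite /arm_volume; set B := (X in _ = \det X); set A := \matrix_i _.
suff -> : B = A *m Q by rewrite det_mulmx dQ mulr1.
apply/row_matrixP => i; rewrite row_mul !rowK /arm_vector !pq !gE.
by rewrite opprD addrACA subrr addr0 mulmxBl.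
Qed.

Lemma signed_volume_pi (p : arms) :
  signed_volume (\pi_moduli_space p) = arm_volume (set_val p).
Proof.
apply: arm_volume_congruent; apply/asboolP.
by apply/(@eqmodP _ congruentb_equiv); rewrite reprK.
Qed.

End Arms.

(* Main.v *)
(** Up to congruence a 3-arm is determined by the Gram entries [a], [b], [c] of its unit
arm vectors and by their determinant [D], which satisfy [D^2 = 1 - (q - 2abc)] with
[q = a^2 + b^2 + c^2].  On the cube [|a|, |b|, |c| <= 1] one has [3abc <= q], so [q - 2abc]
increases strictly along rays from the origin, and it is at least 1 on the boundary.
Rescaling [(a, b, c)] to squared length [1 - D^2] therefore maps the compact moduli space
bijectively onto the unit sphere of [R^4], and turns the signed volume into a multiple of
the last coordinate.

Away from the poles that coordinate belongs to a graph chart; at the poles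
[x' sqrt L / sqrt (1 + |x_3|)] is a Morse chart.  Other indices are excluded by the local
behaviour of the sublevel set: extrema for 0 and 3, a disconnected sublevel (or superlevel)
set for 1 and 2.

The Betti numbers follow from Mayer-Vietoris applied to the sets of points with a nonzero
coordinate among the first [k]: the next one is the union of two open hemispheres, star-shaped
up to radial projection, that meet in the previous one.  The small-chain lemma behind it uses
barycentric subdivision, where affine simplices are encoded by stochastic matrices. *)
Require Import Defs.
From HB Require Import structures.
From mathcomp Require Import all_boot all_order all_algebra.
From mathcomp Require Import all_classical all_reals all_analysis.
From mathcomp Require Import finmap.
From mathcomp Require Import -(notations) monalg.
From mathcomp Require Import ring lra zify.

Set Implicit Arguments.
Unset Strict Implicit.
Unset Printing Implicit Defensive.

Import Order.TTheory GRing.Theory Num.Theory.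
Import numFieldNormedType.Exports.

Local Open Scope classical_set_scope.
Local Open Scope ring_scope.

(** * Chains over stochastic matrices *)

(** Arms with collinear vectors are fixed by rotations about their line, so the action is not free
    and gives no evident chart of the quotient there. A single global map to R^4 treats these arms
    like all others, and compactness makes its inverse continuous without any formula for it.

    The inverse is used as a map [N] on all nonzero vectors, constant on rays. Charts, segments and
    cones are written in linear coordinates and carried back by [N], so the moduli space itself
    needs no linear structure.

    The Gram entries see only the square of the determinant. SO(3), unlike O(3), preserves its sign,
    hence the fourth coordinate is the determinant itself and mirror arms lie on opposite sides of
    the equator.

    Betti numbers refer to singular chains, so they are computed at chain level. Chains are indexed
    by their number of vertices and the empty simplex is kept: this yields reduced homology, and the
    induction can start at the empty set, the sphere of dimension -1. *)

HB.lock Definition lext (K : choiceType) (V : lmodType rat) (f : K -> V)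
    (c : malg K rat) : V :=
  \sum_(s <- msupp c) mcoeff s c *: f s.

Section FreeModule.
Variable K : choiceType.
Implicit Types (P Q : K -> Prop) (c : malg K rat).

Lemma lextEw (V : lmodType rat) (f : K -> V) c (d : {fset K}) :
  {subset msupp c <= d} -> lext f c = \sum_(s <- d) mcoeff s c *: f s.
Proof.
move=> cd; rewrite lext.unlock; apply: big_fset_incl; first exact/fsubsetP.
by move=> s _ sc; rewrite mcoeff_outdom ?scale0r.
Qed.

Lemma lext_is_linear (V : lmodType rat) (f : K -> V) : linear (lext f).
Proof.
move=> a c1 c2.
pose d := (msupp c1 `|` msupp c2)%fset.
rewrite !(@lextEw _ f _ d) /d; last 3 first.
- by move=> s sc; rewrite in_fsetU sc orbT.
- by move=> s sc; rewrite in_fsetU sc.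
- move=> s; rewrite -mcoeff_neq0 mcoeffD mcoeffZ in_fsetU; apply: contraR.
  by rewrite negb_or => /andP[s1 s2]; rewrite !mcoeff_outdom // mulr0 addr0.
rewrite scaler_sumr -big_split /=; apply: eq_bigr => s _.
by rewrite mcoeffD mcoeffZ scalerDl scalerA.
Qed.

HB.instance Definition _ (V : lmodType rat) (f : K -> V) :=
  GRing.isLinear.Build rat (malg K rat) V *:%R (lext f) (lext_is_linear f).

Lemma lextU (V : lmodType rat) (f : K -> V) s : lext f (mkmalgU s 1) = f s.
Proof.
by rewrite lext.unlock msuppU oner_eq0 big_seq_fset1 mcoeffUU scale1r.
Qed.

Lemma lext_sum (V : lmodType rat) (f : K -> V) (I : Type) (r : seq I) a (k : I -> K) :
  lext f (\sum_(i <- r) a i *: mkmalgU (k i) 1) = \sum_(i <- r) a i *: f (k i).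
Proof. by rewrite linear_sum; apply: eq_bigr => i _; rewrite linearZ /= lextU. Qed.

Lemma lext_id c : lext (fun s => mkmalgU s 1) c = c.
Proof.
apply/malgP => k; rewrite [in RHS](monalgE c) lext.unlock !raddf_sum /=.
apply: eq_bigr => s _.
by rewrite mcoeffZ !mcoeffU mulrnAr mulr1.
Qed.

Definition supp P c := forall s, s \in msupp c -> P s.

(** Chain identities are checked on single simplices. The restriction to simplices satisfying [P]
    serves the topological cone, whose boundary formula holds only for simplices that can be coned
    off. *)
Lemma eq_linear_supp P (V : lmodType rat) (g h : {linear malg K rat -> V}) c :
  supp P c -> (forall s, P s -> g (mkmalgU s 1) = h (mkmalgU s 1)) -> g c = h c.
Proof.
move=> Pc gh; rewrite -(lext_id c) lext.unlock !linear_sum /=.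
apply: eq_big_seq => s sc.
by rewrite !linearZ /= gh //; exact: Pc.
Qed.

Lemma eq_linear (V : lmodType rat) (g h : {linear malg K rat -> V}) :
  (forall s, g (mkmalgU s 1) = h (mkmalgU s 1)) -> g =1 h.
Proof. by move=> gh c; apply: (@eq_linear_supp (fun=> True)). Qed.

Lemma supp0 P : supp P 0.
Proof. by move=> s; rewrite msupp0. Qed.

Lemma suppD P c1 c2 : supp P c1 -> supp P c2 -> supp P (c1 + c2).
Proof.
move=> P1 P2 s; rewrite -mcoeff_neq0 mcoeffD => h.
have [/P1//|s1] := boolP (s \in msupp c1).
have [/P2//|s2] := boolP (s \in msupp c2).
by rewrite !mcoeff_outdom // addr0 eqxx in h.
Qed.

Lemma suppZ P a c : supp P c -> supp P (a *: c).
Proof.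
move=> Pc s; rewrite -mcoeff_neq0 mcoeffZ => h; apply: Pc.
by apply: contraR h => h; rewrite mcoeff_outdom ?mulr0.
Qed.

Lemma suppN P c : supp P c -> supp P (- c).
Proof. by rewrite -scaleN1r; exact: suppZ. Qed.

Lemma suppB P c1 c2 : supp P c1 -> supp P c2 -> supp P (c1 - c2).
Proof. by move=> ? ?; apply: suppD => //; exact: suppN. Qed.

Lemma supp_sum P (I : Type) (r : seq I) (F : I -> malg K rat) :
  (forall i, supp P (F i)) -> supp P (\sum_(i <- r) F i).
Proof.
by move=> PF; elim/big_rec: _ => [|i x _]; [exact: supp0|exact: suppD].
Qed.

Lemma supp_sum_seq P (I : eqType) (r : seq I) (F : I -> malg K rat) :
  (forall i, i \in r -> supp P (F i)) -> supp P (\sum_(i <- r) F i).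
Proof.
move=> PF; rewrite big_seq.
by elim/big_rec: _ => [|i x ir]; [exact: supp0|apply: suppD; exact: PF].
Qed.

Lemma suppU P s : P s -> supp P (mkmalgU s 1).
Proof. by move=> Ps t; rewrite msuppU oner_eq0 in_fset1 => /eqP->. Qed.

Lemma sub_supp P Q c : (forall s, P s -> Q s) -> supp P c -> supp Q c.
Proof. by move=> PQ Pc s /Pc /PQ. Qed.

Lemma supp_split P Q c : supp (fun s => P s \/ Q s) c ->
  exists c1 c2, [/\ supp P c1, supp Q c2 & c = c1 + c2].
Proof.
move=> PQ; exists (\sum_(s <- msupp c | `[< P s >]) mcoeff s c *: mkmalgU s 1).
exists (\sum_(s <- msupp c | ~~ `[< P s >]) mcoeff s c *: mkmalgU s 1); split.
- elim/big_rec: _ => [|s x /asboolP Ps Px]; first exact: supp0.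
  by apply: suppD => //; apply: suppZ; apply: suppU.
- rewrite big_seq_cond; elim/big_rec: _ => [|s x]; first exact: supp0.
  move=> /andP[sc /asboolPn nP] Px.
  by apply: suppD => //; apply: suppZ; apply: suppU; case: (PQ s sc).
- have := lext_id c; rewrite lext.unlock (bigID (fun s => `[< P s >])) /=; exact: esym.
Qed.

End FreeModule.

Lemma supp_lext (K L : choiceType) (P : K -> Prop) (Q : L -> Prop)
    (f : K -> malg L rat) c :
  (forall s, P s -> supp Q (f s)) -> supp P c -> supp Q (lext f c).
Proof.
by move=> PQ Pc; rewrite lext.unlock; apply: supp_sum_seq => s /Pc/PQ h; exact: suppZ.
Qed.

(** * Affine maps between simplices *)

Section StochasticMatrices.
Variable R : realType.

(** Such a matrix is an affine map from the simplex with [n] vertices to the one with [m] vertices: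
    row [i] holds the barycentric coordinates of the image of vertex [i]. Composition is the matrix
    product, and a face inclusion is the identity matrix with one row removed. *)
Definition stochastic n m (M : 'M[R]_(n, m)) : bool :=
  [forall i, [forall j, 0 <= M i j] && (\sum_j M i j == 1)].

Lemma stochasticP n m (M : 'M[R]_(n, m)) :
  reflect (forall i, (forall j, 0 <= M i j) /\ \sum_j M i j = 1) (stochastic M).
Proof.
apply: (iffP forallP) => h i.
  by have /andP[/forallP h1 /eqP h2] := h i.
by have [h1 h2] := h i; apply/andP; split; [exact/forallP|exact/eqP].
Qed.

Record smx n m := SMx { smx_val :> 'M[R]_(n, m); smxP : stochastic smx_val }.

HB.instance Definition _ n m := [isSub for @smx_val n m].
HB.instance Definition _ n m := [Choice of smx n m by <:].

Lemma smx_inj n m : injective (@smx_val n m).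
Proof. exact: val_inj. Qed.

Lemma smul_subproof n m p (M : smx n m) (N : smx m p) : stochastic (M *m N).
Proof.
apply/stochasticP => i.
have /stochasticP/(_ i)[M0 M1] := smxP M; have /stochasticP hN := smxP N.
split=> [j|].
  by rewrite mxE sumr_ge0 // => k _; rewrite mulr_ge0 //; case: (hN k).
rewrite -M1 (eq_bigr (fun j => \sum_k M i k * N k j)); last first.
  by move=> j _; rewrite mxE.
rewrite exchange_big /=; apply: eq_bigr => k _.
by rewrite -mulr_sumr; have [_ ->] := hN k; rewrite mulr1.
Qed.
Definition smul n m p (M : smx n m) (N : smx m p) := SMx (smul_subproof M N).

Lemma sid_subproof n : stochastic (1%:M : 'M[R]_n).
Proof.
apply/stochasticP => i; split=> [j|]; first by rewrite mxE ler0n.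
rewrite (bigD1 i) //= mxE eqxx big1 ?addr0 // => j ji.
by rewrite mxE eq_sym (negPf ji).
Qed.
Definition sid n := SMx (sid_subproof n).

Lemma srow'_subproof n m i (M : smx n.+1 m) : stochastic (row' i M : 'M[R]_(n, m)).
Proof.
have /stochasticP hM := smxP M; apply/stochasticP => k.
split=> [j|]; first by rewrite mxE; case: (hM (lift i k)).
by rewrite -(hM (lift i k)).2; apply: eq_bigr => j _; rewrite mxE.
Qed.
Definition srow' n m i (M : smx n.+1 m) := SMx (srow'_subproof i M).

Definition sface n (i : 'I_n.+1) : smx n n.+1 := srow' i (sid n.+1).

Lemma col_mx_ord0 n m (b : 'rV[R]_m) (M : 'M[R]_(n, m)) j :
  (col_mx b M : 'M[R]_(n.+1, m)) ord0 j = b 0 j.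
Proof.
by rewrite -[RHS](col_mxEu b M 0 j); congr (fun_of_matrix _ _ _); exact: val_inj.
Qed.

Lemma col_mx_lift n m (b : 'rV[R]_m) (M : 'M[R]_(n, m)) k j :
  (col_mx b M : 'M[R]_(n.+1, m)) (lift ord0 k) j = M k j.
Proof.
by rewrite -[RHS](col_mxEd b M k j); congr (fun_of_matrix _ _ _); exact: val_inj.
Qed.

Lemma scone_subproof n m (b : smx 1 m) (M : smx n m) :
  stochastic (col_mx b M : 'M[R]_(n.+1, m)).
Proof.
have /stochasticP hM := smxP M; have /stochasticP hb := smxP b.
apply/stochasticP => i; have [k ->|->] := unliftP ord0 i.
  split=> [j|]; first by rewrite col_mx_lift; case: (hM k).
  by rewrite -(hM k).2; apply: eq_bigr => j _; rewrite col_mx_lift.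
split=> [j|]; first by rewrite col_mx_ord0; case: (hb 0).
by rewrite -(hb 0).2; apply: eq_bigr => j _; rewrite col_mx_ord0.
Qed.
(** The apex comes first, so face 0 of the cone is [M] with sign +1 and the other faces are cones
    over the faces of [M]. *)
Definition scone n m (b : smx 1 m) (M : smx n m) : smx n.+1 m :=
  SMx (scone_subproof b M).

Lemma sbary_subproof n : stochastic (const_mx n.+1%:R^-1 : 'M[R]_(1, n.+1)).
Proof.
apply/stochasticP => i; split=> [j|]; first by rewrite mxE invr_ge0 ler0n.
rewrite (eq_bigr (fun=> n.+1%:R^-1)); last by move=> j _; rewrite mxE.
by rewrite sumr_const card_ord -(mulr_natr n.+1%:R^-1) mulVf ?pnatr_eq0.
Qed.
Definition sbary n := SMx (sbary_subproof n).

Lemma smulA n m p q (A : smx n m) (B : smx m p) (C : smx p q) :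
  smul A (smul B C) = smul (smul A B) C.
Proof. by apply: smx_inj; rewrite /= mulmxA. Qed.

Lemma smul1l n m (A : smx n m) : smul (sid n) A = A.
Proof. by apply: smx_inj; rewrite /= mul1mx. Qed.

Lemma smul1r n m (A : smx n m) : smul A (sid m) = A.
Proof. by apply: smx_inj; rewrite /= mulmx1. Qed.

Lemma row'E n m (i : 'I_n.+1) (M : 'M[R]_(n.+1, m)) :
  row' i M = row' i 1%:M *m M.
Proof.
apply/matrixP => k j; rewrite !mxE (bigD1 (lift i k)) //= !mxE eqxx mul1r.
by rewrite big1 ?addr0 // => l lk; rewrite !mxE eq_sym (negPf lk) mul0r.
Qed.

Lemma sface_mul n m i (M : smx n.+1 m) : smul (sface i) M = srow' i M.
Proof. by apply: smx_inj; rewrite /= [RHS]row'E. Qed.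

Lemma sface0_cone n m (b : smx 1 m) (M : smx n m) : smul (sface ord0) (scone b M) = M.
Proof.
rewrite sface_mul; apply: smx_inj; apply/matrixP => k j /=.
by rewrite mxE col_mx_lift.
Qed.

Lemma sface_cone n m (b : smx 1 m) (M : smx n.+1 m) i :
  smul (sface (lift ord0 i)) (scone b M) = scone b (smul (sface i) M).
Proof.
rewrite !sface_mul; apply: smx_inj; apply/matrixP => k j /=; rewrite mxE.
have [l ->|->] := unliftP ord0 k.
  have -> : lift (lift ord0 i) (lift ord0 l) = lift ord0 (lift i l).
    by apply: val_inj; rewrite /= /bump /= !add1n ltnS addnS.
  by rewrite !col_mx_lift mxE.
by rewrite (_ : lift _ _ = ord0) ?col_mx_ord0 //; exact: val_inj.
Qed.

(** The simplicial identity. The shifted indices are separate variables, tied by their values,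
    because they change ordinal type. *)
Lemma sface_sface n (i : 'I_n.+1) (j : 'I_n.+2) (i' : 'I_n.+1) (j' : 'I_n.+2) :
  (i < j)%N -> i' = j.-1 :> nat -> j' = i :> nat ->
  smul (sface i') (sface j') = smul (sface i) (sface j).
Proof.
move=> ij i'E j'E; rewrite !sface_mul; apply: smx_inj; apply/matrixP => k l /=.
rewrite !mxE (_ : lift j' _ = lift j (lift i k)) //; apply: val_inj.
rewrite /= /bump i'E j'E; case: j ij {i'E j'E} => j /= jn ij.
lia.
Qed.

End StochasticMatrices.

(** * Barycentric subdivision and its chain homotopy *)

Section Subdivision.
Variable R : realType.

(* Graded sets with a right action of stochastic matrices: the singular simplices
   of a space, and the formal affine simplices spanned by the rows of a matrix. *)
Record rmod := RMod {
  rcar : nat -> choiceType;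
  ract : forall n m, smx R n m -> rcar m -> rcar n;
  ractM : forall n m p (M : smx R n m) (N : smx R m p) s,
    ract (smul M N) s = ract M (ract N s);
  ract1 : forall n s, ract (sid R n) s = s }.

Definition matrix_rmod m := @RMod (fun n => smx R n m : choiceType)
  (fun n p M N => smul M N) (fun n p q M N s => esym (smulA M N s))
  (fun n s => smul1l s).

Definition chain (T : rmod) n := malg (rcar T n) rat.

Section Chains.
Variable T : rmod.

(** Since [n] counts vertices, [n = 0] gives the augmentation: each vertex is sent to the empty
    simplex. *)
Definition bd n : chain T n.+1 -> chain T n :=
  lext (fun s => \sum_(i < n.+1) (-1) ^+ i *: mkmalgU (ract (sface R i) s) (1 : rat)).

(** Every simplex [s] is the push-forward of the identity matrix. A natural operation is therefore
    defined once, on the model simplex, and an identity between natural operations need only be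
    checked there. *)
Definition push m (s : rcar T m) n : chain (matrix_rmod m) n -> chain T n :=
  lext (fun M => mkmalgU (ract M s) 1).

HB.instance Definition _ n := GRing.Linear.on (@bd n).
HB.instance Definition _ m s n := GRing.Linear.on (@push m s n).

Lemma bdU n s : bd (mkmalgU s 1) =
  \sum_(i < n.+1) (-1) ^+ i *: mkmalgU (ract (sface R i) s) (1 : rat).
Proof. exact: lextU. Qed.

Lemma pushU m (s : rcar T m) n M : @push m s n (mkmalgU M 1) = mkmalgU (ract M s) 1.
Proof. exact: lextU. Qed.

Lemma push_id m (s : rcar T m) : push s (mkmalgU (sid R m) 1) = mkmalgU s 1.
Proof. by rewrite pushU ract1. Qed.

Lemma bd_bd n (c : chain T n.+2) : bd (bd c) = 0.
Proof.
suff : @bd n \o @bd n.+1 =1 \0 by exact.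
apply: eq_linear => s /=; rewrite bdU linear_sum /=.
under eq_bigr => j _.
  rewrite linearZ /= bdU scaler_sumr; under eq_bigr => i _ do rewrite scalerA -ractM.
  over.
rewrite exchange_big pair_big /=.
rewrite (bigID (fun p : 'I_n.+1 * 'I_n.+2 => p.1 < p.2)%N) /=.
(* [h] and [k] exchange the pairs with [i < j] and those with [j <= i]. By the simplicial identity,
   partners are the same face, and their signs differ by one factor -1. *)
pose h (p : 'I_n.+1 * 'I_n.+2) : 'I_n.+1 * 'I_n.+2 := (inord p.2.-1, inord p.1).
pose k (p : 'I_n.+1 * 'I_n.+2) : 'I_n.+1 * 'I_n.+2 := (inord p.2, inord p.1.+1).
rewrite [X in _ + X](reindex_onto h k) /=; last first.
  move=> [i j] /=; rewrite -leqNgt => ji; rewrite /h /k /=.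
  have jn := ltn_ord j; have lin := ltn_ord i.
  rewrite !inordK //; last by lia.
  by congr (_, _); apply: val_inj; rewrite /= inordK //; lia.
rewrite [X in _ + X](eq_bigl (fun p : 'I_n.+1 * 'I_n.+2 => p.1 < p.2)%N); last first.
  move=> [i j] /=; have := ltn_ord j; have := ltn_ord i => lin jn.
  rewrite /h /k /= !inordK; [|lia..].
  apply/idP/idP => [/andP[ji /eqP[e1 e2]]|ij].
    have := congr1 val e1; have := congr1 val e2; rewrite /= !inordK; lia.
  apply/andP; split; first lia.
  apply/eqP; congr (_, _); apply: val_inj; rewrite /= inordK; lia.
rewrite -big_split /= big1 // => -[i j] /= ij; have := ltn_ord j => jn.
rewrite (@sface_sface R n i j (inord j.-1) (inord i)) //; last 2 first.
- by rewrite inordK //; lia.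
- by rewrite inordK //; have := ltn_ord i; lia.
rewrite -scalerDl !inordK; [|have := ltn_ord i; lia..].
have -> : nat_of_ord j = j.-1.+1 by lia.
by rewrite /= exprS mulN1r mulNr mulrC addNr scale0r.
Qed.

End Chains.

Lemma push_bd (T : rmod) m (s : rcar T m) n (c : chain (matrix_rmod m) n.+1) :
  bd (push s c) = push s (bd c).
Proof.
suff : @bd T n \o push s (n:=n.+1) =1 push s (n:=n) \o @bd (matrix_rmod m) n by exact.
apply: eq_linear => M /=; rewrite pushU !bdU linear_sum /=.
by apply: eq_bigr => i _; rewrite linearZ /= pushU ractM.
Qed.

Definition mcone m (b : smx R 1 m) n :
    chain (matrix_rmod m) n -> chain (matrix_rmod m) n.+1 :=
  lext (fun M => mkmalgU (scone b M) 1).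
HB.instance Definition _ m b n := GRing.Linear.on (@mcone m b n).

Lemma mconeU m (b : smx R 1 m) n M : @mcone m b n (mkmalgU M 1) = mkmalgU (scone b M) 1.
Proof. exact: lextU. Qed.

(** Coning the empty simplex gives the apex, whose augmentation is the empty simplex again. Nothing
    lies below index 0, so the correction term of the general cone formula is absent. *)
Lemma bd_mcone0 m (b : smx R 1 m) (c : chain (matrix_rmod m) 0) : bd (mcone b c) = c.
Proof.
suff : @bd (matrix_rmod m) 0 \o @mcone m b 0 =1 idfun by exact.
apply: eq_linear => M /=.
by rewrite mconeU bdU big_ord_recl big_ord0 addr0 expr0 scale1r [ract _ _]sface0_cone.
Qed.

Lemma bd_mcone m (b : smx R 1 m) n (c : chain (matrix_rmod m) n.+1) :
  bd (mcone b c) = c - mcone b (bd c).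
Proof.
suff : @bd (matrix_rmod m) n.+1 \o @mcone m b n.+1 =1
       (idfun \- (@mcone m b n \o @bd (matrix_rmod m) n)) by exact.
apply: eq_linear => M /=.
rewrite mconeU !bdU big_ord_recl expr0 scale1r [ract _ _]sface0_cone; congr (_ + _).
rewrite [mcone b _]lext_sum -sumrN; apply: eq_bigr => i _.
by rewrite [ract _ _]sface_cone lift0 exprS mulN1r scaleNr.
Qed.

(** The cone from the barycentre over the subdivided boundary. The inner [lext] is [subdiv], which
    cannot be named before the recursion is complete; [sub_modelS] restores that form. *)
Fixpoint sub_model n : chain (matrix_rmod n) n :=
  match n with
  | 0 => mkmalgU (sid R 0) 1
  | n'.+1 => mcone (sbary R n')
      (lext (fun s => @push (matrix_rmod n'.+1) n' s n' (sub_model n'))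
         (bd (mkmalgU (sid R n'.+1 : rcar (matrix_rmod n'.+1) n'.+1) 1)))
  end.

Definition subdiv T n : chain T n -> chain T n := lext (fun s => push s (sub_model n)).
HB.instance Definition _ T n := GRing.Linear.on (@subdiv T n).

(** The homotopy has to satisfy [bd T = id - Sd - T bd]. The right-hand side on the model is a
    cycle, and coning a cycle from the barycentre gives a chain that it bounds. *)
Fixpoint hom_model n : chain (matrix_rmod n) n.+1 :=
  match n with
  | 0 => 0
  | n'.+1 => mcone (sbary R n')
      (mkmalgU (sid R n'.+1) 1 - sub_model n'.+1 -
       lext (fun s => @push (matrix_rmod n'.+1) n' s n'.+1 (hom_model n'))
         (bd (mkmalgU (sid R n'.+1 : rcar (matrix_rmod n'.+1) n'.+1) 1)))
  end.

Definition subhom T n : chain T n -> chain T n.+1 := lext (fun s => push s (hom_model n)).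
HB.instance Definition _ T n := GRing.Linear.on (@subhom T n).

Lemma subdivU T n s : @subdiv T n (mkmalgU s 1) = push s (sub_model n).
Proof. exact: lextU. Qed.

Lemma subhomU T n s : @subhom T n (mkmalgU s 1) = push s (hom_model n).
Proof. exact: lextU. Qed.

Definition model n : chain (matrix_rmod n) n := mkmalgU (sid R n) 1.

Lemma sub_modelS n : sub_model n.+1 = mcone (sbary R n) (subdiv (bd (model n.+1))).
Proof. by []. Qed.

Lemma hom_modelS n : hom_model n.+1 =
  mcone (sbary R n) (model n.+1 - sub_model n.+1 - subhom (bd (model n.+1))).
Proof. by []. Qed.

Lemma push_push T m (s : rcar T m) p (M : smx R p m) n (c : chain (matrix_rmod p) n) :
  push s (push (M : rcar (matrix_rmod m) p) c) = push (ract M s) c.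
Proof.
suff : push s (n:=n) \o @push (matrix_rmod m) p M n =1 push (ract M s) (n:=n) by exact.
by apply: eq_linear => N /=; rewrite !pushU ractM.
Qed.

Lemma hom_model0 : hom_model 0 = 0.
Proof. by []. Qed.

Lemma push_subdiv T m (s : rcar T m) n (c : chain (matrix_rmod m) n) :
  push s (subdiv c) = subdiv (push s c).
Proof.
suff : push s (n:=n) \o @subdiv (matrix_rmod m) n =1 @subdiv T n \o push s (n:=n) by exact.
by apply: eq_linear => M /=; rewrite subdivU pushU subdivU push_push.
Qed.

Lemma push_subhom T m (s : rcar T m) n (c : chain (matrix_rmod m) n) :
  push s (subhom c) = subhom (push s c).
Proof.
suff : push s (n:=n.+1) \o @subhom (matrix_rmod m) n =1 @subhom T n \o push s (n:=n) by exact.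
by apply: eq_linear => M /=; rewrite subhomU pushU subhomU push_push.
Qed.

Lemma subdiv0 T (c : chain T 0) : subdiv c = c.
Proof.
suff : @subdiv T 0 =1 idfun by exact.
by apply: eq_linear => s /=; rewrite subdivU push_id.
Qed.

Lemma mcone0 m (b : smx R 1 m) n : @mcone m b n 0 = 0.
Proof. exact: linear0. Qed.

Lemma subdiv_0 T n : @subdiv T n 0 = 0.
Proof. exact: linear0. Qed.

Lemma subhom_0 T n : @subhom T n 0 = 0.
Proof. exact: linear0. Qed.

Lemma bdB T n (c d : chain T n.+1) : bd (c - d) = bd c - bd d.
Proof. exact: linearB. Qed.

Lemma pushB T m (s : rcar T m) n (c d : chain (matrix_rmod m) n) :
  push s (c - d) = push s c - push s d.
Proof. exact: linearB. Qed.

(** By naturality the model suffices. The cone formula leaves the cone over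
    [bd (subdiv (bd model))], which is [subdiv (bd (bd model)) = 0] by the preceding dimension. *)
Lemma bd_subdiv T n (c : chain T n.+1) : bd (subdiv c) = subdiv (bd c).
Proof.
elim: n T c => [|n IH] T c.
  suff : @bd T 0 \o @subdiv T 1 =1 @subdiv T 0 \o @bd T 0 by exact.
  apply: eq_linear => s /=.
  by rewrite subdivU push_bd sub_modelS bd_mcone0 push_subdiv -push_bd push_id.
suff : @bd T n.+1 \o @subdiv T n.+2 =1 @subdiv T n.+1 \o @bd T n.+1 by exact.
apply: eq_linear => s /=.
rewrite subdivU push_bd sub_modelS bd_mcone IH bd_bd subdiv_0 mcone0 subr0.
by rewrite push_subdiv -push_bd push_id.
Qed.

Lemma bd_sub_model n : bd (sub_model n.+1) = subdiv (bd (model n.+1)).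
Proof.
case: n => [|n]; rewrite sub_modelS ?bd_mcone0 //.
by rewrite bd_mcone bd_subdiv bd_bd subdiv_0 mcone0 subr0.
Qed.

Lemma bd_subhom0 T (c : chain T 0) : bd (subhom c) = 0.
Proof.
suff : @bd T 0 \o @subhom T 0 =1 \0 by exact.
by apply: eq_linear => s /=; rewrite subhomU hom_model0 !linear0.
Qed.

Lemma subhom_step T n (s : rcar T n.+1) :
  bd (model n.+1 - sub_model n.+1 - subhom (bd (model n.+1))) = 0 ->
  bd (subhom (mkmalgU s 1)) =
  mkmalgU s 1 - subdiv (mkmalgU s 1) - subhom (bd (mkmalgU s 1)).
Proof.
move=> h; rewrite subhomU push_bd hom_modelS bd_mcone h mcone0 subr0 !pushB.
rewrite push_subhom.
rewrite -push_bd.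
rewrite push_id.
by rewrite subdivU.
Qed.

Lemma bd_subhom T n (c : chain T n.+1) :
  bd (subhom c) = c - subdiv c - subhom (bd c).
Proof.
elim: n T c => [|n IH] T c.
  suff : @bd T 1 \o @subhom T 1 =1
     (idfun \- @subdiv T 1) \- (@subhom T 0 \o @bd T 0) by exact.
  apply: eq_linear => s /=; apply: subhom_step.
  rewrite !bdB.
rewrite bd_subhom0.
rewrite bd_sub_model.
rewrite subdiv0.
by rewrite subrr subr0.
suff : @bd T n.+2 \o @subhom T n.+2 =1
   (idfun \- @subdiv T n.+2) \- (@subhom T n.+1 \o @bd T n.+1) by exact.
apply: eq_linear => s /=; apply: subhom_step.
by rewrite !bdB IH bd_sub_model bd_bd subhom_0 subr0 subrr.
Qed.

(** The homotopy formula applied to each iterate and telescoped. *)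
Lemma subdiv_iter T n k (c : chain T n.+1) :
  c - iter k (@subdiv T n.+1) c =
  bd (\sum_(j < k) subhom (iter j (@subdiv T n.+1) c)) +
  \sum_(j < k) subhom (iter j (@subdiv T n) (bd c)).
Proof.
elim: k => [|k IH]; first by rewrite !big_ord0 subrr addr0; apply/esym/linear0.
have bd_iter j : bd (iter j (@subdiv T n.+1) c) = iter j (@subdiv T n) (bd c).
  by elim: j => //= j <-; rewrite bd_subdiv.
rewrite !big_ord_recr /= -bd_iter.
set u := \sum_(i < k) _; set v := \sum_(i < k) _; set w := iter k _ c.
have -> : bd (u + subhom w) = bd u + bd (subhom w) by exact: linearD.
by rewrite bd_subhom addrACA subrK -IH addrA subrK.
Qed.

Section Support.
Variables (T : rmod) (P : forall n, rcar T n -> Prop).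
Hypothesis Pact : forall n m (M : smx R n m) s, P s -> P (ract M s).

Lemma supp_push m (s : rcar T m) n c : P s -> supp (@P n) (push s c).
Proof.
move=> Ps; apply: (@supp_lext _ _ (fun=> True)) => // M _.
by apply: suppU; exact: Pact.
Qed.

Lemma supp_bd n (c : chain T n.+1) : supp (@P n.+1) c -> supp (@P n) (bd c).
Proof.
apply: supp_lext => s Ps; apply: supp_sum => i.
by apply: suppZ; apply: suppU; exact: Pact.
Qed.

Lemma supp_subdiv n (c : chain T n) : supp (@P n) c -> supp (@P n) (subdiv c).
Proof. by apply: supp_lext => s Ps; exact: supp_push. Qed.

Lemma supp_subdiv_iter n k (c : chain T n) :
  supp (@P n) c -> supp (@P n) (iter k (@subdiv T n) c).
Proof. by move=> Pc; elim: k => //= k; exact: supp_subdiv. Qed.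

Lemma supp_subhom n (c : chain T n) : supp (@P n) c -> supp (@P n.+1) (subhom c).
Proof. by apply: supp_lext => s Ps; exact: supp_push. Qed.

End Support.

(* Replacing [w] by a homologous chain finer than a given cover: [Q] singles out the
   small simplices, [P] those in the ambient set. *)
Lemma small_chain T (P Q : forall n, rcar T n -> Prop) n (w : chain T n.+1) k :
  (forall n m (M : smx R n m) s, P m s -> P n (ract M s)) ->
  (forall n m (M : smx R n m) s, Q m s -> Q n (ract M s)) ->
  supp (@P n.+1) w -> supp (@Q n) (bd w) ->
  supp (@Q n.+1) (iter k (@subdiv T n.+1) w) ->
  exists2 u, supp (@P n.+2) u & supp (@Q n.+1) (w - bd u).
Proof.
move=> Pact Qact Pw Qbw Qw.
exists (\sum_(j < k) subhom (iter j (@subdiv T n.+1) w)).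
  by apply: supp_sum => j; apply: supp_subhom => //; exact: supp_subdiv_iter.
set u := \sum_(j < k) _.
have -> : w - bd u = iter k (@subdiv T n.+1) w +
    \sum_(j < k) subhom (iter j (@subdiv T n) (bd w)).
  by apply/eqP; rewrite subr_eq addrAC -addrA addrC -subr_eq addrC subdiv_iter addrC.
apply: suppD => //; apply: supp_sum => j.
by apply: supp_subhom => //; exact: supp_subdiv_iter.
Qed.

End Subdivision.

(** * Shrinking of iterated subdivisions *)

Section Mesh.
Variable R : realType.

Lemma smx_avg_le n m (M : smx R n m) (v : 'I_m -> R) B i :
  (forall k, v k <= B) -> \sum_k M i k * v k <= B.
Proof.
move=> vB; have /stochasticP/(_ i)[M0 M1] := smxP M.
rewrite -[B]mul1r -M1 mulr_suml; apply: ler_sum => k _; exact: ler_wpM2l.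
Qed.

Lemma smx_avg_ge n m (M : smx R n m) (v : 'I_m -> R) B i :
  (forall k, B <= v k) -> B <= \sum_k M i k * v k.
Proof.
move=> vB; rewrite -lerN2 -sumrN (eq_bigr (fun k => M i k * - v k)).
  by apply: (@smx_avg_le _ _ M (fun k => - v k)) => k; rewrite lerN2.
by move=> k _; rewrite mulrN.
Qed.

(** A diameter bound without a norm: [v] is an affine function given by its values at the vertices,
    and its oscillation over the rows of [M] is at most [r] times its oscillation over the whole
    simplex. In this form the ratios multiply under composition. *)
Definition contracting (r : R) n m (M : smx R n m) : Prop :=
  forall (v : 'I_m -> R) c, (forall k l, v k - v l <= c) ->
  forall i j, \sum_k M i k * v k - \sum_k M j k * v k <= r * c.

Lemma smul_avg n m p (M : smx R n m) (N : smx R m p) (v : 'I_p -> R) i :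
  \sum_k smul M N i k * v k = \sum_k M i k * (\sum_l N k l * v l).
Proof.
rewrite (eq_bigr (fun k => \sum_j M i j * N j k * v k)); last first.
  by move=> k _; rewrite /= mxE mulr_suml.
rewrite exchange_big /=; apply: eq_bigr => k _.
by rewrite mulr_sumr; apply: eq_bigr => l _; rewrite mulrA.
Qed.

Lemma contracting_mul r q n m p (M : smx R n m) (N : smx R m p) :
  contracting r M -> contracting q N -> contracting (r * q) (smul M N).
Proof.
by move=> Mr Nq v c vc i j; rewrite !smul_avg -mulrA; apply: Mr; exact: Nq.
Qed.

Lemma contracting1 n m (M : smx R n m) : contracting 1 M.
Proof.
move=> v c vc i j; rewrite mul1r lerBlDr; apply: smx_avg_le => k.
rewrite -lerBlDl; apply: smx_avg_ge => l.
by rewrite lerBlDl addrC -lerBlDl; rewrite lerBlDl addrC -lerBlDr; exact: vc.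
Qed.

Definition mesh n : R := n%:R / n.+1%:R.

(** The barycentre minus vertex [l] is the sum of the [n] differences [v k - v l] with [k != l],
    divided by [n + 1]; this is the origin of the ratio [mesh n]. *)
Lemma bary_dist n (v : 'I_n.+1 -> R) c l : (forall k l, v k - v l <= c) ->
  \sum_k sbary R n 0 k * v k - v l <= mesh n * c /\
  v l - \sum_k sbary R n 0 k * v k <= mesh n * c.
Proof.
move=> vc.
have n0 : n.+1%:R != 0 :> R by rewrite pnatr_eq0.
have E : \sum_k sbary R n 0 k * v k = n.+1%:R^-1 * \sum_k v k.
  by rewrite mulr_sumr; apply: eq_bigr => k _; rewrite mxE.
have E2 : \sum_k sbary R n 0 k * v k - v l = n.+1%:R^-1 * \sum_(k | k != l) (v k - v l).
  rewrite E (bigD1 l) //= sumrB sumr_const cardC1 card_ord /= -mulr_natr.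
  move: n0; rewrite -natr1 => n0; set S := \sum_(_ | _) _.
  by rewrite -mulr_natr; field.
have E3 (F : 'I_n.+1 -> R) : (forall k, F k <= c) ->
    n.+1%:R^-1 * \sum_(k | k != l) F k <= mesh n * c.
  move=> Fc; rewrite /mesh [_ / _]mulrC -mulrA ler_wpM2l ?invr_ge0 ?ler0n //.
  apply: (le_trans (ler_sum _ (fun k _ => Fc k))).
  by rewrite sumr_const cardC1 card_ord /= mulr_natl lexx.
split; first by rewrite E2; exact: E3.
rewrite -opprB E2 -mulrN -sumrN; apply: E3 => k; rewrite opprB; exact: vc.
Qed.

Lemma mesh_ge0 n : 0 <= mesh n.
Proof. by rewrite divr_ge0 ?ler0n. Qed.

Lemma mesh_lt1 n : mesh n < 1.
Proof. by rewrite ltr_pdivrMr ?ltr0n // mul1r ltr_nat. Qed.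

Lemma mesh_leS n : mesh n <= mesh n.+1.
Proof.
rewrite /mesh ler_pdivrMr ?ltr0n // mulrAC ler_pdivlMr ?ltr0n //.
by rewrite -!natrM ler_nat; lia.
Qed.

(** Each small simplex is a cone from the barycentre over a simplex of a subdivided facet. Two base
    vertices are controlled by induction, the ratio growing with the dimension. A base vertex is an
    average of old vertices, and each old vertex is within the bound of the barycentre. *)
Lemma sub_model_mesh n : supp (@contracting (mesh n) n.+1 n.+1) (sub_model R n.+1).
Proof.
elim: n => [|n IH].
  move=> M _ v c vc i j; rewrite (ord1 i) (ord1 j) subrr mulr_ge0 ?mesh_ge0 //.
  by have := vc ord0 ord0; rewrite subrr.
pose P (M : smx R n.+1 n.+2) := exists N i,
  contracting (mesh n) (N : smx R n.+1 n.+1) /\ M = smul N (sface R i).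
have PM : supp P (subdiv (bd (model R n.+2))).
  rewrite bdU linear_sum; apply: supp_sum => i /=.
  rewrite linearZ /= subdivU; apply: suppZ.
  apply: (supp_lext _ IH) => N Nc; apply: suppU; exists N, i; split => //=.
  by rewrite smul1r.
rewrite sub_modelS; apply: (supp_lext _ PM) => M [N [i [Nc ->]]].
apply: suppU => v c vc.
have c0 : 0 <= c by have := vc ord0 ord0; rewrite subrr.
have cone0 : \sum_k scone (sbary R n.+1) (smul N (sface R i)) ord0 k * v k =
    \sum_k sbary R n.+1 0 k * v k.
  by apply: eq_bigr => k _; rewrite /= col_mx_ord0.
have coneS j : \sum_k scone (sbary R n.+1) (smul N (sface R i)) (lift ord0 j) k * v k =
    \sum_k smul N (sface R i) j k * v k.
  by apply: eq_bigr => k _; rewrite /= col_mx_lift.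
move=> a b; have [a' ->|->] := unliftP ord0 a; have [b' ->|->] := unliftP ord0 b.
- rewrite !coneS; apply: (@le_trans _ _ (mesh n * c)); last first.
    by rewrite ler_wpM2r ?mesh_leS.
  rewrite -[mesh n]mulr1.
  by apply: (contracting_mul Nc (@contracting1 _ _ _)).
- rewrite cone0 coneS lerBlDr; apply: smx_avg_le => l; rewrite -lerBlDr.
  by have [_] := bary_dist l vc.
- rewrite cone0 coneS.
  rewrite lerBlDr addrC -lerBlDr; apply: smx_avg_ge => l.
  by rewrite lerBlDr addrC -lerBlDr; have [] := bary_dist l vc.
- by rewrite subrr mulr_ge0 ?mesh_ge0.
Qed.

Lemma subdiv_iter_mesh T n k (s : rcar T n.+1) :
  supp (fun t => exists2 M : smx R n.+1 n.+1,
      contracting (mesh n ^+ k) M & t = ract M s)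
    (iter k (@subdiv R T n.+1) (mkmalgU s 1)).
Proof.
elim: k => [|k IH] /=.
  by apply: suppU; exists (sid R n.+1); rewrite ?ract1 // expr0; exact: contracting1.
apply: (supp_lext _ IH) => t [M Mc ->].
apply: (supp_lext _ (@sub_model_mesh n)) => N Nc; apply: suppU.
by exists (smul N M); rewrite ?ractM // exprS; exact: contracting_mul.
Qed.

End Mesh.

(** * Singular simplices *)

Section ContinuityHelpers.

Lemma mx_continuous_at (X T : topologicalType) m n (f : X -> 'M[T]_(m, n)) x :
  (forall i j, {for x, continuous (fun y => f y i j)}) -> {for x, continuous f}.
Proof.
move=> cf U [P Px PU].
have FF : Filter (nbhs x) by exact: nbhs_filter.
have h : \forall y \near x, forall i j, P i j (f y i j).
  by apply: filter_forall => i; apply: filter_forall => j; exact: cf (Px i j).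
by apply: filterS h => y Py; exact: PU.
Qed.

Lemma sub_continuous_at (X Y : topologicalType) (A : set Y) (f : X -> A) x :
  {for x, continuous (fun y => set_val (f y))} -> {for x, continuous f}.
Proof.
move=> cf U [?/= [[W oW <-]]] /= Wsfz /filterS; apply; apply: cf.
exact: open_nbhs_nbhs.
Qed.

Lemma set_val_continuous (Y : topologicalType) (A : set Y) : continuous (set_val : A -> Y).
Proof. exact: initial_continuous. Qed.

Lemma nbhs_subtype (Y : topologicalType) (A : set Y) (x : A) (U : set A) :
  nbhs x U -> exists2 V, nbhs (set_val x) V & forall y : A, V (set_val y) -> U y.
Proof.
move=> [? [[W oW <-]] /= Wx WU]; exists W => //; exact: open_nbhs_nbhs.
Qed.

Lemma continuous_sum_at (R : realType) (X : topologicalType) (I : Type) (r : seq I)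
    (f : I -> X -> R) x :
  (forall i, {for x, continuous (f i)}) ->
  {for x, continuous (fun y => \sum_(i <- r) f i y)}.
Proof.
move=> cf; elim: r => [|i r IH].
  rewrite (_ : (fun _ => _) = cst 0); first exact: cst_continuous.
  by apply/funext => y; rewrite big_nil.
rewrite (_ : (fun _ => _) = (fun y => f i y + \sum_(i <- r) f i y)).
  by apply: continuousD.
by apply/funext => y; rewrite big_cons.
Qed.

Lemma mulmxr_continuous (R : realType) m n p (M : 'M[R]_(n, p)) :
  continuous (fun x : 'M[R]_(m, n) => x *m M).
Proof.
move=> x; apply: mx_continuous_at => i j.
rewrite (_ : (fun _ => _) = (fun y : 'M[R]_(m, n) => \sum_k y i k * M k j)).
  apply: continuous_sum_at => k; apply: continuousM; first exact: coord_continuous.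
  exact: cst_continuous.
by apply/funext => y; rewrite mxE.
Qed.

Lemma mx_norm_ltP (R : realType) m n (x : 'M[R]_(m, n)) e : 0 < e ->
  (forall i j, `|x i j| < e) -> `|x| < e.
Proof.
move=> e0 xe; rewrite /Num.norm /= mx_normrE; apply/bigmax_ltP; split => // -[i j] _; exact: xe.
Qed.

Lemma row_coord_continuous (R : realType) (X : topologicalType) m (F : X -> 'rV[R]_m) i :
  continuous F -> continuous (fun x => F x 0 i).
Proof.
move=> cF x; have := @continuous_comp _ _ _ F (fun v : 'rV[R]_m => v 0 i) x.
by apply; [exact: cF|exact: coord_continuous].
Qed.

Lemma near_dist (R : realType) (X : topologicalType) (g : X -> R) x e :
  {for x, continuous g} -> 0 < e -> \forall y \near x, `|g x - g y| < e.
Proof.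
move=> cg e0; have := @cvgr_dist_lt _ _ _ (nbhs x) _ g (g x) cg e e0.
exact.
Qed.

Lemma near_andS (X : topologicalType) (x : X) (P Q S : X -> Prop) :
  (\forall y \near x, P y) -> (\forall y \near x, Q y) ->
  (forall y, P y -> Q y -> S y) -> \forall y \near x, S y.
Proof. by move=> hP hQ PQS; apply: filterS (filterI hP hQ) => y []; exact: PQS. Qed.

Lemma near_subS (X : topologicalType) (x : X) (P Q : X -> Prop) :
  (\forall y \near x, P y) -> (forall y, P y -> Q y) -> \forall y \near x, Q y.
Proof. by move=> hP PQ; apply: filterS hP. Qed.

End ContinuityHelpers.

(** At [n.+1] this is convertible with [std_simplex R n]. It also covers [n = 0], where it is empty
    and carries exactly one map to any space: the empty simplex. *)
Definition dsimp (R : realType) n : set 'rV[R]_n :=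
  [set x | (forall i, 0 <= x 0 i) /\ \sum_(i < n) x 0 i = 1].
Arguments dsimp : clear implicits.

Section SingularModule.
Variable R : realType.

Lemma aff_subproof n m (M : smx R n m) (x : dsimp R n) : dsimp R m (set_val x *m M).
Proof.
have [x0 x1] := set_valP x.
have /stochasticP hM := smxP M.
split=> [i|].
  by rewrite mxE sumr_ge0 // => k _; rewrite mulr_ge0 //; case: (hM k).
rewrite -x1 (eq_bigr (fun i => \sum_k set_val x 0 k * M k i)); last first.
  by move=> i _; rewrite mxE.
rewrite exchange_big /=; apply: eq_bigr => k _.
by rewrite -mulr_sumr; have [_ ->] := hM k; rewrite mulr1.
Qed.

Definition aff n m (M : smx R n m) (x : dsimp R n) : dsimp R m :=
  exist _ (set_val x *m M) (mem_set (aff_subproof M x)).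

Lemma aff_continuous n m (M : smx R n m) : continuous (aff M).
Proof.
move=> x; apply: sub_continuous_at.
have := @continuous_comp _ _ _ (fun y : dsimp R n => set_val y)
  (fun v : 'rV[R]_n => v *m M) x.
apply; [exact: set_val_continuous|exact: mulmxr_continuous].
Qed.

HB.instance Definition _ n m (M : smx R n m) :=
  @isContinuous.Build _ _ (aff M) (@aff_continuous n m M).

Lemma affM n m p (M : smx R n m) (N : smx R m p) x : aff (smul M N) x = aff N (aff M x).
Proof. by apply: val_inj; rewrite /= mulmxA. Qed.

Lemma aff1 n x : aff (sid R n) x = x.
Proof. by apply: val_inj; rewrite /= mulmx1. Qed.

Variable X : topologicalType.

Definition sact n m (M : smx R n m) (s : continuousType (dsimp R m) X) :
    continuousType (dsimp R n) X :=
  [the continuousType _ _ of s \o aff M].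

Lemma sactM n m p (M : smx R n m) (N : smx R m p) s :
  sact (smul M N) s = sact M (sact N s).
Proof. by apply/continuousEP => x /=; rewrite affM. Qed.

Lemma sact1 n s : sact (sid R n) s = s.
Proof. by apply/continuousEP => x /=; rewrite aff1. Qed.

Definition sing : rmod R :=
  @RMod R (fun n => continuousType (dsimp R n) X : choiceType) sact sactM sact1.

(** Multiplying a row by the identity matrix without row [i] inserts a zero at position [i], which
    is what [face_row] does. *)
Lemma boundaryE n (c : singular_chain R X n.+1) :
  boundary c = bd (c : chain sing n.+2).
Proof.
rewrite /bd lext.unlock; apply: eq_bigr => s _; congr (_ *: _).
apply: eq_bigr => i _; congr (_ *: mkmalgU _ _).
apply/continuousEP => x /=; congr (s _); apply: val_inj => /=.
apply/matrixP => a j; rewrite (ord1 a) !mxE.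
have [k ->|->] := unliftP i j.
  rewrite (bigD1 k) //= !mxE eqxx mulr1 big1 ?addr0 // => l lk.
  by rewrite !mxE (inj_eq lift_inj) (negPf lk) mulr0.
rewrite big1 // => l _; rewrite !mxE eq_sym (negPf (neq_lift _ _)) mulr0 //.
Qed.

End SingularModule.

(** * Lebesgue numbers and chains subordinate to a cover *)

Section SmallChains.
Variables (R : realType) (X : topologicalType).
Local Notation T := (sing R X).

Definition ins (A : set X) n (s : rcar T n) : Prop :=
  forall x : dsimp R n, A ((s : continuousType (dsimp R n) X) x).

Lemma ins_act A n m (M : smx R n m) (s : rcar T m) : ins A s -> ins A (ract M s).
Proof. by move=> As x; exact: As. Qed.

Lemma dsimp_compact n : compact (dsimp R n).
Proof.
apply: bounded_closed_compact.
  exists 1; split => // r r1 x [x0 x1].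
  apply: ltW; apply: mx_norm_ltP; first exact: lt_trans r1.
  move=> i j; rewrite (ord1 i) ger0_norm //; apply: le_lt_trans r1.
  by rewrite -x1 (bigD1 j) //= lerDl sumr_ge0.
rewrite (_ : dsimp R n = \bigcap_(i in [set: 'I_n]) [set x | 0 <= x 0 i] `&`
    [set x | \sum_(i < n) x 0 i = 1]); last first.
  by apply/seteqP; split => x /= [h1 h2]; split=> // i; [move=> _|]; exact: h1.
apply: closedI.
  apply: closed_bigI => i _.
  apply: (@preimage_closed _ _ (fun x : 'rV[R]_n => x 0 i) [set y | 0 <= y]).
    by move=> x _; exact: coord_continuous.
  exact: closed_ge.
apply: (@preimage_closed _ _ (fun x : 'rV[R]_n => \sum_i x 0 i) [set 1]).
  by move=> x _; apply: continuous_sum_at => i; exact: coord_continuous.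
exact: closed_eq.
Qed.

Lemma lebesgue (A B : set X) n (s : rcar T n.+1) : open A -> open B ->
  ins (A `|` B) s ->
  exists2 e : R, 0 < e & forall m (M : smx R m n.+1), contracting e M ->
    ins A (ract M s) \/ ins B (ract M s).
Proof.
move=> oA oB sAB.
pose P (e : R) (x : 'rV[R]_n.+1) := exists2 W, W = A \/ W = B &
  forall y : dsimp R n.+1, `|set_val y - x| < e ->
    W ((s : continuousType (dsimp R n.+1) X) y).
have cK := @dsimp_compact n.+1.
have /compact_near_coveringP/near_covering_withinP cov := cK.
(* Compactness in its near-covering form turns the radii found around single points into one [e] for
   the whole simplex. A point within [r / 2] of [x] and an [e] below [r / 2] keep the [e]-ball
   inside the [r]-ball of [x]. *)
have H : \forall e \near (0 : R)^'+, forall x, dsimp R n.+1 x -> P e x.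
  apply: cov => x Kx.
  pose z : dsimp R n.+1 := exist _ x (mem_set Kx).
  have [W [OAB oO Oz]] : exists W, [/\ W = A \/ W = B, open W &
      W ((s : continuousType (dsimp R n.+1) X) z)].
    by case: (sAB z) => h; [exists A; split => //; left|exists B; split => //; right].
  have : nbhs z ((s : continuousType (dsimp R n.+1) X) @^-1` W).
    by apply: (@cts_fun _ _ (s : continuousType (dsimp R n.+1) X)); exact: open_nbhs_nbhs.
  move=> /nbhs_subtype[V /nbhs_ballP[r /= r0 rV] VO].
  have r20 : 0 < r / 2 by rewrite divr_gt0.
  near=> x' e => Kx'.
  have er : e < r / 2 by near: e; exact: nbhs_right_lt.
  exists W => // y yx; apply: VO; apply: rV.
  rewrite -ball_normE /= distrC -(subrK x' (set_val y)) -addrA.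
  apply: le_lt_trans (ler_normD _ _) _; rewrite [ltRHS]splitr ltrD //.
    exact: lt_trans yx er.
have [e [e0 He]] : exists e : R, 0 < e /\ forall x, dsimp R n.+1 x -> P e x.
  have /filter_ex : \forall e \near (0 : R)^'+,
      0 < e /\ forall x, dsimp R n.+1 x -> P e x.
    by apply: filterI; [exact: nbhs_right_gt|exact: H].
  by [].
have e20 : 0 < e / 2 by rewrite divr_gt0.
exists (e / 2) => // -[|m] M Mc.
  by left => x; have [_] := set_valP x; rewrite big_ord0 => /esym/eqP; rewrite oner_eq0.
have rowM : dsimp R n.+1 (row ord0 M).
  have /stochasticP/(_ ord0)[M0 M1] := smxP M.
  by split=> [i|]; [rewrite mxE|rewrite -M1; apply: eq_bigr => i _; rewrite mxE].
have close (x : dsimp R m.+1) : `|set_val x *m M - row ord0 M| < e.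
  have [x0 x1] := set_valP x.
  apply: mx_norm_ltP => // i j; rewrite (ord1 i) {i} !mxE.
  have sx : stochastic (set_val x).
    by apply/stochasticP => k; rewrite (ord1 k).
  (* The contraction property is tested on coordinate [j], an affine function that is 0 or 1 at each
     vertex and so has oscillation at most 1. *)
  have d k l : M k j - M l j <= e / 2.
    have := Mc (fun i => (i == j)%:R) 1; rewrite mulr1 => /(_ _ k l).
    have sd a : \sum_i M a i * (i == j)%:R = M a j.
      by rewrite (bigD1 j) //= eqxx mulr1 big1 ?addr0 // => i /negPf->; rewrite mulr0.
    rewrite !sd; apply => a b.
    by case: (a == j); case: (b == j); rewrite ?subrr ?subr0 ?sub0r ?ler01 ?lerN10.
  rewrite ltr_norml; apply/andP; split.
    rewrite ltrBrDl; apply: (@lt_le_trans _ _ (M ord0 j - e / 2)).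
      by rewrite ltrD2l ltrN2 [ltRHS]splitr ltrDl.
    apply: (@smx_avg_ge _ _ _ (SMx sx) (fun k => M k j)) => k.
    by rewrite lerBlDr -lerBlDl.
  rewrite ltrBlDr; apply: (@le_lt_trans _ _ (e / 2 + M ord0 j)); last first.
    by rewrite ltrD2r [ltRHS]splitr ltrDl.
  by apply: (@smx_avg_le _ _ _ (SMx sx) (fun k => M k j)) => k; rewrite -lerBlDr.
have [W [OA|OB] h] := He _ rowM.
  by left => x; rewrite -OA; apply: h; exact: close.
by right => x; rewrite -OB; apply: h; exact: close.
Unshelve. all: by end_near. Qed.

Definition small A B n (s : rcar T n) : Prop := ins A s \/ ins B s.

Lemma small_act A B n m (M : smx R n m) (s : rcar T m) :
  small A B s -> small A B (ract M s).
Proof. by case=> h; [left|right]; exact: ins_act. Qed.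

Lemma iter_subdivD n k (a : rat) (c d : chain T n) :
  iter k (@subdiv R T n) (a *: c + d) =
  a *: iter k (@subdiv R T n) c + iter k (@subdiv R T n) d.
Proof. by elim: k => //= k ->; rewrite linearD linearZ. Qed.

Lemma iter_subdiv_0 n k : iter k (@subdiv R T n) 0 = 0.
Proof. by elim: k => //= k ->; exact: linear0. Qed.

(** The simplices of [c] have different Lebesgue numbers. The claim is made for every large [k] so
    that the maximum of their thresholds serves all of them. *)
Lemma iter_subdiv_small A B n (c : chain T n.+1) : open A -> open B ->
  supp (ins (A `|` B) (n:=n.+1)) c ->
  exists k0, forall k, (k0 <= k)%N ->
    supp (small A B (n:=n.+1)) (iter k (@subdiv R T n.+1) c).
Proof.
move=> oA oB; rewrite -{2}(lext_id c) lext.unlock big_seq => cAB.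
elim/big_ind: _ => [|c1 c2 [k1 h1] [k2 h2]|s sc].
- by exists 0%N => k _; rewrite iter_subdiv_0; exact: supp0.
- exists (maxn k1 k2) => k; rewrite geq_max => /andP[k1k k2k].
  rewrite -[c1]scale1r iter_subdivD scale1r.
  by apply: suppD; [exact: h1|exact: h2].
- have [e e0 he] := lebesgue oA oB (cAB s sc).
  have : \forall k \near \oo, mesh R n ^+ k < e.
    have m0 : `|mesh R n| < 1 by rewrite ger0_norm ?mesh_ge0 ?mesh_lt1.
    exact: (cvgr_lt (0 : R) (cvg_expr m0)).
  move=> [N _ HN]; exists N => k Nk.
  rewrite -[_ *: _]addr0 iter_subdivD iter_subdiv_0 addr0; apply: suppZ.
  have h := @subdiv_iter_mesh R T n k s; move=> t /h[M Mc ->].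
  case: (he _ M) => [v c0 vc a b||]; [|by left|by right].
  apply: le_trans (Mc v c0 vc a b) _; apply: ler_wpM2r; last exact/ltW/HN.
  by have := vc a a; rewrite subrr.
Qed.

End SmallChains.

(** * Mayer-Vietoris sequences *)

Section MayerVietoris.
Variables (R : realType) (X : topologicalType).
Local Notation T := (sing R X).
Local Notation ch := (chain T).

Definition inch (A : set X) n (c : ch n) : Prop := supp (ins A (n:=n)) c.

Definition cyc n : ch n -> Prop :=
  match n with 0 => fun=> True | n'.+1 => fun c => bd c = 0 end.

(* Reduced homology of [A]; the index is one more than the dimension, and
   index 0 stands for the augmentation module, spanned by the empty simplex. *)
Definition acyclic (A : set X) n : Prop :=
  forall c : ch n, cyc c -> inch A c -> exists2 d : ch n.+1, inch A d & bd d = c.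

Definition one_dim (A : set X) n : Prop :=
  exists z : ch n, [/\ cyc z, inch A z,
    forall d : ch n.+1, inch A d -> bd d <> z &
    forall c : ch n, cyc c -> inch A c ->
      exists a : rat, exists2 d : ch n.+1, inch A d & bd d = c - a *: z].

Lemma inchD A n (c d : ch n) : inch A c -> inch A d -> inch A (c + d).
Proof. exact: suppD. Qed.

Lemma inchB A n (c d : ch n) : inch A c -> inch A d -> inch A (c - d).
Proof. exact: suppB. Qed.

Lemma inchZ A n a (c : ch n) : inch A c -> inch A (a *: c).
Proof. exact: suppZ. Qed.

Lemma inch_bd A n (c : ch n.+1) : inch A c -> inch A (bd c).
Proof. by apply: supp_bd => *; exact: ins_act. Qed.

Lemma inchS (A B : set X) n (c : ch n) : A `<=` B -> inch A c -> inch B c.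
Proof. by move=> AB; apply: sub_supp => s sA x; apply: AB; exact: sA. Qed.

Lemma inchI A B n (c : ch n) : inch A c -> inch B c -> inch (A `&` B) c.
Proof. by move=> cA cB s sc x; split; [exact: cA|exact: cB]. Qed.

Lemma cyc_bd n (d : ch n.+1) : cyc (bd d).
Proof. by case: n d => //= n d; exact: bd_bd. Qed.

Lemma bdD n (c d : ch n.+1) : bd (c + d) = bd c + bd d.
Proof. exact: linearD. Qed.

Lemma bdZ n a (c : ch n.+1) : bd (a *: c) = a *: bd c.
Proof. exact: linearZ. Qed.

Section Cover.
Variables (A B : set X).
Hypotheses (oA : open A) (oB : open B).

Lemma excision n (w : ch n.+1) : inch (A `|` B) w ->
  supp (small A B (n:=n)) (bd w) ->
  exists2 u : ch n.+2, inch (A `|` B) u &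
    exists a b : ch n.+1, [/\ inch A a, inch B b & w - bd u = a + b].
Proof.
move=> wAB bw.
have [k hk] := iter_subdiv_small oA oB wAB.
have [] := @small_chain R T (ins (A `|` B)) (small A B) n w k _ _ wAB bw (hk k (leqnn k)).
- by move=> *; exact: ins_act.
- by move=> *; exact: small_act.
move=> u uAB /supp_split[a [b [aA bB e]]]; exists u => //.
by exists a, b.
Qed.

Hypotheses (acA : forall n, acyclic A n) (acB : forall n, acyclic B n).

Lemma small_cyc n (c : ch n.+1) : bd c = 0 -> supp (small A B (n:=n)) (bd c).
Proof. by move=> ->; exact: supp0. Qed.

Lemma cycle_split n (c : ch n.+1) : bd c = 0 -> inch (A `|` B) c ->
  exists a b u, [/\ inch A a, inch B b, inch (A `|` B) u,
    c = a + b + bd u & inch (A `&` B) (bd a) /\ bd b = - bd a].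
Proof.
move=> bc cAB.
have [u uAB [a [b [aA bB e]]]] := excision cAB (small_cyc bc).
have bab : bd a + bd b = 0 by rewrite -bdD -e bdB bc bd_bd subrr.
have bbE : bd b = - bd a by apply/eqP; rewrite -addr_eq0 addrC bab.
exists a, b, u; split => //; first by rewrite -e subrK.
split=> //; apply: inchI; first exact: inch_bd.
by rewrite -[bd a]opprK -bbE; apply: suppN; exact: inch_bd.
Qed.

(** Injectivity of the connecting map. A cycle splits as [a + b] up to a boundary, and
    [bd a = - bd b] is a cycle in the intersection. If it bounds [e] there, then [a - e] and [b + e]
    are cycles in [A] and in [B], where they bound. *)
Lemma acyclicU n : acyclic (A `&` B) n -> acyclic (A `|` B) n.+1.
Proof.
move=> acI c /= bc cAB.
have [a [b [u [aA bB uAB -> [abI bbE]]]]] := cycle_split bc cAB.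
have [e eI eE] := acI _ (cyc_bd a) abI.
have eA : inch A e by apply: inchS eI => x [].
have eB : inch B e by apply: inchS eI => x [].
have [f fA fE] : exists2 f, inch A f & bd f = a - e.
  by apply: acA; [rewrite /= bdB eE subrr|exact: inchB].
have [g gB gE] : exists2 g, inch B g & bd g = b + e.
  by apply: acB; [rewrite /= bdD eE bbE addNr|exact: inchD].
exists (f + g + u); last by rewrite !bdD fE gE addrACA addNr addr0.
by apply: inchD => //; apply: inchD; [apply: inchS fA|apply: inchS gB] => x; [left|right].
Qed.

(** The generator [z] of the intersection bounds [a] in [A] and [b] in [B]; gluing these gives the
    new generator [a - b], one dimension higher. *)
Lemma one_dimU n : one_dim (A `&` B) n -> one_dim (A `|` B) n.+1.
Proof.
move=> [z [zc zI znb zgen]].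
have zA : inch A z by apply: inchS zI => x [].
have zB : inch B z by apply: inchS zI => x [].
have [a aA aE] := acA zc zA; have [b bB bE] := acB zc zB.
have sA n' (c : ch n') : inch A c -> inch (A `|` B) c by apply: inchS => x; left.
have sB n' (c : ch n') : inch B c -> inch (A `|` B) c by apply: inchS => x; right.
exists (a - b); split.
- by rewrite /= bdB aE bE subrr.
- by apply: inchB; [exact: sA|exact: sB].
- move=> w wAB wE.
  have [|u uAB [p [q [pA qB e]]]] := excision wAB.
    rewrite wE; apply: suppB.
      by apply: sub_supp aA => s; left.
    by apply: sub_supp bB => s; right.
  (* The left side lies in [A] and the right side in [B], so this chain lies in the intersection.
     Its boundary is [z], which [znb] forbids. *)
  have E : a - bd p = b + bd q.
    apply/eqP; rewrite subr_eq -addrA [bd q + _]addrC addrC -subr_eq -bdD -e.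
    by rewrite bdB bd_bd subr0 wE.
  have EI : inch (A `&` B) (a - bd p).
    apply: inchI; first by apply: inchB => //; exact: inch_bd.
    by rewrite E; apply: inchD => //; exact: inch_bd.
  by apply: (znb _ EI); rewrite bdB bd_bd subr0.
- move=> c bc cAB.
  have [a' [b' [u [aA' bB' uAB -> [abI bbE]]]]] := cycle_split bc cAB.
  have [r [e eI eE]] := zgen _ (cyc_bd a') abI.
  have eA : inch A e by apply: inchS eI => x [].
  have eB : inch B e by apply: inchS eI => x [].
  have [f fA fE] : exists2 f, inch A f & bd f = a' - r *: a - e.
    apply: acA; first by rewrite /= !bdB bdZ aE eE subrr.
    by apply: inchB => //; apply: inchB => //; exact: inchZ.
  have [g gB gE] : exists2 g, inch B g & bd g = b' + r *: b + e.
    apply: acB; first by rewrite /= !bdD bdZ bE eE bbE; rewrite addrACA addNr subrr addr0.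
    by apply: inchD => //; apply: inchD => //; exact: inchZ.
  exists r, (f + g + u).
    by apply: inchD => //; apply: inchD; [exact: sA|exact: sB].
  rewrite !bdD fE gE scalerBr opprB addrACA addNr addr0 addrACA.
  by rewrite [RHS]addrAC [- _ + _]addrC.
Qed.

End Cover.

End MayerVietoris.

(** * Cones over singular simplices and star-shaped sets *)

Section StarShaped.
Variables (R : realType) (X : topologicalType) (m : nat).
Variables (f : X -> 'rV[R]_m) (N : 'rV[R]_m -> X) (B : R).
Hypotheses (cf : continuous f) (B_ge0 : 0 <= B) (fB : forall x, `|f x| <= B).
Hypothesis cN : forall v, v != 0 -> {for v, continuous N}.
Hypothesis fK : forall x, N (f x) = x.
Local Notation T := (sing R X).
Local Notation cts n := (continuousType (dsimp R n) X).

(** Segments are drawn in R^m after applying [f] and brought back by [N]. Continuity of [N] is known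
    only away from 0, hence the segments must avoid 0. *)
Definition conable (p : 'rV[R]_m) n (s : dsimp R n -> X) : Prop :=
  p != 0 /\ forall x t, 0 <= t <= 1 -> t *: p + (1 - t) *: f (s x) != 0.

Definition dpt n (y : 'rV[R]_n) (h : dsimp R n y) : dsimp R n := exist _ y (mem_set h).

Definition ext n (s : dsimp R n -> X) (y : 'rV[R]_n) : 'rV[R]_m :=
  if pselect (dsimp R n y) is left h then f (s (dpt h)) else 0.

Lemma extE n (s : dsimp R n -> X) (x : dsimp R n) : ext s (set_val x) = f (s x).
Proof.
rewrite /ext; case: pselect => [h|]; last by have := set_valP x.
by congr (f (s _)); exact: val_inj.
Qed.

Lemma ext_in n (s : dsimp R n -> X) y (h : dsimp R n y) :
  ext s y = f (s (dpt h)).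
Proof. by rewrite -extE. Qed.

Lemma ext_bound n (s : dsimp R n -> X) y : `|ext s y| <= B.
Proof. by rewrite /ext; case: pselect => [h|_]; rewrite ?normr0. Qed.

Definition apex n (t : 'rV[R]_n.+1) : R := t 0 ord0.
Definition base n (t : 'rV[R]_n.+1) : 'rV[R]_n := \row_j t 0 (lift ord0 j).

(** Join coordinates: away from the apex, the remaining barycentric coordinates are rescaled to a
    point of the base. At the apex the rescaling divides by zero, but its coefficient [1 - apex t]
    vanishes there as well. *)
Definition cone_vec p n (s : dsimp R n -> X) (t : 'rV[R]_n.+1) : 'rV[R]_m :=
  apex t *: p + (1 - apex t) *: ext s ((1 - apex t)^-1 *: base t).

Lemma apex_bound n (t : 'rV[R]_n.+1) : dsimp R n.+1 t -> 0 <= apex t <= 1.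
Proof.
move=> [t0 t1]; rewrite /apex t0 /= -t1 big_ord_recl lerDl sumr_ge0 //.
Qed.

Lemma base_dsimp n (t : 'rV[R]_n.+1) : dsimp R n.+1 t -> apex t != 1 ->
  dsimp R n ((1 - apex t)^-1 *: base t).
Proof.
move=> tD t1; have /andP[a0 a1] := apex_bound tD; have [t0 tS] := tD.
have d0 : 0 < 1 - apex t by rewrite subr_gt0 lt_neqAle t1.
split=> [i|]; first by rewrite !mxE mulr_ge0 ?invr_ge0 ?(ltW d0).
under eq_bigr do rewrite !mxE; rewrite -mulr_sumr.
have -> : \sum_i t 0 (lift ord0 i) = 1 - apex t.
  by rewrite -[X in X - _]tS big_ord_recl /apex addrAC subrr add0r.
by rewrite mulVf ?gt_eqF.
Qed.

Lemma apex_continuous n : continuous (@apex n).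
Proof. exact: coord_continuous. Qed.

Lemma base_continuous n : continuous (@base n).
Proof.
move=> t; apply: mx_continuous_at => i j.
rewrite (_ : (fun _ => _) = (fun y : 'rV[R]_n.+1 => y 0 (lift ord0 j))).
  exact: coord_continuous.
by apply/funext => y; rewrite mxE.
Qed.

Lemma conable_neq0 p n (s : dsimp R n -> X) (t : dsimp R n.+1) :
  conable p s -> cone_vec p s (set_val t) != 0.
Proof.
move=> [p0 h]; have tD := set_valP t; have a01 := apex_bound tD.
have [a1|a1] := eqVneq (apex (set_val t)) 1.
  by rewrite /cone_vec a1 subrr scale1r scale0r addr0.
by rewrite /cone_vec (ext_in s (base_dsimp tD a1)); exact: h.
Qed.

Lemma cone_vec_continuous p n (s : cts n) :
  continuous (fun t : dsimp R n.+1 => cone_vec p s (set_val t)).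
Proof.
move=> t.
have ca : {for t, continuous (fun t' : dsimp R n.+1 => apex (set_val t'))}.
  have := @continuous_comp _ _ _ (fun y : dsimp R n.+1 => set_val y) (@apex n) t.
  apply; [exact: set_val_continuous|exact: apex_continuous].
have cb : {for t, continuous (fun t' : dsimp R n.+1 => base (set_val t'))}.
  have := @continuous_comp _ _ _ (fun y : dsimp R n.+1 => set_val y) (@base n) t.
  apply; [exact: set_val_continuous|exact: base_continuous].
have FF : Filter (nbhs t) by exact: nbhs_filter.
have tD := set_valP t.
have [a1|a1] := eqVneq (apex (set_val t)) 1.
  rewrite /continuous_at.
  have -> : cone_vec p s (set_val t) = p.
    by rewrite /cone_vec a1 subrr scale1r scale0r addr0.
  apply/cvgrPdist_lt => e e0.
  (* At the apex the base point has no limit. The distance to [p] is [1 - apex] times the norm of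
     [p - v], and [v] is bounded by [B]; the summand 1 makes [C] positive. *)
  pose C := B + `|p| + 1.
  have C0 : 0 < C by rewrite ltr_wpDl // addr_ge0.
  have eC : 0 < e / C by rewrite divr_gt0.
  have := near_dist ca eC; apply: filterS => t' /=; rewrite a1 /cone_vec => h.
  set v := ext s _; set a := apex _ in h *.
  rewrite (_ : p - _ = (1 - a) *: (p - v)); last first.
    by rewrite opprD addrA scalerBr [(1 - a) *: p]scalerBl scale1r.
  rewrite normrZ; apply: (@le_lt_trans _ _ (`|1 - a| * C)).
    rewrite ler_wpM2l // (le_trans (ler_normB _ _)) // /C addrC -[leLHS]addr0.
    by rewrite lerD // lerD // ext_bound.
  by rewrite -ltr_pdivlMr.
have ci : {for t, continuous (fun t' : dsimp R n.+1 => (1 - apex (set_val t'))^-1)}.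
  apply: continuousV; first by rewrite subr_eq0 eq_sym.
  by apply: continuousB => //; exact: cst_continuous.
have cg : {for t, continuous (fun t' : dsimp R n.+1 =>
    (1 - apex (set_val t'))^-1 *: base (set_val t'))}.
  by apply: continuousZ.
have ce : {for t, continuous (fun t' : dsimp R n.+1 =>
    ext s ((1 - apex (set_val t'))^-1 *: base (set_val t')))}.
  move=> V; rewrite /= (ext_in s (base_dsimp tD a1)) => fV.
  pose z := dpt (base_dsimp tD a1).
  have : nbhs z (fun x => V (f (s x))).
    exact: (@cts_fun _ _ s z _ (cf (fV : nbhs (f (s z)) V))).
  move=> /nbhs_subtype[W Wg WV].
  have h1 : \forall t' \near t, W ((1 - apex (set_val t'))^-1 *: base (set_val t')).
    exact: cg.
  have h2 : \forall t' \near t, apex (set_val t') != 1.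
    have : nbhs (apex (set_val t)) [set x | x != 1].
      by apply: open_nbhs_nbhs; split => //; exact: open_neq.
    by move=> h; exact: ca h.
  suff : \forall t' \near t,
      V (ext s ((1 - apex (set_val t'))^-1 *: base (set_val t'))) by [].
  apply: (near_andS h1 h2) => t' Wt' t'1.
  by rewrite /= (ext_in s (base_dsimp (set_valP t') t'1)); exact: WV.
have c1 : {for t, continuous (fun t' : dsimp R n.+1 => apex (set_val t') *: p)}.
  by apply: continuousZ => //; exact: cst_continuous.
have c2 : {for t, continuous (fun t' : dsimp R n.+1 => 1 - apex (set_val t'))}.
  by apply: continuousB => //; exact: cst_continuous.
exact: (continuousD c1 (continuousZ c2 ce)).
Qed.

Lemma cone_continuous p n (s : cts n) : conable p s ->
  continuous (fun t : dsimp R n.+1 => N (cone_vec p s (set_val t))).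
Proof.
move=> ps t.
have := @continuous_comp _ _ _ (fun t : dsimp R n.+1 => cone_vec p s (set_val t)) N t.
by apply; [exact: cone_vec_continuous|apply: cN; exact: conable_neq0].
Qed.

(** Linear extension needs a value at every simplex, so those that cannot be coned off receive a
    constant map. *)
Definition topcone p n (s : rcar T n) : rcar T n.+1 :=
  if pselect (conable p (s : cts n)) is left h
  then [the cts n.+1 of mkcts (cone_continuous h)] else [the cts n.+1 of cst (N 0)].

Lemma topconeE p n (s : cts n) (t : dsimp R n.+1) : conable p s ->
  (topcone p s : cts n.+1) t = N (cone_vec p s (set_val t)).
Proof. by move=> h; rewrite /topcone; case: pselect. Qed.

Lemma face0_topcone p n (s : rcar T n) : conable p (s : cts n) ->
  ract (sface R ord0) (topcone p s) = s.
Proof.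
move=> h; apply/continuousEP => x /=; rewrite topconeE //=.
have E : set_val x *m row' ord0 1%:M = set_val (aff (sface R (ord0 : 'I_n.+1)) x) by [].
have -> : cone_vec p (s : cts n) (set_val x *m row' ord0 1%:M) = f ((s : cts n) x).
  rewrite -extE /cone_vec; set t := _ *m _.
  have -> : apex t = 0.
    rewrite /apex /t mxE big1 // => i _.
    by rewrite !mxE eq_sym (negPf (neq_lift _ _)) mulr0.
  rewrite scale0r add0r subr0 scale1r invr1 scale1r; congr (ext _ _).
  apply/rowP => j; rewrite !mxE (bigD1 j) //= !mxE eqxx mulr1 big1 ?addr0 //.
  by move=> k kj; rewrite !mxE (inj_eq lift_inj) (negPf kj) mulr0.
by rewrite fK.
Qed.

Lemma face_topcone p n (s : rcar T n.+1) i : conable p (s : cts n.+1) ->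
  ract (sface R (lift ord0 i)) (topcone p s) = topcone p (ract (sface R i) s).
Proof.
move=> h.
have h' : conable p (ract (sface R i) s : cts n).
  by case: h => p0 h; split=> // x t t01; exact: h.
apply/continuousEP => x; rewrite [RHS]topconeE //= [LHS]topconeE //=; congr N.
rewrite /cone_vec; set t := set_val (aff _ x).
have tE : t = set_val x *m row' (lift ord0 i) 1%:M by [].
have ta : apex t = apex (set_val x).
  rewrite /apex tE mxE (bigD1 ord0) //= !mxE.
  rewrite (_ : _ == _ = true) ?mulr1; last by [].
  rewrite big1 ?addr0 // => k k0; rewrite !mxE (_ : _ == _ = false) ?mulr0 //.
  by apply/negP => /eqP/(congr1 val) /=; move: k0; rewrite -val_eqE /= /bump; lia.
have tb : base t = base (set_val x) *m row' i 1%:M.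
  apply/rowP => j; rewrite tE !mxE big_ord_recl !mxE /= mulr0 add0r.
  apply: eq_bigr => k _; rewrite !mxE; congr (_ * _%:R).
  by rewrite -!val_eqE /= /bump; lia.
rewrite ta tb; congr (_ + _).
have xD := set_valP x.
have [a1|a1] := eqVneq (apex (set_val x)) 1; first by rewrite a1 subrr !scale0r.
congr (_ *: _); rewrite scalemxAl [RHS](ext_in _ (base_dsimp xD a1)).
by rewrite [RHS]/= -[RHS](extE (s : cts n.+1)).
Qed.

Definition star (p : 'rV[R]_m) (A : set X) : Prop :=
  [/\ p != 0, A (N p) & forall x t, A x -> 0 <= t <= 1 ->
    t *: p + (1 - t) *: f x != 0 /\ A (N (t *: p + (1 - t) *: f x))].

Lemma star_conable p A n (s : rcar T n) : star p A -> ins A s -> conable p (s : cts n).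
Proof. by move=> [p0 _ h] sA; split=> // x t t01; have [] := h _ _ (sA x) t01. Qed.

Lemma ins_topcone p A n (s : rcar T n) : star p A -> ins A s -> ins A (topcone p s).
Proof.
move=> pA sA t; rewrite topconeE; last exact: star_conable pA sA.
have [p0 ANp h] := pA; have tD := set_valP t.
have [a1|a1] := eqVneq (apex (set_val t)) 1.
  by rewrite /cone_vec a1 subrr scale1r scale0r addr0.
rewrite /cone_vec (ext_in _ (base_dsimp tD a1)).
exact: (h _ _ (sA _) (apex_bound tD)).2.
Qed.

Definition coneop p n : chain T n -> chain T n.+1 :=
  lext (fun s => mkmalgU (topcone p s) 1).
HB.instance Definition _ p n := GRing.Linear.on (@coneop p n).

Lemma bd_coneop0 p A (c : chain T 0) : star p A -> inch A c -> bd (coneop p c) = c.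
Proof.
move=> pA cA.
suff : (@bd R T 0 \o @coneop p 0) c = idfun c by [].
apply: eq_linear_supp cA _ => s sA /=.
rewrite [coneop _ _]lextU bdU big_ord_recl big_ord0 addr0 expr0 scale1r.
by rewrite face0_topcone //; exact: star_conable pA sA.
Qed.

Lemma bd_coneop p A n (c : chain T n.+1) : star p A -> inch A c ->
  bd (coneop p c) = c - coneop p (bd c).
Proof.
move=> pA cA.
suff : (@bd R T n.+1 \o @coneop p n.+1) c = (idfun \- (@coneop p n \o @bd R T n)) c by [].
apply: eq_linear_supp cA _ => s sA /=.
have sc := star_conable pA sA.
rewrite [coneop _ (mkmalgU _ _)]lextU !bdU big_ord_recl expr0 scale1r face0_topcone //.
congr (_ + _); rewrite [coneop _ _]lext_sum -sumrN; apply: eq_bigr => i _.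
by rewrite face_topcone // lift0 exprS mulN1r scaleNr.
Qed.

Lemma star_acyclic p A n : star p A -> @acyclic R X A n.
Proof.
move=> pA c cc cA; exists (coneop p c).
  by apply: supp_lext cA => s sA; apply: suppU; exact: ins_topcone.
case: n c cc cA => [|n] c /= cc cA; first exact: bd_coneop0 pA cA.
by rewrite (bd_coneop pA cA) cc [coneop p 0]linear0 subr0.
Qed.

End StarShaped.

(** * Homology of the sphere *)

Section SphereHomology.
Variables (R : realType) (X : topologicalType) (m : nat).
Variables (f : X -> 'rV[R]_m) (N : 'rV[R]_m -> X) (B : R).
Hypotheses (cf : continuous f) (B_ge0 : 0 <= B) (fB : forall x, `|f x| <= B).
Hypothesis cN : forall v, v != 0 -> {for v, continuous N}.
Hypothesis fK : forall x, N (f x) = x.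
Hypothesis f_neq0 : forall x, f x != 0.
Hypothesis Nray : forall v, v != 0 -> exists2 c, 0 < c & f (N v) = c *: v.
Local Notation T := (sing R X).

Definition skel k : set X := [set x | exists2 i : 'I_m, (i < k)%N & f x 0 i != 0].
Definition hemi (e : R) (k : 'I_m) : set X :=
  skel k `|` [set x | 0 < e * f x 0 k].

Lemma skel_open k : open (skel k).
Proof.
rewrite (_ : skel k = \bigcup_(i in [set i : 'I_m | (i < k)%N])
   (fun x => f x 0 i) @^-1` [set y | y != 0]).
  apply: bigcup_open => i _; apply: open_comp; last exact: open_neq.
  by move=> x _; exact: row_coord_continuous.
by apply/seteqP; split=> x [i ik h]; exists i.
Qed.

Lemma hemi_open e k : open (hemi e k).
Proof.
apply: openU; first exact: skel_open.
rewrite (_ : mkset _ = (fun x => e * f x 0 k) @^-1` [set y | 0 < y]) //.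
apply: open_comp; last exact: open_gt.
move=> x _; apply: continuousM; first exact: cst_continuous.
exact: row_coord_continuous.
Qed.

Lemma hemi_ray e k v : v != 0 -> hemi e k (N v) <->
  (exists2 i : 'I_m, (i < k)%N & v 0 i != 0) \/ 0 < e * v 0 k.
Proof.
move=> v0; have [c c0 E] := Nray v0.
have nE i : (f (N v) 0 i != 0) = (v 0 i != 0).
  by rewrite E mxE mulf_eq0 negb_or (gt_eqF c0).
have pE : (0 < e * f (N v) 0 k) = (0 < e * v 0 k).
  by rewrite E mxE mulrCA pmulr_rgt0.
split; (case=> [[i ik h]|h]; [left; exists i => //|right]).
- by rewrite -nE.
- by rewrite -pE.
- by rewrite nE.
- by rewrite /= pE.
Qed.

(** On the segment towards the pole, a coordinate of index below [k] is only multiplied by [1 - t]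
    and stays nonzero for [t < 1]. If instead [e] times coordinate [k] is positive, it remains so.
    At [t = 1] the segment has reached the pole, which belongs to the set. *)
Lemma hemi_star e k : e * e = 1 -> star f N (e *: delta_mx 0 k) (hemi e k).
Proof.
move=> ee.
have pk : (e *: delta_mx 0 k : 'rV[R]_m) 0 k = e by rewrite !mxE !eqxx mulr1.
have vneq0 (v : 'rV[R]_m) i : v 0 i != 0 -> v != 0.
  by apply: contraNneq => ->; rewrite mxE.
have e0 : e != 0 by apply/eqP => e0; move: ee; rewrite e0 mul0r => /esym/eqP; rewrite oner_eq0.
have p0 : e *: delta_mx 0 k != 0 :> 'rV[R]_m by apply: (vneq0 _ k); rewrite pk.
have Np : hemi e k (N (e *: delta_mx 0 k)).
  by apply/hemi_ray => //; right; rewrite pk ee ltr01.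
split=> // x t xA /andP[t0 t1].
set v := t *: _ + _.
have vE i : v 0 i = t * (e * (i == k)%:R) + (1 - t) * f x 0 i by rewrite !mxE.
have [t1E|t1N] := eqVneq t 1.
  by rewrite /v t1E subrr scale0r addr0 scale1r.
have s0 : 0 < 1 - t by rewrite subr_gt0 lt_neqAle t1N.
case: xA => [[i ik fi]|fk].
  have vi : v 0 i != 0.
    rewrite vE (_ : i == k = false); last by rewrite -val_eqE /= ltn_eqF.
    by rewrite !mulr0 add0r mulf_neq0 // gt_eqF.
  have v0 := vneq0 _ _ vi; split => //.
  by apply/hemi_ray => //; left; exists i.
have vk : 0 < e * v 0 k.
  rewrite vE eqxx mulr1 mulrDr mulrCA ee mulr1 mulrCA.
  by rewrite ltr_wpDl // mulr_gt0.
have v0 : v != 0.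
  by apply: (vneq0 _ k); apply: contraTneq vk => ->; rewrite mulr0 ltxx.
by split => //; apply/hemi_ray => //; right.
Qed.

Lemma skelS (k : 'I_m) : skel k.+1 = hemi 1 k `|` hemi (-1) k.
Proof.
apply/seteqP; split=> x.
  move=> [i]; rewrite ltnS leq_eqVlt => /orP[/eqP/val_inj ->|ik] h.
    move: h; rewrite neq_lt => /orP[h|h]; [right|left]; right => /=.
      by rewrite mulN1r oppr_gt0.
    by rewrite mul1r.
  by left; left; exists i.
have sk : skel k `<=` skel k.+1 by move=> y [i ik h]; exists i => //; exact: ltnW.
case=> -[/sk//|] /= h; exists k => //; apply: contraTneq h => ->;
by rewrite mulr0 ltxx.
Qed.

Lemma skelI (k : 'I_m) : skel k = hemi 1 k `&` hemi (-1) k.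
Proof.
apply/seteqP; split=> x; first by move=> h; split; left.
case=> -[//|] /= h1 [//|] /= h2; exfalso; move: h1 h2.
by rewrite mul1r mulN1r oppr_gt0 => h1 h2; have := lt_trans h1 h2; rewrite ltxx.
Qed.

Lemma skelT : skel m = setT.
Proof.
apply/seteqP; split=> // x _; apply: contrapT => h.
have /eqP : f x = 0; last by apply/negP.
apply/rowP => i; rewrite mxE; apply: contrapT => /eqP hi; apply: h.
by exists i.
Qed.

Lemma eq_simplex0 (s t : rcar T 0) : s = t.
Proof.
apply/continuousEP => x; have [_] := set_valP x.
by rewrite big_ord0 => /esym/eqP; rewrite oner_eq0.
Qed.

Definition simplex0 : rcar T 0 := [the continuousType (dsimp R 0) X of cst (N 0)].

Lemma chain0E (c : chain T 0) : exists a : rat, c = a *: mkmalgU simplex0 1.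
Proof.
exists (\sum_(s <- msupp c) mcoeff s c); rewrite -{1}(lext_id c) lext.unlock scaler_suml.
by apply: eq_bigr => s _; rewrite (eq_simplex0 s simplex0).
Qed.

Lemma inch_simplex0 A (c : chain T 0) : inch A c.
Proof.
move=> s _ x; have [_] := set_valP x.
by rewrite big_ord0 => /esym/eqP; rewrite oner_eq0.
Qed.

Lemma inch_set0 n (c : chain T n.+1) : inch set0 c -> c = 0.
Proof.
move=> c0; rewrite -(lext_id c).
suff : lext (fun s => mkmalgU s 1) c = (\0 : chain T n.+1 -> chain T n.+1) c by [].
apply: eq_linear_supp c0 _ => s s0; exfalso.
have xD : dsimp R n.+1 (delta_mx 0 ord0).
  split=> [i|]; first by rewrite mxE ler0n.
  rewrite (bigD1 ord0) //= mxE !eqxx big1 ?addr0 // => i i0.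
  by rewrite mxE (negPf i0) andbF.
exact: (s0 (dpt xD)).
Qed.

Lemma skel0 : skel 0 = set0.
Proof. by apply/seteqP; split=> x // [i]. Qed.

(** This is the reduced homology of the sphere of dimension [k - 1], concentrated at index [k]
    because indices exceed dimensions by one. For [k = 0] the set is empty and the empty simplex is
    a cycle that bounds nothing. *)
Lemma skel_homology k : (k <= m)%N ->
  @one_dim R X (skel k) k /\ forall n, n != k -> @acyclic R X (skel k) n.
Proof.
elim: k => [_|k IH km].
  rewrite skel0; split.
    exists (mkmalgU simplex0 1); split => //; first exact: inch_simplex0.
      move=> d /inch_set0 ->; rewrite [bd 0]linear0 => /esym/eqP.
      by rewrite monalgU_eq0 oner_eq0.
    move=> c _ _; have [a ->] := chain0E c.
    by exists a, 0; [exact: supp0|rewrite subrr [bd 0]linear0].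
  move=> [//|n] _ c _ /inch_set0 ->; exists 0; [exact: supp0|exact: linear0].
have [IH1 IH2] := IH (ltnW km).
have kE : k = Ordinal km by [].
have acH e n : e * e = 1 -> @acyclic R X (hemi e (Ordinal km)) n.
  by move=> ee; apply: (star_acyclic cf B_ge0 fB cN fK); exact: hemi_star.
have ac1 n : @acyclic R X (hemi 1 (Ordinal km)) n by apply: acH; rewrite mulr1.
have acN n : @acyclic R X (hemi (-1) (Ordinal km)) n by apply: acH; rewrite mulrNN mulr1.
rewrite {1 3}kE skelI in IH1 IH2 *; rewrite {1 3}kE skelS.
split; first by apply: one_dimU => //; exact: hemi_open.
move=> [_|n nk]; last first.
  by apply: acyclicU => //; [exact: hemi_open|exact: hemi_open|exact: IH2].
(* Index 0 is outside the range of [acyclicU]; there the empty simplex bounds because the hemisphere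
   is acyclic. *)
move=> c _ _; have [d dA dE] := ac1 0%N c Logic.I (@inch_simplex0 _ c).
by exists d => //; apply: inchS dA => x; left.
Qed.

Lemma inchT n (c : chain T n) : inch setT c.
Proof. by []. Qed.

Lemma is_boundaryE n (c : singular_chain R X n) :
  is_boundary c <-> exists d : chain T n.+2, bd d = (c : chain T n.+1).
Proof. split=> -[d dE]; exists d; first by rewrite dE boundaryE.
by rewrite boundaryE dE. Qed.

(** Unreduced homology gains one class in dimension 0. For [1 < m] this dimension differs from
    [m - 1], so every Betti number is 0 or 1 and can be given as a boolean. *)
Lemma sphere_betti n : (1 < m)%N ->
  is_betti_number R X n ((n == 0%N) || (n.+1 == m)).
Proof.
move=> m1; have [h1 h2] := skel_homology (leqnn m).
rewrite skelT in h1 h2.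
have cycE n' (c : singular_chain R X n'.+1) : is_cycle c <-> cyc (c : chain T n'.+2).
  by rewrite /= boundaryE.
case: n => [|n].
  pose v : rcar T 1 := [the continuousType (dsimp R 1) X of cst (N 0)].
  have vE : bd (mkmalgU v 1) = mkmalgU simplex0 1.
    rewrite bdU big_ord_recl big_ord0 addr0 expr0 scale1r.
    by congr mkmalgU; exact: eq_simplex0.
  exists (fun=> mkmalgU v 1); split => //= [a|c _].
    rewrite big_ord_recl big_ord0 addr0 => /is_boundaryE[d dE] i.
    have /eqP := bd_bd d; rewrite dE [bd _]linearZ /= vE scaler_eq0.
    by rewrite monalgU_eq0 oner_eq0 orbF (ord1 i) => /eqP.
  (* [q] is the augmentation of [c]. Subtracting [q] times a vertex leaves a reduced cycle, which
     bounds since index 1 is not [m]. *)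
  have [q qE] := chain0E (bd (c : chain T 1)).
  have c0 : cyc (c - q *: mkmalgU v 1 : chain T 1).
    by rewrite /= bdB bdZ vE qE subrr.
  have n01 : 1%N != m by rewrite neq_ltn m1.
  have [d _ dE] := h2 _ n01 _ c0 (@inchT _ _).
  exists (fun=> q); rewrite big_ord_recl big_ord0 addr0.
  by apply/is_boundaryE; exists d.
have [mE|mN] /= := eqVneq n.+2 m.
  move: h1; rewrite -mE => -[z [zc _ znb zgen]].
  exists (fun=> z); split => [i|a|c].
  - exact/cycE.
  - rewrite big_ord_recl big_ord0 addr0 => /is_boundaryE[d dE] i.
    rewrite (ord1 i); apply: contrapT => /eqP a0.
    apply: (znb ((a ord0)^-1 *: d)); first exact: inchT.
    by rewrite bdZ dE scalerA mulVf // scale1r.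
  - move=> /cycE cc; have [q [d _ dE]] := zgen c cc (@inchT _ _).
    exists (fun=> q); rewrite big_ord_recl big_ord0 addr0.
    by apply/is_boundaryE; exists d.
exists (fun=> 0); split => [[]//|a _ []//|c /cycE cc].
have [d _ dE] := h2 _ mN _ cc (@inchT _ _).
by exists (fun=> 0); rewrite big_ord0 subr0; apply/is_boundaryE; exists d.
Qed.

End SphereHomology.

(** * Morse critical points *)

Section MorseLocal.
Variables (R : realType) (m : nat) (X : topologicalType).
Implicit Types (f : X -> R) (p : X) (U : set X) (phi : X -> 'rV[R]_m).

Lemma chart_nbhs U phi p (e : R) : local_chart U phi -> U p -> 0 < e ->
  nbhs p [set x | U x /\ `|phi x - phi p| < e].
Proof.
move=> [psi [[oU _] cphi _ _]] Up e0.
apply: filterI; first exact: open_nbhs_nbhs.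
apply: (near_subS (cphi p (mem_set Up) _ (nbhsx_ballx (phi p) e e0))) => x.
by rewrite -ball_normE /= distrC.
Qed.

Lemma chart_inv U phi p : local_chart U phi -> U p ->
  exists psi : 'rV[R]_m -> X, [/\ {in phi @` U, continuous psi},
    forall x, U x -> psi (phi x) = x &
  forall S, nbhs p S -> exists2 e : R, 0 < e &
    forall v, `|v - phi p| < e -> [/\ (phi @` U) v, S (psi v), U (psi v) & phi (psi v) = v]].
Proof.
move=> [psi [[oU oI] cphi cpsi K]] Up; exists psi; split => // [x /mem_set/K//|S Sp].
have Ip : (phi @` U) (phi p) by exists p.
have h1 : nbhs (phi p) (phi @` U) by exact: open_nbhs_nbhs.
have h2 : nbhs (phi p) (psi @^-1` S).
  by apply: (cpsi _ (mem_set Ip)); rewrite (K _ (mem_set Up)).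
have : nbhs (phi p) (phi @` U `&` psi @^-1` S) by exact: filterI.
move=> /nbhs_ballP[e /= e0 he].
exists e => // v ve.
have [Iv Sv] : (phi @` U `&` psi @^-1` S) v by apply: he; rewrite -ball_normE /= distrC.
have [x Ux xv] := Iv.
by split; [exists x| |rewrite -xv (K _ (mem_set Ux))|rewrite -xv (K _ (mem_set Ux))].
Qed.

Lemma near_row (i : 'I_m) (e : R) : 0 < e ->
  exists2 d : R, 0 < d & forall s : R, `|s| = 1 -> `|(s * d) *: (delta_mx 0 i : 'rV[R]_m)| < e.
Proof.
move=> e0; exists (e / 2) => [|s s1]; first by rewrite divr_gt0.
apply: mx_norm_ltP => // a b; rewrite !mxE normrM normrM s1 mul1r.
rewrite (gtr0_norm (divr_gt0 e0 _)) //.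
apply: (@le_lt_trans _ _ (e / 2)); last by rewrite [ltRHS]splitr ltrDl divr_gt0.
by case: (_ && _); rewrite ?normr1 ?normr0 ?mulr1 ?mulr0 // ltW ?divr_gt0.
Qed.

Lemma delta_sum (P : pred 'I_m) (i : 'I_m) (d : R) :
  \sum_(j < m | P j) (d *: (delta_mx 0 i : 'rV[R]_m)) 0 j ^+ 2 = (P i)%:R * d ^+ 2.
Proof.
rewrite big_mkcond (bigD1 i) //= big1 ?addr0; last first.
  by move=> j ji; rewrite !mxE (negPf ji) mulr0 expr0n /= if_same.
by rewrite !mxE !eqxx mulr1; case: (P i); rewrite ?mul1r ?mul0r.
Qed.

Lemma critical_below f l p S : morse_critical m f l p -> (0 < l)%N -> nbhs p S ->
  exists2 x, S x & f x < f p.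
Proof.
move=> [lm [U [phi [Up ch p0 fE]]]] l0 Sp.
have [psi [_ _ hpsi]] := chart_inv ch Up.
have [e e0 he] := hpsi _ Sp.
pose i := Ordinal (leq_trans l0 lm).
have [d d0 hd] := near_row i e0.
have := hd 1 (normr1 _); rewrite mul1r => dn.
have [|_ Sv Uv vE] := he (d *: delta_mx 0 i); first by rewrite p0 subr0.
exists (psi (d *: delta_mx 0 i)) => //.
rewrite (fE _ (mem_set Uv)) vE !delta_sum /= l0 leqNgt l0 mul1r mul0r addr0.
by rewrite ltrBlDr ltrDl exprn_gt0.
Qed.

Lemma critical_above f l p S : morse_critical m f l p -> (l < m)%N -> nbhs p S ->
  exists2 x, S x & f p < f x.
Proof.
move=> [_ [U [phi [Up ch p0 fE]]]] lm Sp.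
have [psi [_ _ hpsi]] := chart_inv ch Up.
have [e e0 he] := hpsi _ Sp.
pose i := Ordinal lm.
have [d d0 hd] := near_row i e0.
have := hd 1 (normr1 _); rewrite mul1r => dn.
have [|_ Sv Uv vE] := he (d *: delta_mx 0 i); first by rewrite p0 subr0.
exists (psi (d *: delta_mx 0 i)) => //.
rewrite (fE _ (mem_set Uv)) vE !delta_sum /= ltnn leqnn mul1r mul0r subr0.
by rewrite ltrDl exprn_gt0.
Qed.

Lemma critical_min f p : morse_critical m f 0 p -> nbhs p [set x | f p <= f x].
Proof.
move=> [_ [U [phi [Up [psi [[oU _] _ _ _]] p0 fE]]]].
apply: filterS (open_nbhs_nbhs (conj oU Up)) => x Ux /=.
by rewrite (fE _ (mem_set Ux)) big_pred0 // subr0 lerDl sumr_ge0 // => i _; exact: sqr_ge0.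
Qed.

Lemma critical_max f p : morse_critical m f m p -> nbhs p [set x | f x <= f p].
Proof.
move=> [_ [U [phi [Up [psi [[oU _] _ _ _]] p0 fE]]]].
apply: filterS (open_nbhs_nbhs (conj oU Up)) => x Ux /=.
rewrite (fE _ (mem_set Ux)) [X in _ + X]big_pred0; last by move=> i; rewrite leqNgt ltn_ord.
by rewrite addr0 gerBl sumr_ge0 // => i _; exact: sqr_ge0.
Qed.

Lemma regular_both f p S (s : R) : topologically_regular m f p -> `|s| = 1 -> nbhs p S ->
  exists2 x, S x & 0 < s * (f x - f p).
Proof.
move=> [U [phi [Up ch [i [c fE]]]]] s1 Sp.
have [psi [_ _ hpsi]] := chart_inv ch Up.
have [e e0 he] := hpsi _ Sp.
have [d d0 hd] := near_row i e0.
have [|_ Sv Uv vE] := he (phi p + (s * d) *: delta_mx 0 i).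
  by rewrite addrAC subrr add0r hd.
exists (psi (phi p + (s * d) *: delta_mx 0 i)) => //.
rewrite (fE _ (mem_set Uv)) (fE _ (mem_set Up)) vE !mxE !eqxx mulr1.
rewrite [X in s * X](_ : _ = s * d); last by ring.
by rewrite mulrA -expr2 -real_normK ?num_real // s1 expr1n mul1r.
Qed.

(* Near a regular point the sublevel set [f < f p] is connected (convex in a chart),
   whereas [saddle] says that it is separated by a coordinate hyperplane. *)
Definition saddle (s : R) f p : Prop :=
  exists U phi (i : 'I_m), [/\ U p, local_chart U phi, phi p = 0 &
    forall x, U x ->
      s * (f x - f p) = - phi x 0 i ^+ 2 + \sum_(j < m | j != i) phi x 0 j ^+ 2].

Lemma regular_not_saddle s f p : topologically_regular m f p -> ~ saddle s f p.
Proof.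
move=> [U' [phi' [Up' ch' [j [c fE']]]]] [U [phi [i [Up ch p0 fE]]]].
have [psi [_ _ hpsi]] := chart_inv ch Up.
have [psi' [cpsi' K' hpsi']] := chart_inv ch' Up'.
have [_ [[oU _] cphi _ _]] := ch.
have [e1 e10 he1] := hpsi' _ (open_nbhs_nbhs (conj oU Up)).
have [e e0 he] := hpsi _ (chart_nbhs ch' Up' e10).
have [d d0 hd] := near_row i e0.
(* The points at distance [d] on either side of the [i]-axis of the saddle chart, read in the
   regular chart. The radius [e] was chosen so that both land in the [e1]-ball there, which is
   convex and pulls back into [U]. *)
have endpoint (r : R) : `|r| = 1 -> exists a, [/\ `|a - phi' p| < e1,
    phi (psi' a) = (r * d) *: delta_mx 0 i & s * (a 0 j + c - f p) = - d ^+ 2].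
  move=> r1.
  have [|_ [U'v v1] Uv vE] := he ((r * d) *: delta_mx 0 i).
    by rewrite p0 subr0 hd.
  exists (phi' (psi ((r * d) *: delta_mx 0 i))); rewrite K' //; split => //.
  rewrite -(fE' _ (mem_set U'v)) (fE _ Uv) vE delta_sum eqxx mul0r addr0.
  rewrite !mxE !eqxx mulr1 exprMn.
  by rewrite -[r ^+ 2]real_normK ?num_real // r1 expr1n mul1r.
have [a [a1 aE af]] := endpoint (-1) (normrN1 _).
have [b [b1 bE bf]] := endpoint 1 (normr1 _).
pose w (t : R) := (1 - t) *: a + t *: b.
have w1 t : 0 <= t <= 1 -> `|w t - phi' p| < e1.
  move=> /andP[t0 t1].
  have -> : w t - phi' p = (1 - t) *: (a - phi' p) + t *: (b - phi' p).
    by apply/rowP => k; rewrite !mxE; ring.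
  have t10 : 0 <= 1 - t by rewrite subr_ge0.
  apply: le_lt_trans (ler_normD _ _) _; rewrite !normrZ (ger0_norm t0) (ger0_norm t10).
  pose M := Num.max `|a - phi' p| `|b - phi' p|.
  have Me : M < e1 by rewrite /M gt_max a1 b1.
  apply: le_lt_trans Me; rewrite (_ : M = (1 - t) * M + t * M); last by ring.
  by rewrite lerD // ler_wpM2l // /M le_max lexx ?orbT.
pose g t := phi (psi' (w t)) 0 i.
have cw : continuous w.
  move=> t.
  have c1 : {for t, continuous (fun t : R => (1 - t) *: (a : 'rV[R]_m))}.
    apply: continuousZ; last exact: cst_continuous.
    by apply: continuousB; [exact: cst_continuous|move=> ?].
  have c2 : {for t, continuous (fun t : R => t *: (b : 'rV[R]_m))}.
    by apply: continuousZ; [move=> ?|exact: cst_continuous].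
  exact: (continuousD c1 c2).
have cg : {within `[0, 1], continuous g}.
  apply: continuous_in_subspaceT => t /set_mem; rewrite /= in_itv /= => t01.
  have [Iw Uw _ _] := he1 _ (w1 _ t01).
  have h1 : {for t, continuous (psi' \o w)}.
    by apply: continuous_comp; [exact: cw|apply: cpsi'; exact: mem_set].
  have h2 : {for t, continuous (phi \o (psi' \o w))}.
    by apply: continuous_comp; [exact: h1|apply: cphi; exact: mem_set].
  have := @continuous_comp _ _ _ (phi \o (psi' \o w)) (fun v : 'rV[R]_m => v 0 i) t h2.
  by apply; exact: coord_continuous.
have g0 : g 0 = - d.
  by rewrite /g /w subr0 scale1r scale0r addr0 aE !mxE !eqxx mulr1 mulN1r.
have g1 : g 1 = d.
  by rewrite /g /w subrr scale0r add0r scale1r bE !mxE !eqxx mulr1 mul1r.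
(* Along the segment [w] the function is affine with equal end values, so [s * (f - f p)] stays at
   [- d ^+ 2]. Meanwhile the saddle coordinate [i] passes from [- d] to [d], and where it vanishes
   the saddle formula is a sum of squares. *)
have [|t t01 gt] := @IVT _ g 0 1 0 ler01 cg.
  by rewrite g0 g1 ge_min le_max oppr_le0 (ltW d0) orbT.
rewrite in_itv /= in t01.
have [Iw Uw U'w wE] := he1 _ (w1 _ t01).
have := fE _ Uw; rewrite -/(g t) gt expr0n oppr0 add0r (fE' _ (mem_set U'w)) wE.
have -> : s * (w t 0 j + c - f p) =
    (1 - t) * (s * (a 0 j + c - f p)) + t * (s * (b 0 j + c - f p)).
  by rewrite !mxE; ring.
rewrite af bf -mulrDl subrK mul1r => E.
have : 0 <= - d ^+ 2 by rewrite E sumr_ge0 // => k _; exact: sqr_ge0.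
by rewrite oppr_ge0 leNgt exprn_gt0.
Qed.

End MorseLocal.

Lemma big_ord3 (R : realType) (P : pred 'I_3) (F : 'I_3 -> R) :
  \sum_(i < 3 | P i) F i = (P ord0)%:R * F ord0 +
    ((P (lift ord0 ord0))%:R * F (lift ord0 ord0) +
     (P (lift ord0 (lift ord0 ord0)))%:R * F (lift ord0 (lift ord0 ord0))).
Proof.
rewrite big_mkcond !big_ord_recl big_ord0 /=.
by do 3 case: (P _); rewrite ?mul1r ?mul0r ?addr0 ?add0r.
Qed.

Section MorseThree.
Variables (R : realType) (X : topologicalType) (f : X -> R).

Lemma critical1_saddle p : morse_critical 3 f 1 p -> saddle 3 1 f p.
Proof.
move=> [_ [U [phi [Up ch p0 fE]]]]; exists U, phi, ord0; split => // x Ux.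
rewrite (fE _ (mem_set Ux)) mul1r.
rewrite !big_ord3 /=.
by ring.
Qed.

(** For [- f] an index 2 point has a single negative square, on the last coordinate. *)
Lemma critical2_saddle p : morse_critical 3 f 2 p -> saddle 3 (-1) f p.
Proof.
move=> [_ [U [phi [Up ch p0 fE]]]]; exists U, phi, ord_max; split => // x Ux.
rewrite (fE _ (mem_set Ux)).
have -> : (ord_max : 'I_3) = lift ord0 (lift ord0 ord0) by exact: val_inj.
rewrite !big_ord3 /=.
by ring.
Qed.

(** The index at an extremum is forced: a positive index produces lower values arbitrarily close to
    the minimum, an index below 3 higher values close to the maximum. A regular point is neither a
    local extremum nor a saddle, which excludes all four indices. *)
Lemma morse_critical_sphere pmin pmax :
  morse_critical 3 f 0 pmin -> morse_critical 3 f 3 pmax ->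
  (forall p, p <> pmin -> p <> pmax -> topologically_regular 3 f p) ->
  forall l p, morse_critical 3 f l p <-> (l = 0%N /\ p = pmin) \/ (l = 3 /\ p = pmax).
Proof.
move=> cmin cmax reg l p; split; last by case=> -[-> ->].
move=> cr; have [l3 _] := cr.
have minE : p = pmin -> l = 0%N.
  move=> pE; case: l {l3} cr => // l cr; exfalso.
  rewrite pE in cr.
  have [x] := critical_below cr (ltn0Sn _) (critical_min cmin).
  by move=> /= h1 h2; have := le_lt_trans h1 h2; rewrite ltxx.
have maxE : p = pmax -> l = 3.
  move=> pE; move: l3; rewrite leq_eqVlt => /orP[/eqP//|l3]; exfalso.
  rewrite pE in cr.
  have [x] := critical_above cr l3 (critical_max cmax).
  by move=> /= h1 h2; have := le_lt_trans h1 h2; rewrite ltxx.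
have [pE|pmin'] := pselect (p = pmin); first by left; split => //; exact: minE.
have [pE|pmax'] := pselect (p = pmax); first by right; split => //; exact: maxE.
have rp := reg p pmin' pmax'; exfalso.
case: l cr l3 {minE maxE} => [|[|[|[|//]]]] cr _.
- have [x] := regular_both rp (normrN1 _) (critical_min cr).
  by rewrite /= mulN1r oppr_gt0 subr_lt0 leNgt => /negP.
- exact: regular_not_saddle rp (critical1_saddle cr).
- exact: regular_not_saddle rp (critical2_saddle cr).
- have [x] := regular_both rp (normr1 _) (critical_max cr).
  by rewrite /= mul1r subr_gt0 leNgt => /negP.
Qed.

End MorseThree.

(** * Hausdorff and countability axioms through maps to other spaces *)

Section Countability.

Lemma rV_second_countable (R : realType) n : @second_countable 'rV[R]_n.
Proof.
pose b (qk : 'rV[rat]_n * nat) : set 'rV[R]_n :=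
  ball (\row_j ratr (qk.1 0 j) : 'rV[R]_n) qk.2.+1%:R^-1.
exists (range b).
  by apply: (card_le_trans (card_image_le _ _)); exact: countableP.
split; first by move=> _ [qk _ <-]; exact: ball_open.
move=> x V /nbhs_ballP[e /= e0 eV].
(* A ball of radius below [e / 2] whose rational centre is at most that far from [x] contains [x]
   and stays within [e] of it. *)
have [k kE] : exists k : nat, k.+1%:R^-1 < e / 2.
  have e20 : 0 < e / 2 by rewrite divr_gt0.
  have [k _ hk] := near_infty_natSinv_lt (PosNum e20).
  by exists k; apply: (hk k) => /=.
pose d : R := k.+1%:R^-1.
have d0 : 0 < d by rewrite invr_gt0 ltr0n.
have qP j : {q : rat | `|x 0 j - ratr q| < d}.
  apply: cid; have : x 0 j - d < x 0 j + d by rewrite ltrBlDr -addrA ltrDl addr_gt0.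
  move=> /rat_in_itvoo[q]; rewrite in_itv /= => /andP[q1 q2]; exists q.
  by rewrite ltr_norml ltrBrDl -ltrBrDr opprK [_ + d]addrC ltrBlDl -ltrBlDr; lra.
exists (b (\row_j sval (qP j), k)); last first.
  move=> y; rewrite /b -ball_normE /= => yq; apply: eV; rewrite -ball_normE /=.
  pose c : 'rV[R]_n := \row_j ratr ((\row_j sval (qP j) : 'rV[rat]_n) 0 j).
  rewrite -(subrK c x) -addrA; apply: le_lt_trans (ler_normD _ _) _.
  rewrite [ltRHS]splitr ltrD //; last exact: lt_trans yq kE.
  apply: mx_norm_ltP => [|i j]; first by rewrite divr_gt0.
  rewrite (ord1 i) !mxE; exact: lt_trans (svalP (qP j)) kE.
split; first by exists (\row_j sval (qP j), k).
rewrite /b -ball_normE /= distrC; apply: mx_norm_ltP => // i j.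
by rewrite (ord1 i) !mxE; exact: svalP (qP j).
Qed.

Lemma second_countable_retract (X Y : topologicalType) (F : X -> Y) (N : Y -> X) :
  continuous F -> (forall x, {for F x, continuous N}) -> cancel F N ->
  @second_countable Y -> @second_countable X.
Proof.
move=> cF cN FK [B cB [Bo Bx]].
exists ((fun b => F @^-1` b) @` B).
  exact: (card_le_trans (card_image_le _ _)).
split; first by move=> _ [b Bb <-]; apply: open_comp; [move=> x _; exact: cF|exact: Bo].
move=> x V Vx.
have NV : nbhs (F x) (N @^-1` V) by apply: (cN x); rewrite FK.
have [b [Bb bx] bV] := Bx _ _ NV.
exists (F @^-1` b); first by split => //; exists b.
by move=> y /= /bV /=; rewrite FK.
Qed.

Lemma hausdorff_inj (X Y : topologicalType) (F : X -> Y) :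
  continuous F -> injective F -> hausdorff_space Y -> hausdorff_space X.
Proof.
move=> cF iF hY p q pq; apply: iF; apply: hY => A B Ap Bq.
have [x [Ax Bx]] := pq _ _ (cF p _ Ap) (cF q _ Bq).
by exists (F x).
Qed.

End Countability.

(** * The height function on a topological 3-sphere *)

Section SphereMorse.
Variables (R : realType) (X : topologicalType).
Variables (F : X -> 'rV[R]_4) (N : 'rV[R]_4 -> X) (L : R).
Hypotheses (L0 : 0 < L) (cF : continuous F).
Hypothesis F1 : forall x, \sum_i F x 0 i ^+ 2 = 1.
Hypothesis cN : forall v, v != 0 -> {for v, continuous N}.
Hypothesis NK : forall v : 'rV[R]_4, \sum_i v 0 i ^+ 2 = 1 -> F (N v) = v.
Hypothesis FK : forall x, N (F x) = x.

Definition height (x : X) : R := L * F x 0 ord_max.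

Definition sqn n (v : 'rV[R]_n) : R := \sum_i v 0 i ^+ 2.

Lemma sqn_neq0 n (v : 'rV[R]_n) : sqn v = 1 -> v != 0.
Proof.
move=> v1; apply: contra_eq_neq v1 => ->.
by rewrite /sqn big1 ?(eq_sym 0) ?oner_neq0 // => i _; rewrite mxE expr0n.
Qed.

Lemma sqn_continuous n : continuous (@sqn n).
Proof.
move=> v; apply: continuous_sum_at => i.
apply: (@continuous_comp _ _ _ (fun v : 'rV[R]_n => v 0 i) (fun y => y ^+ 2)).
  exact: coord_continuous.
exact: exprn_continuous.
Qed.

Lemma sqn_ge0 n (v : 'rV[R]_n) : 0 <= sqn v.
Proof. by apply: sumr_ge0 => i _; exact: sqr_ge0. Qed.

Lemma sqn_split (v : 'rV[R]_4) i : sqn v = v 0 i ^+ 2 + \sum_j v 0 (lift i j) ^+ 2.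
Proof. by rewrite /sqn (bigD1_ord i). Qed.

(** A chart is verified by exhibiting an explicit parametrization [w] of the sphere over [D]. The
    inverse on [X] is [N \o w], so only formulas in coordinates remain to be checked. *)
Lemma sphere_chart (U : set X) (phi : X -> 'rV[R]_3) (w : 'rV[R]_3 -> 'rV[R]_4) D :
  open U -> open D ->
  (forall x, U x -> {for x, continuous phi}) ->
  (forall v, D v -> {for v, continuous w}) ->
  (forall x, U x -> D (phi x) /\ w (phi x) = F x) ->
  (forall v, D v -> [/\ sqn (w v) = 1, U (N (w v)) & phi (N (w v)) = v]) ->
  local_chart U phi.
Proof.
move=> oU oD cphi cw UD DU; exists (N \o w).
have -> : phi @` U = D.
  apply/seteqP; split=> [_ [x Ux <-]|v Dv]; first by have [] := UD x Ux.
  by have [_ h1 h2] := DU v Dv; exists (N (w v)).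
split=> // [x /set_mem|v /set_mem Dv|x /set_mem Ux]; first exact: cphi.
  apply: continuous_comp; first exact: cw.
  by apply: cN; apply: sqn_neq0; have [] := DU v Dv.
by rewrite /=; have [_ ->] := UD x Ux.
Qed.

Lemma half_open (s : R) i : open [set x | 0 < s * F x 0 i].
Proof.
rewrite (_ : mkset _ = (fun x => s * F x 0 i) @^-1` [set y | 0 < y]) //.
apply: open_comp; last exact: open_gt.
move=> x _; apply: continuousM; first exact: cst_continuous.
exact: row_coord_continuous.
Qed.

Lemma sqn_open n (r : R) : open [set v : 'rV[R]_n | sqn v < r].
Proof.
rewrite (_ : mkset _ = @sqn n @^-1` [set y | y < r]) //.
by apply: open_comp; [move=> v _; exact: sqn_continuous|exact: open_lt].
Qed.

Lemma sign_abs (s y : R) : s * s = 1 -> 0 < s * y -> s * Num.sqrt (y ^+ 2) = y.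
Proof.
move=> ss sy; rewrite sqrtr_sqr.
have <- : s * y = `|y|.
  rewrite -[LHS]gtr0_norm // normrM.
  suff -> : `|s| = 1 by rewrite mul1r.
  by apply/eqP; rewrite -sqrp_eq1 // real_normK ?num_real // expr2 ss.
by rewrite mulrA ss mul1r.
Qed.

(** Each half sphere is a graph over the other three coordinates. The factor [L] makes [height]
    itself one of them when [i] is not the last index: regularity allows an additive constant but no
    scaling. *)
Definition graph_chart (i : 'I_4) (x : X) : 'rV[R]_3 := \row_j (L * F x 0 (lift i j)).
Definition graph_param (s : R) (i : 'I_4) (v : 'rV[R]_3) : 'rV[R]_4 :=
  \row_k if unlift i k is Some j then L^-1 * v 0 j
         else s * Num.sqrt (1 - sqn (L^-1 *: v)).

Lemma local_graph_chart s i : s * s = 1 ->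
  local_chart [set x | 0 < s * F x 0 i] (graph_chart i).
Proof.
move=> ss.
have L0' : L != 0 by rewrite gt_eqF.
have wi v : graph_param s i v 0 i = s * Num.sqrt (1 - sqn (L^-1 *: v)).
  by rewrite mxE unlift_none.
have wl v j : graph_param s i v 0 (lift i j) = L^-1 * v 0 j by rewrite mxE liftK.
have ph x : L^-1 *: graph_chart i x = \row_j F x 0 (lift i j).
  by apply/rowP => j; rewrite !mxE mulKf.
have sq x : sqn (\row_j F x 0 (lift i j) : 'rV[R]_3) = 1 - F x 0 i ^+ 2.
  rewrite -(F1 x) -/(sqn (F x)) (sqn_split _ i) addrAC subrr add0r /sqn.
  by apply: eq_bigr => j _; rewrite mxE.
apply: (@sphere_chart _ _ (graph_param s i) [set v | sqn (L^-1 *: v) < 1]).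
- exact: half_open.
- rewrite (_ : mkset _ = (fun v : 'rV[R]_3 => L^-1 *: v) @^-1` [set v | sqn v < 1]) //.
  apply: open_comp; last exact: sqn_open.
  by move=> v _; exact: scaler_continuous.
- move=> x _; apply: mx_continuous_at => a j.
  rewrite (_ : (fun _ => _) = (fun y => L * F y 0 (lift i j))); last first.
    by apply/funext => y; rewrite mxE.
  apply: continuousM; [exact: cst_continuous|exact: row_coord_continuous].
- move=> v Dv; apply: mx_continuous_at => a k.
  have [j ->|->] := unliftP i k.
    rewrite (_ : (fun _ => _) = (fun y : 'rV[R]_3 => L^-1 * y 0 j)); last first.
      by apply/funext => y; rewrite (ord1 a) wl.
    apply: continuousM; [exact: cst_continuous|exact: coord_continuous].
  rewrite (_ : (fun _ => _) = (fun y => s * Num.sqrt (1 - sqn (L^-1 *: y)))); last first.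
    by apply/funext => y; rewrite (ord1 a) wi.
  apply: continuousM; first exact: cst_continuous.
  apply: (@continuous_comp _ _ _ (fun y : 'rV[R]_3 => 1 - sqn (L^-1 *: y)) Num.sqrt).
    apply: continuousB; first exact: cst_continuous.
    apply: (@continuous_comp _ _ _ (fun y : 'rV[R]_3 => L^-1 *: y) (@sqn 3)).
      exact: scaler_continuous.
    exact: sqn_continuous.
  exact: sqrt_continuous.
- move=> x /= Ux; rewrite ph sq; split.
    rewrite ltrBlDr ltrDl exprn_even_gt0 //=.
    by apply: contraTneq Ux => ->; rewrite mulr0 ltxx.
  apply/rowP => k; have [j ->|->] := unliftP i k.
    by rewrite wl mxE mulKf.
  by rewrite wi ph sq opprB addrCA subrr addr0 sign_abs.
- move=> v /= Dv.
  have d0 : 0 < 1 - sqn (L^-1 *: v) by rewrite subr_gt0.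
  have n1 : sqn (graph_param s i v) = 1.
    rewrite (sqn_split _ i) wi exprMn sqr_sqrtr ?(ltW d0) // expr2 ss mul1r.
    rewrite -[RHS](subrK (sqn (L^-1 *: v))); congr (_ + _).
    by apply: eq_bigr => j _; rewrite wl mxE.
  rewrite NK // wi mulrA ss mul1r sqrtr_gt0; split=> //.
  by apply/rowP => j; rewrite mxE NK // wl mulVKf.
Qed.

Lemma height_regular x i : i != ord_max -> F x 0 i != 0 ->
  topologically_regular 3 height x.
Proof.
move=> im Fi; pose s := Num.sg (F x 0 i).
have ss : s * s = 1 by rewrite -expr2 sqr_sg Fi.
exists [set x | 0 < s * F x 0 i], (graph_chart i); split.
- by rewrite /= /s -normrEsg normr_gt0.
- exact: local_graph_chart.
- have [j0 E|E] := unliftP i ord_max; last by rewrite E eqxx in im.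
  exists j0, 0 => y _.
  by rewrite addr0 mxE -E.
Qed.

(** With [t] the last coordinate times [s], the other three have squared length
    [1 - t^2 = (1 - t)(1 + t)]. Multiplying by [L / (1 + t)] leaves [L (1 - t)], exactly the
    difference in height from the pole. *)
Definition pole_chart (s : R) (x : X) : 'rV[R]_3 :=
  \row_j (F x 0 (lift ord_max j) * (Num.sqrt L / Num.sqrt (1 + s * F x 0 ord_max))).
(** The inverse of [pole_chart]: from [sqn v = L (1 - t)] one gets [t = 1 - sqn v / L] and
    [1 + t = 2 - sqn v / L]. The half sphere [t > 0] becomes the ball [sqn v < L]. *)
Definition pole_param (s : R) (v : 'rV[R]_3) : 'rV[R]_4 :=
  \row_k if unlift ord_max k is Some j
         then v 0 j * (Num.sqrt (2 - sqn v / L) / Num.sqrt L)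
         else s * (1 - sqn v / L).

Lemma sqn_lift_max x : \sum_j F x 0 (lift ord_max j) ^+ 2 = 1 - F x 0 ord_max ^+ 2.
Proof. by rewrite -(F1 x) -/(sqn (F x)) (sqn_split _ ord_max) addrAC subrr add0r. Qed.

Lemma sqn_pole_chart s x : s * s = 1 -> 0 < s * F x 0 ord_max ->
  sqn (pole_chart s x) = L * (1 - s * F x 0 ord_max).
Proof.
move=> ss sF; set t := s * _ in sF *.
have t1 : 0 < 1 + t by rewrite addr_gt0.
rewrite /sqn (eq_bigr (fun j => F x 0 (lift ord_max j) ^+ 2 * (L / (1 + t)))); last first.
  by move=> j _; rewrite mxE -/t exprMn expr_div_n !sqr_sqrtr // ltW.
rewrite -mulr_suml sqn_lift_max.
have -> : F x 0 ord_max ^+ 2 = t ^+ 2 by rewrite /t exprMn (expr2 s) ss mul1r.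
by field; rewrite gt_eqF.
Qed.

Lemma local_pole_chart s : s * s = 1 ->
  local_chart [set x | 0 < s * F x 0 ord_max] (pole_chart s).
Proof.
move=> ss.
have L0' : L != 0 by rewrite gt_eqF.
have sL0 : Num.sqrt L != 0 by rewrite gt_eqF // sqrtr_gt0.
have wi v : pole_param s v 0 ord_max = s * (1 - sqn v / L).
  by rewrite mxE unlift_none.
have wl v j : pole_param s v 0 (lift ord_max j) =
    v 0 j * (Num.sqrt (2 - sqn v / L) / Num.sqrt L) by rewrite mxE liftK.
have csq v : {for v, continuous (fun y : 'rV[R]_3 => sqn y / L)}.
  apply: continuousM; [exact: sqn_continuous|exact: cst_continuous].
apply: (@sphere_chart _ _ (pole_param s) [set v | sqn v < L]).
- exact: half_open.
- exact: sqn_open.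
- move=> x /= Ux; apply: mx_continuous_at => a j.
  rewrite (_ : (fun _ => _) = (fun y => F y 0 (lift ord_max j) *
      (Num.sqrt L / Num.sqrt (1 + s * F y 0 ord_max)))); last first.
    by apply/funext => y; rewrite mxE.
  apply: continuousM; first exact: row_coord_continuous.
  apply: continuousM; first exact: cst_continuous.
  apply: continuousV; first by rewrite gt_eqF // sqrtr_gt0 addr_gt0.
  apply: (@continuous_comp _ _ _ (fun y => 1 + s * F y 0 ord_max) Num.sqrt).
    apply: continuousD; first exact: cst_continuous.
    apply: continuousM; [exact: cst_continuous|exact: row_coord_continuous].
  exact: sqrt_continuous.
- move=> v Dv; apply: mx_continuous_at => a k.
  have [j ->|->] := unliftP ord_max k.
    rewrite (_ : (fun _ => _) = (fun y : 'rV[R]_3 => y 0 j *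
        (Num.sqrt (2 - sqn y / L) / Num.sqrt L))); last first.
      by apply/funext => y; rewrite (ord1 a) wl.
    apply: continuousM; first exact: coord_continuous.
    apply: continuousM; last exact: cst_continuous.
    apply: (@continuous_comp _ _ _ (fun y : 'rV[R]_3 => 2 - sqn y / L) Num.sqrt).
      by apply: continuousB; [exact: cst_continuous|exact: csq].
    exact: sqrt_continuous.
  rewrite (_ : (fun _ => _) = (fun y => s * (1 - sqn y / L))); last first.
    by apply/funext => y; rewrite (ord1 a) wi.
  apply: continuousM; first exact: cst_continuous.
  by apply: continuousB; [exact: cst_continuous|exact: csq].
- move=> x /= Ux; have t1 : 0 < 1 + s * F x 0 ord_max by rewrite addr_gt0.
  have E := sqn_pole_chart ss Ux.
  split; first by rewrite E gtr_pMr // ltrBlDr ltrDl.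
  have E2 : sqn (pole_chart s x) / L = 1 - s * F x 0 ord_max by rewrite E mulrC mulKf.
  apply/rowP => k; have [j ->|->] := unliftP ord_max k.
    rewrite wl E2 mxE (_ : 2 - _ = 1 + s * F x 0 ord_max); last by ring.
    by field; rewrite sL0 gt_eqF // sqrtr_gt0.
  by rewrite wi E2 opprB addrCA subrr addr0 mulrA ss mul1r.
- move=> v /= Dv.
  have d1 : sqn v / L < 1 by rewrite ltr_pdivrMr // mul1r.
  have d0 : 0 < 1 - sqn v / L by rewrite subr_gt0.
  have d2 : 0 < 2 - sqn v / L by lra.
  have n1 : sqn (pole_param s v) = 1.
    rewrite (sqn_split _ ord_max) wi exprMn (expr2 s) ss mul1r.
    rewrite (eq_bigr (fun j => v 0 j ^+ 2 * ((2 - sqn v / L) / L))); last first.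
      by move=> j _; rewrite wl exprMn expr_div_n !sqr_sqrtr // ltW.
    rewrite -mulr_suml -/(sqn v).
    by field.
  rewrite NK // wi mulrA ss mul1r; split=> //.
  apply/rowP => j; rewrite mxE NK // wl wi mulrA ss mul1r.
  rewrite (_ : 1 + (1 - _) = 2 - sqn v / L); last by ring.
  by field; rewrite sL0 gt_eqF // sqrtr_gt0.
Qed.

Definition pole (s : R) : X := N (s *: delta_mx 0 ord_max).

Lemma F_pole s : s * s = 1 -> F (pole s) = s *: delta_mx 0 ord_max.
Proof.
move=> ss; rewrite /pole NK // -/(sqn _) (sqn_split _ ord_max) big1; last first.
  by move=> j _; rewrite !mxE eq_sym (negPf (neq_lift _ _)) andbF mulr0 expr0n.
by rewrite !mxE !eqxx mulr1 expr2 ss addr0.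
Qed.

Lemma pole_chart0 s : s * s = 1 -> pole_chart s (pole s) = 0.
Proof.
move=> ss; apply/rowP => j; rewrite mxE F_pole // !mxE.
by rewrite eq_sym (negPf (neq_lift _ _)) andbF mulr0 mul0r.
Qed.

Lemma pole_dom s : s * s = 1 -> 0 < s * F (pole s) 0 ord_max.
Proof. by move=> ss; rewrite F_pole // !mxE !eqxx mulr1 ss ltr01. Qed.

Lemma height_pole s : s * s = 1 -> height (pole s) = L * s.
Proof. by move=> ss; rewrite /height F_pole // !mxE !eqxx mulr1. Qed.

Lemma height_max : morse_critical 3 height 3 (pole 1).
Proof.
have ss : 1 * 1 = 1 :> R by rewrite mulr1.
split=> //; exists [set x | 0 < 1 * F x 0 ord_max], (pole_chart 1); split.
- exact: pole_dom.
- exact: local_pole_chart.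
- exact: pole_chart0.
- move=> x /set_mem Ux; rewrite height_pole // mulr1.
  rewrite (eq_bigl predT) -?/(sqn (pole_chart 1 x)); last by move=> i /=; rewrite ltn_ord.
  rewrite [X in _ + X]big_pred0; last by move=> i; rewrite leqNgt ltn_ord.
  by rewrite sqn_pole_chart // mul1r /height; ring.
Qed.

Lemma height_min : morse_critical 3 height 0 (pole (-1)).
Proof.
have ss : -1 * -1 = 1 :> R by rewrite mulrNN mulr1.
split=> //; exists [set x | 0 < -1 * F x 0 ord_max], (pole_chart (-1)); split.
- exact: pole_dom.
- exact: local_pole_chart.
- exact: pole_chart0.
- move=> x /set_mem Ux; rewrite height_pole //.
  rewrite [X in _ - X]big_pred0 // -/(sqn (pole_chart (-1) x)).
  by rewrite sqn_pole_chart // /height; ring.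
Qed.

Lemma height_off_poles x : x <> pole (-1) -> x <> pole 1 ->
  topologically_regular 3 height x.
Proof.
move=> x1 x2.
have [[i [im Fi]]|h] := pselect (exists i, i != ord_max /\ F x 0 i != 0).
  exact: height_regular im Fi.
exfalso.
have F0 j : F x 0 (lift ord_max j) = 0.
  apply: contrapT => /eqP Fj; apply: h; exists (lift ord_max j); split => //.
  by rewrite eq_sym neq_lift.
have FE : F x = F x 0 ord_max *: delta_mx 0 ord_max.
  apply/rowP => k; rewrite !mxE; have [j ->|->] := unliftP ord_max k.
    by rewrite F0 eq_sym (negPf (neq_lift _ _)) mulr0.
  by rewrite eqxx mulr1.
have := sqn_lift_max x; rewrite big1 => [|j _]; last by rewrite F0 expr0n.
move=> /esym/eqP; rewrite subr_eq0 eq_sym sqrf_eq1 => /orP[] /eqP E.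
  by apply: x2; rewrite -[x]FK FE E.
by apply: x1; rewrite -[x]FK FE E.
Qed.

Lemma pole_neq : pole (-1) <> pole 1.
Proof.
move=> /(congr1 height); rewrite !height_pole ?mulr1 ?mulrNN ?mulr1 // => E.
have : - L = L by rewrite -[RHS]E mulrN1.
by move=> /eqP; rewrite eq_sym -addr_eq0 gt_eqF // addr_gt0.
Qed.

Lemma height_critical l p : morse_critical 3 height l p <->
  (l = 0%N /\ p = pole (-1)) \/ (l = 3 /\ p = pole 1).
Proof. exact: morse_critical_sphere height_min height_max height_off_poles l p. Qed.

Lemma F_neq0 x : F x != 0.
Proof. by apply: sqn_neq0; exact: F1. Qed.

Lemma sphere_manifold : topological_manifold R 3 X.
Proof.
split.
- by apply: (hausdorff_inj cF (can_inj FK)); exact: norm_hausdorff.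
- apply: (@second_countable_retract _ _ F N cF _ FK); last exact: rV_second_countable.
  by move=> x; apply: cN; exact: F_neq0.
- move=> x; have /eqP : F x != 0 by exact: F_neq0.
  have [[i Fi]|h] := pselect (exists i, F x 0 i != 0).
    move=> _; pose s := Num.sg (F x 0 i).
    have ss : s * s = 1 by rewrite -expr2 sqr_sg Fi.
    exists [set x | 0 < s * F x 0 i], (graph_chart i); split.
      by rewrite /= /s -normrEsg normr_gt0.
    exact: local_graph_chart.
  case; apply/rowP => i; rewrite mxE; apply: contrapT => /eqP Fi; apply: h.
  by exists i.
Qed.

Lemma height_continuous : continuous height.
Proof.
by move=> x; apply: continuousM; [exact: cst_continuous|exact: row_coord_continuous].
Qed.

Lemma height_morse : topological_morse 3 height.
Proof.
split; [exact: sphere_manifold|exact: height_continuous|move=> p].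
have [->|p1] := pselect (p = pole (-1)); first by right; exists 0%N; exact: height_min.
have [->|p2] := pselect (p = pole 1); first by right; exists 3%N; exact: height_max.
by left; exact: height_off_poles.
Qed.

Lemma F_bound x : `|F x| <= 1.
Proof.
apply/ler_addgt0Pl => e e0; apply: ltW; apply: mx_norm_ltP.
  by rewrite addr_gt0.
move=> a i; rewrite (ord1 a); apply: (@le_lt_trans _ _ 1); last by rewrite ltrDr.
rewrite -(@ler_pXn2r _ 2) ?nnegrE // expr1n real_normK ?num_real //.
by rewrite -(F1 x) (bigD1 i) //= lerDl sumr_ge0 // => j _; exact: sqr_ge0.
Qed.

Hypothesis Nray : forall v, v != 0 -> exists2 c, 0 < c & F (N v) = c *: v.

Lemma height_exact : exact_morse 3 height.
Proof.
have betti n := @sphere_betti R X 4 F N 1 cF ler01 F_bound cN FK F_neq0 Nray n isT.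
move=> l _; exists ((l == 0%N) || (l.+1 == 4)); split; last exact: betti.
have [->|l0] := eqVneq l 0%N.
  rewrite (_ : mkset _ = [set pole (-1)]); first exact: card_set1.
  apply/seteqP; split=> p /=; first by move=> /height_critical[[]|[]].
  by move=> ->; exact: height_min.
have [/eqP l3|l3] := eqVneq l 3%N.
  rewrite (eqP l3) (_ : mkset _ = [set pole 1]); first exact: card_set1.
  apply/seteqP; split=> p /=; first by move=> /height_critical[[]|[]].
  by move=> ->; exact: height_max.
rewrite (_ : mkset _ = set0); last first.
  by apply/seteqP; split=> p //= /height_critical[[/eqP]|[/eqP]]; rewrite ?(negPf l0) ?(negPf l3).
rewrite (_ : (l.+1 == 4) = false) /=; last by rewrite eqSS (negPf l3).
by rewrite II0 card_eq0.
Qed.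

Lemma height_two_critical :
  ([set x | exists l, morse_critical 3 height l x] #= `I_2)%card.
Proof.
rewrite (_ : mkset _ = [set` [fset pole (-1); pole 1]%fset]).
  by apply/card_eq_fsetP; rewrite cardfs2; case: eqP => // /pole_neq.
apply/seteqP; split=> p /=; rewrite !inE.
  by move=> [l /height_critical[[_ ->]|[_ ->]]]; rewrite eqxx ?orbT.
move=> /orP[/eqP->|/eqP->]; first by exists 0%N; exact: height_min.
by exists 3%N; exact: height_max.
Qed.

End SphereMorse.

(** * Arms in three-space *)

Section Gram.
Variable R : realType.
Local Notation i0 := (ord0 : 'I_3).
Local Notation i1 := (lift ord0 (ord0 : 'I_2) : 'I_3).
Local Notation i2 := (lift ord0 (lift ord0 (ord0 : 'I_1) : 'I_2) : 'I_3).

Lemma sum3 (F : 'I_3 -> R) : \sum_i F i = F i0 + F i1 + F i2.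
Proof. by rewrite !big_ord_recl big_ord0 addr0 addrA. Qed.

Lemma ord3P (P : 'I_3 -> Prop) : P i0 -> P i1 -> P i2 -> forall i, P i.
Proof.
move=> P0 P1 P2 i; have [j ->|->//] := unliftP ord0 i.
have [k ->|->//] := unliftP ord0 j.
by rewrite (ord1 k).
Qed.

Lemma det3 (M : 'M[R]_3) : \det M =
  M i0 i0 * (M i1 i1 * M i2 i2 - M i1 i2 * M i2 i1)
  - M i0 i1 * (M i1 i0 * M i2 i2 - M i1 i2 * M i2 i0)
  + M i0 i2 * (M i1 i0 * M i2 i1 - M i1 i1 * M i2 i0).
Proof.
rewrite (expand_det_row _ i0) sum3 /cofactor.
have det2 (A : 'M[R]_2) : \det A = A ord0 ord0 * A (lift ord0 ord0) (lift ord0 ord0)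
    - A ord0 (lift ord0 ord0) * A (lift ord0 ord0) ord0.
  rewrite (expand_det_row _ ord0) !big_ord_recl big_ord0 /cofactor !det_mx11 !mxE.
  rewrite (_ : lift (lift ord0 ord0) 0 = ord0); last exact: val_inj.
  rewrite (_ : lift ord0 0 = lift ord0 ord0); last exact: val_inj.
  by rewrite /= /bump /=; ring.
rewrite !det2 !mxE.
have -> : lift i1 (ord0 : 'I_2) = i0 by exact: val_inj.
have -> : lift i2 (ord0 : 'I_2) = i0 by exact: val_inj.
have -> : lift i1 (lift ord0 (ord0 : 'I_1)) = i2 by exact: val_inj.
have -> : lift i2 (lift ord0 (ord0 : 'I_1)) = i1 by exact: val_inj.
by rewrite /= /bump /=; ring.
Qed.

Definition row3 (x y z : R) : 'rV[R]_3 := \row_i [:: x; y; z]`_i.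
Definition mx3 (u v w : 'rV[R]_3) : 'M[R]_3 := \matrix_(i, j) nth 0 [:: u 0 j; v 0 j; w 0 j] i.

Definition dot (u v : 'rV[R]_3) : R := \sum_k u 0 k * v 0 k.

Lemma dot3 u v : dot u v = u 0 i0 * v 0 i0 + u 0 i1 * v 0 i1 + u 0 i2 * v 0 i2.
Proof. exact: sum3. Qed.

Lemma dotZl a u v : dot (a *: u) v = a * dot u v.
Proof. by rewrite !dot3 !mxE; ring. Qed.

Lemma dotZr a u v : dot u (a *: v) = a * dot u v.
Proof. by rewrite !dot3 !mxE; ring. Qed.

Lemma dot_ge0 u : 0 <= dot u u.
Proof. by apply: sumr_ge0 => i _; rewrite -expr2 sqr_ge0. Qed.

Lemma dot_eq0 u : dot u u = 0 -> u = 0.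
Proof.
move=> /eqP; rewrite psumr_eq0 => [|i _]; last by rewrite -expr2 sqr_ge0.
move=> /allP h; apply/rowP => i; rewrite mxE.
by have := h i (mem_index_enum i); rewrite /= mulf_eq0 orbb => /eqP.
Qed.

Lemma exists_orthogonal x : dot x x = 1 -> exists2 z, dot z z = 1 & dot x z = 0.
Proof.
rewrite dot3 => x1.
have [h|h] := eqVneq (x 0 i0 ^+ 2 + x 0 i1 ^+ 2) 0.
  have [x00 x10] : x 0 i0 = 0 /\ x 0 i1 = 0.
    by move/eqP: h; rewrite paddr_eq0 ?sqr_ge0 // !sqrf_eq0 => /andP[/eqP-> /eqP->].
  exists (row3 1 0 0); rewrite dot3 !mxE /=; first by ring.
  by rewrite x00 x10; ring.
have h0 : 0 < x 0 i0 ^+ 2 + x 0 i1 ^+ 2 by rewrite lt_neqAle eq_sym h addr_ge0 ?sqr_ge0.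
set r := Num.sqrt (x 0 i0 ^+ 2 + x 0 i1 ^+ 2).
have r0 : r != 0 by rewrite gt_eqF // sqrtr_gt0.
have rr : r ^+ 2 = x 0 i0 ^+ 2 + x 0 i1 ^+ 2 by rewrite sqr_sqrtr // ltW.
exists (row3 (- x 0 i1 / r) (x 0 i0 / r) 0); rewrite dot3 !mxE /=.
  transitivity ((x 0 i0 ^+ 2 + x 0 i1 ^+ 2) / r ^+ 2); last by rewrite -rr divff // expf_neq0.
  by field.
by field.
Qed.

(** Gram-Schmidt with a nonnegative second coefficient. If [y] is parallel to [x], that coefficient
    is zero and any unit vector orthogonal to [x] will do. *)
Lemma exists_frame x y : dot x x = 1 ->
  exists z, [/\ dot z z = 1, dot x z = 0 &
    y = dot x y *: x + Num.sqrt (dot y y - dot x y ^+ 2) *: z].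
Proof.
move=> x1; pose d := y - dot x y *: x.
have dd : dot d d = dot y y - dot x y ^+ 2.
  transitivity (dot y y - 2 * dot x y ^+ 2 + dot x y ^+ 2 * dot x x); last by rewrite x1; ring.
  by rewrite !dot3 !mxE ?dot3; ring.
have xd : dot x d = 0.
  transitivity (dot x y - dot x y * dot x x); last by rewrite x1; ring.
  by rewrite !dot3 !mxE ?dot3; ring.
have yE : y = dot x y *: x + d by rewrite addrC subrK.
have [d0|d0] := eqVneq (dot d d) 0.
  have [z z1 xz] := exists_orthogonal x1; exists z; split => //.
  by rewrite -dd d0 sqrtr0 scale0r addr0 {1}yE (dot_eq0 d0) addr0.
have dp : 0 < dot d d by rewrite lt_neqAle eq_sym d0 dot_ge0.
have r0 : Num.sqrt (dot d d) != 0 by rewrite gt_eqF // sqrtr_gt0.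
exists ((Num.sqrt (dot d d))^-1 *: d); split.
- transitivity (dot d d / Num.sqrt (dot d d) ^+ 2).
    by rewrite dotZl dotZr; field.
  by rewrite sqr_sqrtr ?divff ?dot_ge0.
- by rewrite dotZr xd mulr0.
- by rewrite -dd scalerA divff // scale1r.
Qed.

Definition cross (x z : 'rV[R]_3) : 'rV[R]_3 :=
  row3 (x 0 i1 * z 0 i2 - x 0 i2 * z 0 i1)
       (x 0 i2 * z 0 i0 - x 0 i0 * z 0 i2)
       (x 0 i0 * z 0 i1 - x 0 i1 * z 0 i0).

Definition rotation (Q : 'M[R]_3) : Prop := Q *m Q^T = 1%:M /\ \det Q = 1.

(** Lagrange's identity shows that the cross product has length 1, and its squared length is also
    the determinant. *)
Lemma frame_rotation x z : dot x x = 1 -> dot z z = 1 -> dot x z = 0 ->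
  rotation (mx3 x z (cross x z))^T.
Proof.
move=> x1 z1 xz; set w := cross x z.
have xw : dot x w = 0 by rewrite dot3 !mxE /=; ring.
have zw : dot z w = 0 by rewrite dot3 !mxE /=; ring.
have ww : dot w w = 1.
  transitivity (dot x x * dot z z - dot x z ^+ 2); last by rewrite x1 z1 xz; ring.
  by rewrite !dot3 !mxE /=; ring.
split.
  apply: mulmx1C; rewrite trmxK.
  have E (u v : 'rV[R]_3) i j : (forall k, mx3 x z w i k = u 0 k) ->
      (forall k, mx3 x z w j k = v 0 k) -> (mx3 x z w *m (mx3 x z w)^T) i j = dot u v.
    by move=> hu hv; rewrite mxE; apply: eq_bigr => k _; rewrite hu [X in _ * X]mxE hv.
  have r0 k : mx3 x z w i0 k = x 0 k by rewrite mxE.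
  have r1 k : mx3 x z w i1 k = z 0 k by rewrite mxE.
  have r2 k : mx3 x z w i2 k = w 0 k by rewrite mxE.
  have C u v : dot u v = dot v u by apply: eq_bigr => k _; rewrite mulrC.
  apply/matrixP; apply: ord3P; apply: ord3P.
  - by rewrite (E x x) // x1 mxE.
  - by rewrite (E x z) // xz mxE.
  - by rewrite (E x w) // xw mxE.
  - by rewrite (E z x) // C xz mxE.
  - by rewrite (E z z) // z1 mxE.
  - by rewrite (E z w) // zw mxE.
  - by rewrite (E w x) // C xw mxE.
  - by rewrite (E w z) // C zw mxE.
  - by rewrite (E w w) // ww mxE.
rewrite det_tr det3 -[RHS]ww dot3 /w !mxE /=; ring.
Qed.

(** The lower triangular normal form of three unit vectors under rotation: the first goes to the
    first axis, the second into a half-plane. When [a ^+ 2 = 1] the first two are parallel and the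
    third fixes the half-plane instead; then [D = 0] and [c = a * b]. *)
Definition canon_mx (a b c D : R) : 'M[R]_3 :=
  if a ^+ 2 == 1 then mx3 (row3 1 0 0) (row3 a 0 0) (row3 b (Num.sqrt (1 - b ^+ 2)) 0)
  else mx3 (row3 1 0 0) (row3 a (Num.sqrt (1 - a ^+ 2)) 0)
    (row3 b ((c - a * b) / Num.sqrt (1 - a ^+ 2)) (D / Num.sqrt (1 - a ^+ 2))).

Lemma mulmx_frame (U : 'M[R]_3) x z w :
  U *m (mx3 x z w)^T =
  \matrix_(i, j) nth 0 [:: dot (row i U) x; dot (row i U) z; dot (row i U) w] j.
Proof.
apply/matrixP => i; apply: ord3P; rewrite !mxE /=;
by apply: eq_bigr => k _; rewrite !mxE.
Qed.

Lemma cauchy_schwarz x y : dot x x = 1 -> dot y y = 1 -> dot x y ^+ 2 <= 1.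
Proof.
move=> x1 y1; rewrite -subr_ge0.
have -> : 1 - dot x y ^+ 2 = dot (y - dot x y *: x) (y - dot x y *: x).
  transitivity (dot y y - 2 * dot x y ^+ 2 + dot x y ^+ 2 * dot x x); first by rewrite x1 y1; ring.
  by rewrite !dot3 !mxE ?dot3; ring.
exact: dot_ge0.
Qed.

Lemma canonical_form (U : 'M[R]_3) : (forall i, dot (row i U) (row i U) = 1) ->
  exists2 Q, rotation Q &
  U *m Q = canon_mx (dot (row i0 U) (row i1 U)) (dot (row i0 U) (row i2 U))
                 (dot (row i1 U) (row i2 U)) (\det U).
Proof.
move=> U1; set x := row i0 U; set y := row i1 U; set r := row i2 U.
have dotDl u v (a b : R) t : dot (a *: u + b *: v) t = a * dot u t + b * dot v t.
  by rewrite !dot3 !mxE; ring.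
have C u v : dot u v = dot v u by apply: eq_bigr => k _; rewrite mulrC.
have xw z : dot x (cross x z) = 0 by rewrite dot3 !mxE /=; ring.
have zw z : dot z (cross x z) = 0 by rewrite dot3 !mxE /=; ring.
rewrite /canon_mx; case: ifP => [/eqP a1|/eqP/eqP a1].
  have [z [z1 xz rE]] := exists_frame r (U1 i0 : dot x x = 1).
  have yE : y = dot x y *: x.
    have [t [_ _ yE]] := exists_frame y (U1 i0 : dot x x = 1).
    by rewrite {1}yE (U1 i1 : dot y y = 1) a1 subrr sqrtr0 scale0r addr0.
  exists (mx3 x z (cross x z))^T; first exact: (frame_rotation (U1 i0)).
  rewrite mulmx_frame.
  rewrite (U1 i2 : dot r r = 1) in rE.
  apply/matrixP; apply: ord3P; apply: ord3P; rewrite !mxE /=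
    -?/x -?/y -?/r ?(U1 i0) ?xz ?xw //.
  - by rewrite yE dotZl xz mulr0.
  - by rewrite yE dotZl xw mulr0.
  - by rewrite {1}rE dotDl xz z1; ring.
  - by rewrite {1}rE dotDl xw zw; ring.
have [z [z1 xz yE]] := exists_frame y (U1 i0 : dot x x = 1).
rewrite (U1 i1 : dot y y = 1) in yE.
set s := Num.sqrt _ in yE *.
have s0 : s != 0.
  rewrite gt_eqF // sqrtr_gt0 subr_gt0 lt_neqAle a1 /=.
  exact: (cauchy_schwarz (U1 i0) (U1 i1)).
have rot := frame_rotation (U1 i0 : dot x x = 1) z1 xz.
exists (mx3 x z (cross x z))^T => //.
have rz : dot r z = (dot y r - dot x y * dot x r) / s.
  by rewrite {1}yE dotDl [dot z r]C; field.
have dU : \det (U *m (mx3 x z (cross x z))^T) = \det U.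
  by rewrite det_mulmx (proj2 rot) mulr1.
have yz : dot y z = s by rewrite {1}yE dotDl xz z1; ring.
have yw : dot y (cross x z) = 0 by rewrite {1}yE dotDl xw zw; ring.
(* After the rotation the matrix is lower triangular with diagonal 1, [s] and this entry, so the
   determinant determines it. *)
have rw : dot r (cross x z) = \det U / s.
  apply: (mulfI s0); rewrite [RHS]mulrC divfK //.
  rewrite -dU mulmx_frame det3 !mxE /= -/x -/y -/r (U1 i0) xz xw yz yw; ring.
rewrite mulmx_frame.
apply/matrixP; apply: ord3P; apply: ord3P; rewrite !mxE /=
    -?/x -?/y -?/r ?(U1 i0) ?xz ?xw ?yz ?yw ?rz ?rw //.
Qed.

End Gram.

(** * Gram invariants as coordinates on the 3-sphere *)

Section GramSphere.
Variable R : realType.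
Local Notation i0 := (ord0 : 'I_3).
Local Notation i1 := (lift ord0 (ord0 : 'I_2) : 'I_3).
Local Notation i2 := (lift ord0 (lift ord0 (ord0 : 'I_1) : 'I_2) : 'I_3).
Implicit Types (U Q : 'M[R]_3) (a b c : R).

Definition unit_rows U : Prop := forall i, dot (row i U) (row i U) = 1.

Lemma gram_rotation U Q i j : rotation Q ->
  dot (row i (U *m Q)) (row j (U *m Q)) = dot (row i U) (row j U).
Proof.
move=> [QQ _].
have E (V : 'M[R]_3) : dot (row i V) (row j V) = (V *m V^T) i j.
  by rewrite mxE; apply: eq_bigr => k _; rewrite !mxE.
by rewrite !E trmx_mul mulmxA -(mulmxA U) QQ mulmx1.
Qed.

Lemma gram_det U : unit_rows U ->
  \det U ^+ 2 = 1 - (dot (row i0 U) (row i1 U) ^+ 2 + dot (row i0 U) (row i2 U) ^+ 2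
    + dot (row i1 U) (row i2 U) ^+ 2)
    + 2 * (dot (row i0 U) (row i1 U) * dot (row i0 U) (row i2 U) * dot (row i1 U) (row i2 U)).
Proof.
move=> U1; rewrite expr2 -{2}det_tr -det_mulmx.
have E i j : (U *m U^T) i j = dot (row i U) (row j U).
  by rewrite mxE; apply: eq_bigr => k _; rewrite !mxE.
have C u v : dot u v = dot v u :> R by apply: eq_bigr => k _; rewrite mulrC.
rewrite det3 !E !U1 (C (row i1 U) (row i0 U)) (C (row i2 U) (row i0 U)).
by rewrite (C (row i2 U) (row i1 U)); ring.
Qed.

Definition q3 a b c : R := a ^+ 2 + b ^+ 2 + c ^+ 2.

Lemma q3_ge0 a b c : 0 <= q3 a b c.
Proof. by rewrite /q3 !addr_ge0 ?sqr_ge0. Qed.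

Lemma q3_eq0 a b c : q3 a b c = 0 -> [/\ a = 0, b = 0 & c = 0].
Proof.
move/eqP; rewrite /q3 paddr_eq0 ?addr_ge0 ?sqr_ge0 // paddr_eq0 ?sqr_ge0 // !sqrf_eq0.
by move=> /andP[/andP[/eqP-> /eqP->] /eqP->].
Qed.

(** One factor has absolute value at most 1, and the product of the other two is at most half the
    sum of their squares. Adding the three choices of that factor gives the bound. *)
Lemma amgm3 a b c : a ^+ 2 <= 1 -> b ^+ 2 <= 1 -> c ^+ 2 <= 1 -> 3 * (a * b * c) <= q3 a b c.
Proof.
have H (x y z : R) : z ^+ 2 <= 1 -> x * y * z <= (x ^+ 2 + y ^+ 2) / 2.
  move=> z1; have {}z1 : `|z| <= 1 by rewrite -(@expr_le1 _ 2 `|z|) // real_normK ?num_real.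
  apply: (@le_trans _ _ (`|x| * `|y|)).
    apply: le_trans (ler_norm _) _; rewrite !normrM.
    by rewrite -[leRHS]mulr1 ler_wpM2l // mulr_ge0.
  have := sqr_ge0 (`|x| - `|y|); rewrite -(real_normK (num_real x)) -(real_normK (num_real y)).
  set X := `|x|; set Y := `|y| => h; lra.
move=> a1 b1 c1; have := H a b c c1; have := H b c a a1; have := H a c b b1.
rewrite /q3; lra.
Qed.

(** Here [q] and [p] stand for the squared length and the product of three numbers, which scale by
    [mu ^+ 2] and [mu ^+ 3]. The two inequalities are [amgm3] at the two points of the ray, the
    second divided by [mu ^+ 2]. *)
Lemma ray_unique (q p mu : R) : 0 < q -> 0 < mu -> 3 * p <= q -> 3 * (mu * p) <= q ->
  q - 2 * p = mu ^+ 2 * q - 2 * (mu ^+ 3 * p) -> mu = 1.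
Proof.
move=> q0 mu0 pq mpq E; apply/eqP; rewrite -subr_eq0; apply/negPn/negP => m1.
have X0 : (mu + 1) * q - 2 * ((mu ^+ 2 + mu + 1) * p) = 0.
  apply: (mulfI m1); rewrite mulr0.
  transitivity (mu ^+ 2 * q - 2 * (mu ^+ 3 * p) - (q - 2 * p)); first by ring.
  by rewrite -E subrr.
have [p0|p0] := leP p 0.
  have h1 : 0 < (mu + 1) * q by rewrite mulr_gt0 // addr_gt0.
  have h2 : (mu ^+ 2 + mu + 1) * p <= 0.
    by rewrite mulr_ge0_le0 // !addr_ge0 ?sqr_ge0 ?ltW.
  lra.
(* The inequalities give [(mu + 1) q >= 3 (mu^2 + 1) p], which exceeds [2 (mu^2 + mu + 1) p] by
   [(mu - 1)^2 p]. This contradicts [X0]. *)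
have h : 0 < (mu - 1) ^+ 2 * p by rewrite mulr_gt0 // lt_neqAle eq_sym sqrf_eq0 m1 sqr_ge0.
have h1 : mu * (3 * (mu * p)) <= mu * q by rewrite ler_pM2l.
have E1 : (mu - 1) ^+ 2 * p = mu * (mu * p) - 2 * (mu * p) + p by ring.
have E2 : (mu ^+ 2 + mu + 1) * p = mu * (mu * p) + mu * p + p by ring.
have E3 : (mu + 1) * q = mu * q + q by ring.
have E4 : mu * (3 * (mu * p)) = 3 * (mu * (mu * p)) by ring.
rewrite E1 in h; rewrite E2 E3 in X0; rewrite E4 in h1.
lra.
Qed.

(* Rescales the Gram vector so that, together with the determinant, it becomes a unit
   vector: by [gram_det], [q3 a b c - 2 a b c = 1 - det^2]. *)
Definition hfac a b c : R := Num.sqrt ((q3 a b c - 2 * (a * b * c)) / q3 a b c).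

Lemma hfac_sq a b c : 3 * (a * b * c) <= q3 a b c ->
  hfac a b c ^+ 2 * q3 a b c = q3 a b c - 2 * (a * b * c).
Proof.
move=> h; have q0 := q3_ge0 a b c.
have [qE|qN] := eqVneq (q3 a b c) 0.
  by have [-> -> ->] := q3_eq0 qE; rewrite /q3 !expr0n /=; ring.
have qp : 0 < q3 a b c by rewrite lt_neqAle eq_sym qN q0.
rewrite /hfac sqr_sqrtr ?divfK // divr_ge0 //; lra.
Qed.

Lemma hfac_gt0 a b c : 3 * (a * b * c) <= q3 a b c -> 0 < q3 a b c -> 0 < hfac a b c.
Proof. by move=> h qp; rewrite sqrtr_gt0 divr_gt0 //; lra. Qed.

Lemma hfac_inj a b c a' b' c' :
  3 * (a * b * c) <= q3 a b c -> 3 * (a' * b' * c') <= q3 a' b' c' ->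
  a * hfac a b c = a' * hfac a' b' c' -> b * hfac a b c = b' * hfac a' b' c' ->
  c * hfac a b c = c' * hfac a' b' c' -> [/\ a = a', b = b' & c = c'].
Proof.
move=> h h' ea eb ec.
have := hfac_sq h; have := hfac_sq h'.
have := @hfac_gt0 _ _ _ h; have := @hfac_gt0 _ _ _ h'.
set k := hfac a b c in ea eb ec *; set k' := hfac a' b' c' in ea eb ec *.
move=> k'0 k0 kq' kq.
have kk : k ^+ 2 * q3 a b c = k' ^+ 2 * q3 a' b' c'.
  transitivity ((a * k) ^+ 2 + (b * k) ^+ 2 + (c * k) ^+ 2); first by rewrite /q3; ring.
  by rewrite ea eb ec /q3; ring.
have E : q3 a b c - 2 * (a * b * c) = q3 a' b' c' - 2 * (a' * b' * c').
  by rewrite -kq -kq' kk.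
have q0 := q3_ge0 a b c; have q0' := q3_ge0 a' b' c'.
have [qE|qN] := eqVneq (q3 a b c) 0.
  have [A B C] := q3_eq0 qE.
  have qE' : q3 a' b' c' = 0.
    apply/eqP; rewrite eq_le q0' andbT.
    by move: E; rewrite qE A B C !mul0r mulr0; lra.
  by have [-> -> ->] := q3_eq0 qE'; rewrite A B C.
have qp : 0 < q3 a b c by rewrite lt_neqAle eq_sym qN q0.
have qp' : 0 < q3 a' b' c'.
  rewrite lt_neqAle eq_sym q0' andbT; apply/eqP => qE'.
  have [A B C] := q3_eq0 qE'.
  by move: E; rewrite qE' A B C !mul0r mulr0; lra.
have {}k0 := k0 qp; have {}k'0 := k'0 qp'.
have k'N : k' != 0 by rewrite gt_eqF.
(* Both factors are positive, so equal images put the two points on one ray, with ratio [mu]. *)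
pose mu := k / k'.
have mu0 : 0 < mu by rewrite divr_gt0.
have aE : a' = mu * a by rewrite /mu mulrAC [k * a]mulrC ea mulfK.
have bE : b' = mu * b by rewrite /mu mulrAC [k * b]mulrC eb mulfK.
have cE : c' = mu * c by rewrite /mu mulrAC [k * c]mulrC ec mulfK.
have mu1 : mu = 1.
  apply: (@ray_unique (q3 a b c) (a * b * c)) => //.
    have mm0 : 0 < mu ^+ 2 by rewrite exprn_gt0.
    rewrite -(ler_pM2l mm0); move: h'; rewrite aE bE cE /q3.
    by congr (_ <= _); ring.
  by rewrite E aE bE cE /q3; ring.
by rewrite aE bE cE mu1 !mul1r.
Qed.

Lemma canon_props (a b c D : R) : a ^+ 2 <= 1 -> b ^+ 2 <= 1 ->
  D ^+ 2 = 1 - q3 a b c + 2 * (a * b * c) ->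
  [/\ unit_rows (canon_mx a b c D), dot (row i0 (canon_mx a b c D)) (row i1 (canon_mx a b c D)) = a,
    dot (row i0 (canon_mx a b c D)) (row i2 (canon_mx a b c D)) = b,
    dot (row i1 (canon_mx a b c D)) (row i2 (canon_mx a b c D)) = c & \det (canon_mx a b c D) = D].
Proof.
move=> a1 b1 DE; rewrite /canon_mx /q3 in DE *; case: ifP => [/eqP aa|/eqP/eqP aN].
  have sb : Num.sqrt (1 - b ^+ 2) ^+ 2 = 1 - b ^+ 2 by rewrite sqr_sqrtr // subr_ge0.
  set s := Num.sqrt _ in sb *.
  (* With [a ^+ 2 = 1] the hypothesis on [D] reads [D ^+ 2 = - (c - a * b) ^+ 2], hence both sides
     vanish. *)
  have bac : c - a * b = 0.
    apply/eqP; rewrite -sqrf_eq0; apply/eqP.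
    have := sqr_ge0 D; rewrite DE aa => h.
    have h2 := sqr_ge0 (c - a * b).
    have E : (c - a * b) ^+ 2 = c ^+ 2 - 2 * (a * b * c) + a ^+ 2 * b ^+ 2 by ring.
    rewrite aa mul1r in E; lra.
  have D0 : D = 0.
    apply/eqP; rewrite -sqrf_eq0 DE aa.
    have -> : c = a * b by apply/eqP; rewrite -subr_eq0 bac.
    apply/eqP; transitivity (b ^+ 2 * (a ^+ 2 - 1)); first by ring.
    by rewrite aa subrr mulr0.
  split.
  - apply: ord3P; rewrite dot3 !mxE /= -!expr2 ?sb ?aa; ring.
  - by rewrite dot3 !mxE /=; ring.
  - by rewrite dot3 !mxE /=; ring.
  - rewrite dot3 !mxE /=; apply/eqP.
    by rewrite -subr_eq0 -oppr_eq0 -[X in _ == X]bac; apply/eqP; ring.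
  - by rewrite det3 !mxE /= D0; ring.
have sp : 0 < 1 - a ^+ 2 by rewrite subr_gt0 lt_neqAle aN.
have ss : Num.sqrt (1 - a ^+ 2) ^+ 2 = 1 - a ^+ 2 by rewrite sqr_sqrtr // ltW.
have s0 : Num.sqrt (1 - a ^+ 2) != 0 by rewrite gt_eqF // sqrtr_gt0.
set s := Num.sqrt _ in ss s0 *.
split.
- apply: ord3P; rewrite dot3 !mxE /= -!expr2.
  + by ring.
  + by rewrite ss; ring.
  + rewrite !expr_div_n DE ss; field.
    by rewrite gt_eqF.
- by rewrite dot3 !mxE /=; ring.
- by rewrite dot3 !mxE /=; ring.
- by rewrite dot3 !mxE /=; field.
- by rewrite det3 !mxE /=; field.
Qed.

Definition embed U : 'rV[R]_4 :=
  let a := dot (row i0 U) (row i1 U) in let b := dot (row i0 U) (row i2 U) in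
  let c := dot (row i1 U) (row i2 U) in
  \row_i nth 0 [:: a * hfac a b c; b * hfac a b c; c * hfac a b c; \det U] i.

Lemma embed_rotation U Q : rotation Q -> embed (U *m Q) = embed U.
Proof. by move=> rQ; rewrite /embed !gram_rotation // det_mulmx (proj2 rQ) mulr1. Qed.

Lemma sum4 (F : 'I_4 -> R) : \sum_i F i =
  F ord0 + F (lift ord0 i0) + F (lift ord0 i1) + F (lift ord0 i2).
Proof. by rewrite !big_ord_recl big_ord0 addr0 !addrA. Qed.

Lemma unit_amgm U : unit_rows U ->
  3 * (dot (row i0 U) (row i1 U) * dot (row i0 U) (row i2 U) * dot (row i1 U) (row i2 U)) <=
  q3 (dot (row i0 U) (row i1 U)) (dot (row i0 U) (row i2 U)) (dot (row i1 U) (row i2 U)).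
Proof. by move=> U1; apply: amgm3; apply: cauchy_schwarz; exact: U1. Qed.

Lemma embed_norm U : unit_rows U -> \sum_i embed U 0 i ^+ 2 = 1.
Proof.
move=> U1; rewrite sum4 !mxE /= gram_det //.
have := hfac_sq (unit_amgm U1); rewrite /=.
set a := dot (row i0 _) (row i1 _); set b := dot (row i0 _) (row i2 _).
set c := dot _ _; set h := hfac a b c.
rewrite !exprMn /q3 => E.
rewrite -mulrDl -mulrDl [_ * h ^+ 2]mulrC E; ring.
Qed.

(** Equal images have equal Gram entries and determinants, so both matrices rotate to the same
    [canon_mx]; the required rotation is the first of these followed by the inverse of the
    second. *)
Lemma embed_inj U U' : unit_rows U -> unit_rows U' -> embed U = embed U' ->
  exists2 Q, rotation Q & U' = U *m Q.
Proof.
move=> U1 U1' e.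
have e' i : embed U 0 i = embed U' 0 i by rewrite e.
have := e' ord0; have := e' (lift ord0 i0); have := e' (lift ord0 i1).
have := e' (lift ord0 i2); rewrite !mxE /= => eD ec eb ea.
have [Q [QQ dQ] UQ] := canonical_form U1.
have [Q' [QQ' dQ'] UQ'] := canonical_form U1'.
have [Ea Eb Ec] := hfac_inj (unit_amgm U1) (unit_amgm U1') ea eb ec.
exists (Q *m Q'^T).
  split; last by rewrite det_mulmx det_tr dQ dQ' mulr1.
  by rewrite trmx_mul trmxK mulmxA -(mulmxA Q) (mulmx1C QQ') mulmx1.
by rewrite mulmxA UQ Ea Eb Ec eD -UQ' -mulmxA QQ' mulmx1.
Qed.

(** The Gram vector is sought on the ray through the first three coordinates, at a parameter [t]
    where the determinant relation [G t = D ^+ 2] holds. The rescaling then sends it back to [v],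
    since [hfac] equals [t^-1] there. *)
Lemma embed_surj (v : 'rV[R]_4) : \sum_i v 0 i ^+ 2 = 1 ->
  exists2 U, unit_rows U & embed U = v.
Proof.
set x := v 0 ord0; set y := v 0 (lift ord0 i0); set z := v 0 (lift ord0 i1).
set D := v 0 (lift ord0 i2).
rewrite sum4 -/x -/y -/z -/D => v1.
suff [a [b [c [[a1 b1] DE ax by_ cz]]]] : exists a b c,
    [/\ a ^+ 2 <= 1 /\ b ^+ 2 <= 1, D ^+ 2 = 1 - q3 a b c + 2 * (a * b * c),
        a * hfac a b c = x, b * hfac a b c = y & c * hfac a b c = z].
  have [U1 Ua Ub Uc UD] := canon_props a1 b1 DE.
  exists (canon_mx a b c D) => //; rewrite /embed Ua Ub Uc UD ax by_ cz.
  apply/rowP => i; rewrite mxE.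
  have [j ->|-> //] := unliftP ord0 i.
  by move: j; apply: ord3P.
have DE : D ^+ 2 = 1 - q3 x y z by rewrite /q3; lra.
have [xyz0|xyz0] := eqVneq (q3 x y z) 0.
  have [-> -> ->] := q3_eq0 xyz0.
  exists 0, 0, 0; rewrite !mul0r /q3 !expr0n /= DE xyz0.
  by split=> //; rewrite ?ler01 //; ring.
have Q0 : 0 < q3 x y z by rewrite lt_neqAle eq_sym xyz0 q3_ge0.
(* At [t = M^-1] the ray leaves the cube, so every smaller parameter gives entries of absolute value
   at most 1. *)
pose M : R := Num.max `|x| (Num.max `|y| `|z|).
have xM : `|x| <= M by rewrite /M le_max lexx.
have yM : `|y| <= M by rewrite /M !le_max lexx orbT.
have zM : `|z| <= M by rewrite /M !le_max lexx !orbT.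
have M0 : 0 < M.
  rewrite lt_neqAle (le_trans _ xM) // andbT; apply/eqP => ME.
  have Z (w : R) : `|w| <= M -> w = 0 by rewrite -ME normr_le0 => /eqP.
  by move: Q0; rewrite (Z x xM) (Z y yM) (Z z zM) /q3 !expr0n /= !addr0 ltxx.
pose P := x * y * z.
pose G t : R := 1 - t ^+ 2 * q3 x y z + 2 * (t ^+ 3 * P).
have cG : continuous G.
  have cX k : continuous (fun t : R => t ^+ k) by exact: exprn_continuous.
  move=> t.
  have c1 : {for t, continuous (fun t : R => 1 - t ^+ 2 * q3 x y z)}.
    apply: continuousB; first exact: cst_continuous.
    by apply: continuousM; [exact: cX|exact: cst_continuous].
  have c2 : {for t, continuous (fun t : R => 2 * (t ^+ 3 * P))}.
    apply: continuousM; first exact: cst_continuous.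
    by apply: continuousM; [exact: cX|exact: cst_continuous].
  exact: (continuousD c1 c2).
have GE t : G t = 1 - q3 (t * x) (t * y) (t * z) + 2 * ((t * x) * (t * y) * (t * z)).
  by rewrite /G /q3 /P; ring.
(* On a face of the cube the expression is minus the square of [b - a * c]. Thus [G] falls from 1 to
   at most 0 and meets [D ^+ 2], which lies between. *)
have face (a b c : R) : a ^+ 2 = 1 -> 1 - q3 a b c + 2 * (a * b * c) <= 0.
  move=> aa; have := sqr_ge0 (b - a * c).
  have -> : (b - a * c) ^+ 2 = b ^+ 2 - 2 * (a * b * c) + a ^+ 2 * c ^+ 2 by ring.
  rewrite /q3 aa mul1r; lra.
have Mw w : `|w| = M -> (M^-1 * w) ^+ 2 = 1.
  move=> wM; rewrite exprMn -[w ^+ 2]real_normK ?num_real // wM -exprMn mulVf ?expr1n //.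
  by rewrite gt_eqF.
have G1 : G M^-1 <= 0.
  rewrite GE; have [h|[h|h]] : `|x| = M \/ `|y| = M \/ `|z| = M.
    rewrite /M; have [] := leP `|x| (Num.max `|y| `|z|); last by left.
    by have [] := leP `|y| `|z|; [right; right|right; left].
  - exact: face (Mw _ h).
  - have := face _ (M^-1 * x) (M^-1 * z) (Mw _ h); rewrite /q3; lra.
  - have := face _ (M^-1 * x) (M^-1 * y) (Mw _ h); rewrite /q3; lra.
have G0 : G 0 = 1 by rewrite /G; ring.
have Mi0 : 0 <= M^-1 by rewrite invr_ge0 ltW.
have [|t t01 Gt] := @IVT _ G 0 M^-1 (D ^+ 2) Mi0 (continuous_subspaceT cG).
  rewrite G0 ge_min le_max (le_trans G1 (sqr_ge0 _)) orbT /=.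
  by rewrite DE gerBl ltW.
rewrite in_itv /= in t01; have /andP[t0 tM] := t01.
have tw w : `|w| <= M -> (t * w) ^+ 2 <= 1.
  move=> wM; rewrite -[_ ^+ 2]real_normK ?num_real // expr_le1 // normrM (ger0_norm t0).
  by apply: le_trans (ler_pM t0 (normr_ge0 _) tM wM) _; rewrite mulVf // gt_eqF.
have tp : 0 < t.
  rewrite lt_neqAle t0 andbT; apply/eqP => tE.
  move: Gt; rewrite -tE G0 DE => /eqP.
  by rewrite eq_sym subr_eq addrC -subr_eq subrr eq_sym (negPf xyz0).
have qE : q3 (t * x) (t * y) (t * z) = t ^+ 2 * q3 x y z by rewrite /q3; ring.
have hE : hfac (t * x) (t * y) (t * z) = t^-1.
  have -> : t^-1 = Num.sqrt (t^-1 ^+ 2) by rewrite sqrtr_sqr gtr0_norm // invr_gt0.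
  congr Num.sqrt.
  have -> : q3 (t * x) (t * y) (t * z) - 2 * (t * x * (t * y) * (t * z)) = q3 x y z.
    by move: Gt; rewrite GE DE; lra.
  by rewrite qE; field; rewrite xyz0 gt_eqF.
exists (t * x), (t * y), (t * z); rewrite hE -GE Gt; split => //.
- by split; exact: tw.
- by field; rewrite gt_eqF.
- by field; rewrite gt_eqF.
- by field; rewrite gt_eqF.
Qed.

End GramSphere.

(** * Inverting a continuous bijection from a compact space onto a sphere *)

Section CompactInverse.
Variables (R : realType) (X : topologicalType).

Lemma sub_compact (Y : topologicalType) (A K : set Y) : K `<=` A -> compact K ->
  compact [set x : A | K (set_val x)].
Proof.
move=> KA /compact_near_coveringP cK; apply/compact_near_coveringP => I S P FS h.
have : \forall i \near S, forall y, K y -> forall x : A, set_val x = y -> P i x.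
  apply: (cK I S (fun i y => forall x : A, set_val x = y -> P i x) FS) => y Ky.
  pose z : A := exist (fun y => y \in A) y (mem_set (KA y Ky)).
  have [[U W] /= [Uz SW] UWP] := h z Ky.
  have [V Vy VU] := nbhs_subtype Uz.
  exists (V, W) => //= -[y' i] /= [Vy' Wi] x xy.
  by apply: (UWP (x, i)); split => //=; apply: VU; rewrite xy.
by apply: filterS => i hi x Kx; exact: hi Kx _ erefl.
Qed.

Lemma euclidean_norm_gt0 n (v : 'rV[R]_n) : v != 0 -> 0 < euclidean_norm v.
Proof.
move=> v0; rewrite /euclidean_norm sqrtr_gt0 lt_neqAle.
rewrite sumr_ge0 ?andbT => [|i _]; last exact: sqr_ge0.
apply: contraNneq v0 => /esym/eqP; rewrite psumr_eq0 => [/allP h|i _]; last exact: sqr_ge0.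
apply/eqP/rowP => i; rewrite mxE; apply/eqP; rewrite -sqrf_eq0.
exact: (h i (mem_index_enum i)).
Qed.

Lemma near_normalize n (v : 'rV[R]_n) (C : set 'rV[R]_n) : v != 0 -> closed C ->
  ~ C ((euclidean_norm v)^-1 *: v) ->
  \forall u \near v, u != 0 /\ ~ C ((euclidean_norm u)^-1 *: u).
Proof.
move=> v0 cC Cv.
have oC : open (~` C) by exact: closed_openC.
have en0 : euclidean_norm v != 0 by rewrite gt_eqF // euclidean_norm_gt0.
have cn : {for v, continuous (fun u : 'rV[R]_n => (euclidean_norm u)^-1 *: u)}.
  apply: (@continuousZ _ _ _ (fun u : 'rV[R]_n => (euclidean_norm u)^-1) id).
    apply: continuousV => //.
    apply: (@continuous_comp _ _ _ (@sqn R n) Num.sqrt).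
      exact: sqn_continuous.
    exact: sqrt_continuous.
  by move=> ?.
have h1 : \forall u \near v, sqn u != 0.
  have : nbhs (sqn v) [set y : R | y != 0].
    apply: open_nbhs_nbhs; split; first exact: open_neq.
    by move: en0; rewrite /= /euclidean_norm sqrtr_eq0 -ltNge => /lt0r_neq0.
  by move=> h; exact: sqn_continuous h.
have h2 : \forall u \near v, ~ C ((euclidean_norm u)^-1 *: u).
  exact: (cn _ (open_nbhs_nbhs (conj oC Cv))).
apply: (near_andS h1 h2) => u u0 uC; split => //.
by apply: contraNneq u0 => ->; rewrite /sqn big1 // => i _; rewrite mxE expr0n.
Qed.

Lemma sqn_normalize n (v : 'rV[R]_n) : v != 0 -> sqn ((euclidean_norm v)^-1 *: v) = 1.
Proof.
move=> v0; have n0 := euclidean_norm_gt0 v0.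
rewrite /sqn (eq_bigr (fun i => (euclidean_norm v)^-1 ^+ 2 * v 0 i ^+ 2)); last first.
  by move=> i _; rewrite mxE exprMn.
rewrite -mulr_sumr; have -> : \sum_i v 0 i ^+ 2 = euclidean_norm v ^+ 2.
  by rewrite sqr_sqrtr // sumr_ge0 // => i _; exact: sqr_ge0.
by rewrite -exprMn mulVf ?expr1n // gt_eqF.
Qed.

(** [N] normalizes a vector and takes its preimage. The complement of an open set is compact, so its
    image is closed in Euclidean space; this closedness is the continuity of [N]. *)
Lemma compact_inverse n (F : X -> 'rV[R]_n.+1) : compact [set: X] -> continuous F -> injective F ->
  (forall x, sqn (F x) = 1) -> (forall v, sqn v = 1 -> exists x, F x = v) ->
  exists N : 'rV[R]_n.+1 -> X, [/\ forall v, v != 0 -> {for v, continuous N},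
    cancel F N & forall v, v != 0 -> F (N v) = (euclidean_norm v)^-1 *: v].
Proof.
move=> cX cF iF F1 Fsurj.
have e1 : sqn (delta_mx 0 ord0 : 'rV[R]_n.+1) = 1.
  rewrite /sqn (bigD1 ord0) //= mxE !eqxx expr1n big1 ?addr0 // => i i0.
  by rewrite mxE (negPf i0) andbF expr0n.
have [x0 _] := Fsurj _ e1.
pose N v := xget x0 [set x | F x = (euclidean_norm v)^-1 *: v].
have FN v : v != 0 -> F (N v) = (euclidean_norm v)^-1 *: v.
  by move=> v0; rewrite /N; case: xgetP => [x _ //|h]; have [x /h] := Fsurj _ (sqn_normalize v0).
have FK : cancel F N.
  move=> x; apply: iF; rewrite FN; last exact: sqn_neq0.
  by rewrite /euclidean_norm -/(sqn _) F1 sqrtr1 invr1 scale1r.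
exists N; split => // v v0 V; rewrite nbhsE => -[W [oW Wv] WV].
have cC : compact (~` W).
  by apply: (subclosed_compact _ cX) => //; exact: open_closedC.
have clC : closed (F @` (~` W)).
  apply: compact_closed; first exact: norm_hausdorff.
  by apply: continuous_compact cC; exact: continuous_subspaceT.
have nC : ~ (F @` (~` W)) ((euclidean_norm v)^-1 *: v).
  by move=> [x nWx Fx]; apply: nWx; rewrite -(FK x) Fx -FN // FK.
apply: (near_subS (near_normalize v0 clC nC)) => u [u0 h]; apply: WV.
by apply: contrapT => nWu; apply: h; exists (N u) => //; exact: FN.
Qed.

Lemma sqn_euclidean n (v : 'rV[R]_n) : euclidean_norm v = 1 <-> sqn v = 1.
Proof.
split=> [h|h]; last by rewrite /euclidean_norm -/(sqn v) h sqrtr1.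
by rewrite -[LHS]sqr_sqrtr ?sqn_ge0 // -/(euclidean_norm v) h expr1n.
Qed.

Lemma sphere_homeomorphic n (F : X -> 'rV[R]_n.+1) (N : 'rV[R]_n.+1 -> X) :
  continuous F -> (forall x, sqn (F x) = 1) ->
  (forall v, v != 0 -> {for v, continuous N}) -> cancel F N ->
  (forall v, v != 0 -> F (N v) = (euclidean_norm v)^-1 *: v) ->
  homeomorphic X (sphere R n).
Proof.
move=> cF F1 cN FK FN.
have Fs x : F x \in sphere R n by apply/mem_set/sqn_euclidean.
exists (fun x => exist (fun v => v \in sphere R n) (F x) (Fs x)).
exists (fun s : sphere R n => N (set_val s)); split => [x|s|x|s].
- by apply: sub_continuous_at; exact: cF.
- have s1 := set_valP s; have s0 := sqn_neq0 ((sqn_euclidean _).1 s1).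
  have := @continuous_comp _ _ _ (fun s : sphere R n => set_val s) N s.
  by apply; [exact: set_val_continuous|exact: cN].
- exact: FK.
- have s1 := set_valP s; have s0 := sqn_neq0 ((sqn_euclidean _).1 s1).
  by apply: val_inj; rewrite /= FN // s1 invr1 scale1r.
Qed.

End CompactInverse.

(** * The moduli space of arms *)

Section ModuliSpace.
Variables (R : realType) (l : 'I_3 -> R).
Hypothesis l_gt0 : forall i, 0 < l i.
Local Notation i0 := (ord0 : 'I_3).
Local Notation i1 := (lift ord0 (ord0 : 'I_2) : 'I_3).
Local Notation i2 := (lift ord0 (lift ord0 (ord0 : 'I_1) : 'I_2) : 'I_3).
Local Notation X := (moduli_space l).

Definition armU (p : 'M[R]_(4, 3)) : 'M[R]_3 := \matrix_i ((l i)^-1 *: arm_vector p i).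

Lemma l_neq0 i : l i != 0.
Proof. by rewrite gt_eqF. Qed.

Lemma armU_unit (p : arms l) : unit_rows (armU (set_val p)).
Proof.
move=> i; have /(_ i) pl := set_valP p.
rewrite rowK dotZl dotZr.
have -> : dot (arm_vector (set_val p) i) (arm_vector (set_val p) i) = l i ^+ 2.
  rewrite -pl sqr_sqrtr; last by rewrite sumr_ge0 // => k _; exact: sqr_ge0.
  by apply: eq_bigr => k _; rewrite expr2.
by field; exact: l_neq0.
Qed.

Lemma row_arm (p : 'M[R]_(4, 3)) (i : 'I_4) :
  row i p = row ord0 p + \sum_(k < 3 | (k < i)%N) arm_vector p k.
Proof.
case: i => n; elim: n => [|n IH] n4.
  by rewrite big_pred0 // addr0; congr row; exact: val_inj.
have n3 : (n < 3)%N by [].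
rewrite (bigD1 (Ordinal n3)) //= (eq_bigl (fun k : 'I_3 => (k < n)%N)); last first.
  by move=> k; rewrite -val_eqE /=; lia.
rewrite addrCA -(IH (ltnW n4)) /arm_vector.
rewrite (_ : widen_ord _ _ = Ordinal (ltnW n4)); last exact: val_inj.
rewrite (_ : lift ord0 (Ordinal n3) = Ordinal n4); last exact: val_inj.
by rewrite subrK.
Qed.

Lemma armU_congruent (p q : arms l) Q : rotation Q ->
  armU (set_val q) = armU (set_val p) *m Q -> congruent p q.
Proof.
move=> [QQ dQ] E.
have bE i : arm_vector (set_val q) i = arm_vector (set_val p) i *m Q.
  have := congr1 (row i) E; rewrite row_mul !rowK -scalemxAl => /(congr1 ( *:%R (l i))).
  by rewrite !scalerA divff ?l_neq0 // !scale1r.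
exists (fun x => x *m Q + (row ord0 (set_val q) - row ord0 (set_val p) *m Q)).
  by exists Q, (row ord0 (set_val q) - row ord0 (set_val p) *m Q).
move=> i; rewrite (row_arm (set_val q)) (row_arm (set_val p) i) mulmxDl mulmx_suml.
rewrite [RHS]addrAC [_ + (_ - _)]addrC subrK; congr (_ + _).
by apply: eq_bigr => k _; exact: bE.
Qed.

Lemma congruent_armU (p q : arms l) : congruent p q ->
  exists2 Q, rotation Q & armU (set_val q) = armU (set_val p) *m Q.
Proof.
move=> [g [Q [v [QQ dQ gE]]] pq]; exists Q => //.
apply/row_matrixP => i; rewrite row_mul !rowK -scalemxAl; congr (_ *: _).
by rewrite /arm_vector !pq !gE opprD addrACA subrr addr0 mulmxBl.
Qed.

Definition arm_embed (p : arms l) : 'rV[R]_4 := embed (armU (set_val p)).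
Definition moduli_embed (x : X) : 'rV[R]_4 := arm_embed (repr x).

Lemma arm_embed_congruent p q : congruent p q -> arm_embed p = arm_embed q.
Proof. by move=> /congruent_armU[Q rQ E]; rewrite /arm_embed E embed_rotation. Qed.

Lemma pi_congruent (p q : arms l) :
  \pi_(moduli_space l)%qT p = \pi_(moduli_space l)%qT q <-> congruent p q.
Proof.
split=> [E|pq].
  by apply/asboolP; have /eqmodP := E.
by apply/(@eqmodP _ (congruentb_equiv l)); apply/asboolP.
Qed.

Lemma moduli_embed_pi p : moduli_embed (\pi_(moduli_space l)%qT p) = arm_embed p.
Proof. by apply: arm_embed_congruent; apply/pi_congruent; rewrite reprK. Qed.

Lemma moduli_embed_inj : injective moduli_embed.
Proof.
move=> x y E; rewrite -(reprK x) -(reprK y); apply/pi_congruent.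
have [Q rQ UQ] := embed_inj (armU_unit _) (armU_unit _) E.
exact: armU_congruent rQ UQ.
Qed.

Lemma moduli_embed_norm x : sqn (moduli_embed x) = 1.
Proof. exact: embed_norm (armU_unit _). Qed.

(** The arm that starts at the origin and has the rows of [B] as its arm vectors. *)
Definition mkarm (B : 'M[R]_3) : 'M[R]_(4, 3) := \matrix_(i < 4) \sum_(k < 3 | (k < i)%N) row k B.

Lemma arm_vector_mkarm B i : arm_vector (mkarm B) i = row i B.
Proof.
rewrite /arm_vector !rowK (bigD1 i) /=; last by rewrite /bump /=.
rewrite (eq_bigl (fun k : 'I_3 => (k < i)%N)) ?addrK // => k.
by rewrite -val_eqE /= /bump /=; lia.
Qed.

Lemma mkarm_arms B : (forall i, euclidean_norm (row i B) = l i) -> arms l (mkarm B).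
Proof. by move=> h i; rewrite arm_vector_mkarm. Qed.

Lemma euclidean_normZ n a (v : 'rV[R]_n) : 0 <= a -> euclidean_norm (a *: v) = a * euclidean_norm v.
Proof.
move=> a0; rewrite /euclidean_norm (eq_bigr (fun i => a ^+ 2 * v 0 i ^+ 2)); last first.
  by move=> i _; rewrite mxE exprMn.
by rewrite -mulr_sumr sqrtrM ?sqr_ge0 // sqrtr_sqr ger0_norm.
Qed.

Lemma moduli_embed_surj v : sqn v = 1 -> exists x, moduli_embed x = v.
Proof.
move=> /embed_surj[U U1 UE].
pose B : 'M[R]_3 := \matrix_i (l i *: row i U).
have Ba : arms l (mkarm B).
  apply: mkarm_arms => i; rewrite rowK euclidean_normZ ?ltW //.
  rewrite (_ : euclidean_norm _ = 1) ?mulr1 //; apply/sqn_euclidean.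
  by rewrite -(U1 i); apply: eq_bigr => k _; rewrite expr2.
exists (\pi_(moduli_space l)%qT (exist (fun p => p \in arms l) _ (mem_set Ba))).
rewrite moduli_embed_pi /arm_embed /= -UE; congr embed.
apply/row_matrixP => i; rewrite rowK arm_vector_mkarm rowK scalerA mulVf ?l_neq0 //.
by rewrite scale1r.
Qed.

(** Translations make the space of arms unbounded. The arms starting at the origin form a compact
    set, the continuous image of a product of three spheres, and they already represent every
    class. *)
Lemma moduli_compact : compact [set: X].
Proof.
pose K0 : set 'rV[R]_(3 * 3) :=
  [set v | forall i, euclidean_norm (row i (vec_mx v : 'M[R]_3)) = l i].
have entry_continuous i j : continuous (fun v : 'rV[R]_(3 * 3) => (vec_mx v : 'M[R]_3) i j).
  rewrite (_ : (fun _ => _) = (fun v : 'rV[R]_(3 * 3) => v 0 (mxvec_index i j))).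
    exact: coord_continuous.
  by apply/funext => v; rewrite mxE.
have cK0 : compact K0.
  apply: bounded_closed_compact.
    exists (\sum_i l i); split; [exact: num_real|move=> r lr v vK].
    apply: ltW; apply: mx_norm_ltP => [|a k].
      by apply: le_lt_trans lr; apply: sumr_ge0 => i _; exact: ltW.
    rewrite (ord1 a); case/mxvec_indexP: k => i j.
    apply: le_lt_trans lr; apply: (@le_trans _ _ (l i)); last first.
      by rewrite (bigD1 i) //= lerDl sumr_ge0 // => k _; exact: ltW.
    rewrite -(vK i) /euclidean_norm -sqrtr_sqr ler_wsqrtr // (bigD1 j) //= !mxE.
    by rewrite lerDl sumr_ge0 // => k _; exact: sqr_ge0.
  rewrite (_ : K0 = \bigcap_(i in [set: 'I_3])
      [set v | euclidean_norm (row i (vec_mx v : 'M[R]_3)) = l i]); last first.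
    by apply/seteqP; split=> v h i; [move=> _|]; exact: h.
  apply: closed_bigI => i _.
  apply: (@preimage_closed _ _ (fun v : 'rV[R]_(3 * 3) =>
    euclidean_norm (row i (vec_mx v : 'M[R]_3))) [set l i]); last exact: closed_eq.
  move=> v _.
  apply: (@continuous_comp _ _ _ (fun v : 'rV[R]_(3 * 3) =>
     \sum_k row i (vec_mx v : 'M[R]_3) 0 k ^+ 2) Num.sqrt); last exact: sqrt_continuous.
  apply: continuous_sum_at => k.
  apply: (@continuous_comp _ _ _ (fun v : 'rV[R]_(3 * 3) => row i (vec_mx v : 'M[R]_3) 0 k)
    (fun y => y ^+ 2)); last exact: exprn_continuous.
  rewrite (_ : (fun _ => _) = (fun v : 'rV[R]_(3 * 3) => (vec_mx v : 'M[R]_3) i k)).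
    exact: entry_continuous.
  by apply/funext => w; rewrite mxE.
pose mk (v : 'rV[R]_(3 * 3)) : 'M[R]_(4, 3) := mkarm (vec_mx v).
have cmk : continuous mk.
  move=> v; apply: mx_continuous_at => i j.
  rewrite (_ : (fun _ => _) = (fun y : 'rV[R]_(3 * 3) =>
      \sum_(k < 3) (if (k < i)%N then (vec_mx y : 'M[R]_3) k j else 0))).
    have ck (k : 'I_3) : {for v, continuous (fun y : 'rV[R]_(3 * 3) =>
        if (k < i)%N then (vec_mx y : 'M[R]_3) k j else 0)}.
      by case: (k < i)%N; [exact: entry_continuous|exact: cst_continuous].
    exact: continuous_sum_at ck.
  apply/funext => y; rewrite /mk mxE summxE big_mkcond /=; apply: eq_bigr => k _.
  by case: ifP => // _; rewrite mxE.
have cK : compact (mk @` K0).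
  by apply: continuous_compact cK0; exact: continuous_subspaceT.
have KA : mk @` K0 `<=` arms l by move=> _ [v vK <-]; exact: mkarm_arms.
have cK' := sub_compact KA cK.
have -> : [set: X] = \pi_(moduli_space l)%qT @` [set p : arms l | (mk @` K0) (set_val p)].
  apply/seteqP; split=> // x _.
  pose p := repr x; pose B : 'M[R]_3 := \matrix_i arm_vector (set_val p) i.
  have BK : K0 (mxvec B).
    by move=> i; rewrite mxvecK rowK; have := set_valP p; exact.
  have Ba : arms l (mkarm B) by apply: mkarm_arms => i; have := BK i; rewrite mxvecK.
  exists (exist (fun p => p \in arms l) _ (mem_set Ba)).
    by exists (mxvec B) => //; rewrite /mk mxvecK.
  (* The two arms have the same arm vectors and differ by a translation, so the rotation is the
     identity. *)
  rewrite -[RHS]reprK; apply/pi_congruent; apply: (@armU_congruent _ _ 1%:M).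
    by split; rewrite ?trmx1 ?mulmx1 ?det1.
  rewrite mulmx1; apply/row_matrixP => i.
  by rewrite !rowK /= arm_vector_mkarm rowK.
apply: continuous_compact cK'; apply: continuous_subspaceT; exact: pi_continuous.
Qed.

(** [hfac] jumps where all Gram entries vanish: its value there is 0, by division by zero, while it
    tends to 1. The product is still continuous, because [w ^+ 2 <= q3] bounds its absolute value by
    the square root of [q3 - 2abc], which tends to 0. *)
Lemma hfac_continuous (T : topologicalType) (a b c w : T -> R) x :
  {for x, continuous a} -> {for x, continuous b} -> {for x, continuous c} ->
  {for x, continuous w} -> (forall y, 3 * (a y * b y * c y) <= q3 (a y) (b y) (c y)) ->
  (forall y, w y ^+ 2 <= q3 (a y) (b y) (c y)) ->
  {for x, continuous (fun y => w y * hfac (a y) (b y) (c y))}.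
Proof.
move=> ca cb cc cw h wq.
have cX2 (u : T -> R) : {for x, continuous u} -> {for x, continuous (fun y => u y ^+ 2)}.
  move=> cu; apply: (@continuous_comp _ _ _ u (fun z => z ^+ 2)) => //.
  exact: exprn_continuous.
have cq : {for x, continuous (fun y => q3 (a y) (b y) (c y))}.
  have c1 := continuousD (cX2 _ ca) (cX2 _ cb).
  exact: continuousD c1 (cX2 _ cc).
have cp : {for x, continuous (fun y => q3 (a y) (b y) (c y) - 2 * (a y * b y * c y))}.
  have c1 := continuousM (continuousM ca cb) cc.
  apply: continuousB => //; apply: continuousM => //; exact: cst_continuous.
have csq (u : T -> R) : {for x, continuous u} -> {for x, continuous (fun y => Num.sqrt (u y))}.
  move=> cu; apply: (@continuous_comp _ _ _ u Num.sqrt) => //; exact: sqrt_continuous.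
have [qE|qN] := eqVneq (q3 (a x) (b x) (c x)) 0; last first.
  by apply: continuousM => //; apply: csq; apply: continuousM => //; exact: continuousV.
have w0 : w x = 0.
  by apply/eqP; rewrite -sqrf_eq0 eq_le sqr_ge0 andbT -qE.
have [ax bx cx] := q3_eq0 qE.
rewrite /prop_for /continuous_at w0 mul0r; apply/cvgrPdist_lt => e e0.
have := near_dist (csq _ cp) e0; rewrite qE ax !mul0r mulr0 subr0 sqrtr0.
apply: filterS => y; rewrite !sub0r !normrN => ye.
apply: le_lt_trans ye; rewrite [leRHS]ger0_norm ?sqrtr_ge0 // -sqrtr_sqr ler_wsqrtr //.
by rewrite exprMn -hfac_sq // mulrC ler_wpM2l // sqr_ge0.
Qed.

Lemma arm_embed_continuous : continuous arm_embed.
Proof.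
move=> p.
have cU i k : continuous (fun q : arms l => armU (set_val q) i k).
  move=> q; rewrite (_ : (fun _ => _) = (fun q : arms l =>
     (l i)^-1 * (set_val q (lift ord0 i) k - set_val q (widen_ord (leqnSn 3) i) k))).
    have cc (j : 'I_4) : {for q, continuous (fun q : arms l => set_val q j k)}.
      have := @continuous_comp _ _ _ (fun q : arms l => set_val q)
        (fun v : 'M[R]_(4, 3) => v j k) q.
      by apply; [exact: set_val_continuous|exact: coord_continuous].
    have c0 : {for q, continuous (fun _ : arms l => (l i)^-1)} by exact: cst_continuous.
    exact: (continuousM c0 (continuousB (cc _) (cc _))).
  by apply/funext => r; rewrite !mxE.
have cd i j : {for p, continuous (fun q : arms l =>
    dot (row i (armU (set_val q))) (row j (armU (set_val q))))}.
  apply: continuous_sum_at => k.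
  rewrite (_ : (fun _ => _) = (fun q : arms l => armU (set_val q) i k * armU (set_val q) j k)).
    by apply: continuousM; exact: cU.
  by apply/funext => q; rewrite !mxE.
have am (q : arms l) := unit_amgm (armU_unit q).
apply: mx_continuous_at => a j.
have [j' ->|->] := unliftP ord0 j; last first.
  rewrite (_ : (fun _ => _) = (fun q : arms l =>
    dot (row i0 (armU (set_val q))) (row i1 (armU (set_val q))) *
    hfac (dot (row i0 (armU (set_val q))) (row i1 (armU (set_val q))))
         (dot (row i0 (armU (set_val q))) (row i2 (armU (set_val q))))
         (dot (row i1 (armU (set_val q))) (row i2 (armU (set_val q)))))); last first.
    by apply/funext => q; rewrite mxE.
  apply: hfac_continuous; rewrite ?/cd //; try exact: cd.
  by move=> q; rewrite /q3 -addrA lerDl addr_ge0 ?sqr_ge0.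
move: j'; apply: ord3P.
- rewrite (_ : (fun _ => _) = (fun q : arms l =>
    dot (row i0 (armU (set_val q))) (row i2 (armU (set_val q))) *
    hfac (dot (row i0 (armU (set_val q))) (row i1 (armU (set_val q))))
         (dot (row i0 (armU (set_val q))) (row i2 (armU (set_val q))))
         (dot (row i1 (armU (set_val q))) (row i2 (armU (set_val q)))))); last first.
    by apply/funext => q; rewrite mxE.
  apply: hfac_continuous => //; try exact: cd.
  by move=> q; rewrite /q3 addrAC lerDr addr_ge0 ?sqr_ge0.
- rewrite (_ : (fun _ => _) = (fun q : arms l =>
    dot (row i1 (armU (set_val q))) (row i2 (armU (set_val q))) *
    hfac (dot (row i0 (armU (set_val q))) (row i1 (armU (set_val q))))
         (dot (row i0 (armU (set_val q))) (row i2 (armU (set_val q))))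
         (dot (row i1 (armU (set_val q))) (row i2 (armU (set_val q)))))); last first.
    by apply/funext => q; rewrite mxE.
  apply: hfac_continuous => //; try exact: cd.
  by move=> q; rewrite /q3 lerDr addr_ge0 ?sqr_ge0.
- rewrite (_ : (fun _ => _) = (fun q : arms l => \det (armU (set_val q)))); last first.
    by apply/funext => q; rewrite mxE.
  rewrite (_ : (fun _ => _) = (fun q : arms l => let U := armU (set_val q) in
    U i0 i0 * (U i1 i1 * U i2 i2 - U i1 i2 * U i2 i1)
    - U i0 i1 * (U i1 i0 * U i2 i2 - U i1 i2 * U i2 i0)
    + U i0 i2 * (U i1 i0 * U i2 i1 - U i1 i1 * U i2 i0))); last first.
    by apply/funext => q; rewrite det3.
  have cm (e1 e2 f1 f2 g1 g2 k1 k2 : 'I_3) : {for p, continuous (fun q : arms l =>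
      let U := armU (set_val q) in
      U e1 e2 * U f1 f2 - U g1 g2 * U k1 k2)}.
    by apply: continuousB; apply: continuousM; exact: cU.
  have cm2 (e1 e2 : 'I_3) (f : arms l -> R) : {for p, continuous f} ->
      {for p, continuous (fun q => armU (set_val q) e1 e2 * f q)}.
    by move=> cf; apply: continuousM => //; exact: cU.
  have h1 := cm2 i0 i0 _ (cm i1 i1 i2 i2 i1 i2 i2 i1).
  have h2 := cm2 i0 i1 _ (cm i1 i0 i2 i2 i1 i2 i2 i0).
  have h3 := cm2 i0 i2 _ (cm i1 i0 i2 i1 i1 i1 i2 i0).
  exact: (continuousD (continuousB h1 h2) h3).
Qed.

Lemma moduli_embed_continuous : continuous moduli_embed.
Proof.
apply: repr_comp_continuous; first exact: arm_embed_continuous.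
by move=> p q /eqP/pi_congruent pq; apply/eqP; exact: arm_embed_congruent.
Qed.

Definition arm_lengths : R := l i0 * l i1 * l i2.

(** Normalizing the arm vectors divides the determinant by the product of the lengths, by
    multilinearity. *)
Lemma signed_volume_height : @signed_volume R l = height moduli_embed arm_lengths.
Proof.
apply/funext => x; rewrite /signed_volume /height /moduli_embed /arm_embed.
have -> : (ord_max : 'I_4) = lift ord0 i2 by exact: val_inj.
rewrite [embed _ _ _]mxE /= /arm_volume !det3 /arm_lengths !mxE.
by field; rewrite !l_neq0.
Qed.

End ModuliSpace.

Theorem theorem6p2 (R : realType) (l : 'I_3 -> R) (l_gt0 : forall i, 0 < l i) :
  [/\ homeomorphic (moduli_space l) (sphere R 3),
      topological_morse 3 (@signed_volume R l),
      exact_morse 3 (@signed_volume R l) &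
      ([set x | exists lambda, morse_critical 3 (@signed_volume R l) lambda x]
        #= `I_2)%card].
Proof.
have cE := moduli_embed_continuous l_gt0.
have E1 := moduli_embed_norm l_gt0.
have [N [cN FK FN]] := compact_inverse (moduli_compact l_gt0) cE (moduli_embed_inj l_gt0) E1
  (moduli_embed_surj l_gt0).
have L0 : 0 < arm_lengths l by rewrite /arm_lengths !mulr_gt0.
have NK v : sqn v = 1 -> moduli_embed (N v) = v.
  move=> v1; rewrite FN; last exact: sqn_neq0.
  by rewrite (sqn_euclidean _).2 // invr1 scale1r.
have Nray v : v != 0 -> exists2 c, 0 < c & moduli_embed (N v) = c *: v.
  by move=> v0; exists (euclidean_norm v)^-1; rewrite ?invr_gt0 ?euclidean_norm_gt0 ?FN.
rewrite (signed_volume_height l_gt0); split.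
- exact: sphere_homeomorphic cE E1 cN FK FN.
- exact: height_morse L0 cE E1 cN NK FK.
- exact: height_exact L0 cE E1 cN NK FK Nray.
- exact: height_two_critical L0 cE E1 cN NK FK.
Qed.
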